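(* There exists an element $\zeta \in T$ such that for every nontrivial $\alpha \in T$ there exists $\gamma \in T$ such that $\langle \alpha, \zeta^\gamma \rangle = T$.
   Context: Let $\mathbb{S}^1 = \mathbb{R}/\mathbb{Z}$. Thompson's group $T$ is the group (under composition) of piecewise linear homeomorphisms of $\mathbb{S}^1$ which preserve $\mathbb{Z}[\frac12]/\mathbb{Z}$ (the image of the dyadic rationals), have finitely many breakpoints, have all gradients equal to integral powers of two (in particular gradients are positive), and have all breakpoints in $\mathbb{Z}[\frac12]/\mathbb{Z}$. Group actions are on the right, products are read from left to right, and $x^y = y^{-1}xy$. $\langle \alpha, \beta\rangle$ denotes the subgroup generated by $\alpha$ and $\beta$. *)

(* Defs.v *)
From HB Require Import structures.
From mathcomp Require Import all_boot all_order all_algebra.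
From mathcomp Require Import all_classical all_reals all_analysis.

Set Implicit Arguments.
Unset Strict Implicit.
Unset Printing Implicit Defensive.

Import Order.TTheory GRing.Theory Num.Theory.
Import numFieldNormedType.Exports.

Local Open Scope classical_set_scope.
Local Open Scope ring_scope.
Local Open Scope quotient_scope.

Record homeo (X : topologicalType) := Homeo {
  homeo_fun :> X -> X;
  homeo_inv : X -> X;
  homeo_funK : cancel homeo_fun homeo_inv;
  homeo_invK : cancel homeo_inv homeo_fun;
  homeo_fun_continuous : continuous homeo_fun;
  homeo_inv_continuous : continuous homeo_inv
}.

Section HomeoGroup.
Variable X : topologicalType.
Implicit Types f g h : homeo X.

Lemma homeo_ext f g : homeo_fun f =1 homeo_fun g -> f = g.
Proof.
case: f g => [f f' fK f'K fc f'c] [g g' gK g'K gc g'c] /= /funext fg.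
subst g; have /funext fg' : f' =1 g' by move=> x; rewrite -{1}(g'K x) fK.
by subst g'; congr Homeo; exact: Prop_irrelevance.
Qed.

Definition homeo_id : homeo X.
Proof.
by apply: (@Homeo _ idfun idfun) => // x; apply: cvg_id.
Defined.

(* The group acts on the right: f * g is "f, then g". *)
Definition homeo_mul f g : homeo X.
Proof.
apply: (@Homeo _ (g \o f) (homeo_inv f \o homeo_inv g)).
- exact: (can_comp (homeo_funK g) (homeo_funK f)).
- exact: (can_comp (homeo_invK f) (homeo_invK g)).
- move=> x; apply: continuous_comp; exact: homeo_fun_continuous.
- move=> x; apply: continuous_comp; exact: homeo_inv_continuous.
Defined.

Definition homeo_V f : homeo X :=
  Homeo (homeo_invK f) (homeo_funK f)
    (homeo_inv_continuous (h := f)) (homeo_fun_continuous (h := f)).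

Lemma homeo_mulA : associative homeo_mul.
Proof. by move=> f g h; exact: homeo_ext. Qed.

Lemma homeo_mul1g : left_id homeo_id homeo_mul.
Proof. by move=> f; exact: homeo_ext. Qed.

Lemma homeo_mulg1 : right_id homeo_id homeo_mul.
Proof. by move=> f; exact: homeo_ext. Qed.

Lemma homeo_mulVg : left_inverse homeo_id homeo_V homeo_mul.
Proof. by move=> f; apply: homeo_ext => x /=; rewrite homeo_invK. Qed.

Lemma homeo_mulgV : right_inverse homeo_id homeo_V homeo_mul.
Proof. by move=> f; apply: homeo_ext => x /=; rewrite homeo_funK. Qed.

HB.instance Definition _ := gen_eqMixin (homeo X).
HB.instance Definition _ := gen_choiceMixin (homeo X).
HB.instance Definition _ := isGroup.Build (homeo X)
  homeo_mulA homeo_mul1g homeo_mulg1 homeo_mulVg homeo_mulgV.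

End HomeoGroup.

Definition generated (G : groupType) (A : set G) : set G :=
  smallest (fun H : set G => group_closed [in H]) A.

Section Circle.
Variable R : realType.

(* The predicate underlying [Num.int], as an additive subgroup of R. *)
Definition integers : zmodClosed R :=
  GRing.ZmodClosed.clone R (@Num.int_num_subdef R) _.

Definition circle : Type := quotient_topology (Quotient.quot integers).
HB.instance Definition _ := Topological.on circle.
HB.instance Definition _ := Quotient.on circle.
HB.instance Definition _ := GRing.isZmodule.Build circle
  (@Quotient.addqA _ integers) (@Quotient.addqC _ integers)
  (@Quotient.add0q _ integers) (@Quotient.addNq _ integers).

Definition circle_pi (x : R) : circle := \pi_circle x.

(* The image of Z[1/2] in R / Z. *)
Definition dyadic_points : set circle :=
  [set circle_pi (m%:~R / 2 ^+ n) | m in [set: int] & n in [set: nat]].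

(* f is affine of gradient a on a two-sided neighbourhood of p. *)
Definition has_gradient (f : circle -> circle) (p : circle) (a : R) : Prop :=
  \forall t \near (0 : R), f (p + circle_pi t) = f p + circle_pi (a * t).

(* By compactness, a homeomorphism of the circle is piecewise linear with
   finitely many pieces iff this set is finite. *)
Definition breakpoints (f : circle -> circle) : set circle :=
  [set p | ~ exists a, has_gradient f p a].

Definition thompsonT : set (homeo circle) := [set f |
  [/\ f @` dyadic_points = dyadic_points,
      finite_set (breakpoints f),
      forall p a, has_gradient f p a -> exists k : int, a = 2 ^ k &
      breakpoints f `<=` dyadic_points]].

End Circle.

Arguments thompsonT : clear implicits.

(* Main.v *)
(* An element of T lifts to a piecewise linear homeomorphism of the line that
   commutes with the full turn.  Let zeta be a quarter turn composed with a
   one-bump map f, so that zeta^4 consists of four disjoint copies of f.  A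
   nontrivial alpha moves some small arc off itself; after conjugation this arc
   contains one quarter of the circle, alpha maps it onto the support I of the
   next copy of f, and it carries the first copy of f to a smaller bump a inside
   I.  There f and its conjugate act as f and a, the bumps a and a^f overlap, and
   they generate the copy of Thompson's group F on the union A of their supports.
   A commutator of zeta^4 and its conjugate (corrected by one more commutator if
   alpha has order two) is supported on A.  The elements of the generated
   group H that are supported on A thus form a nontrivial normal subgroup of the
   copy of F on A, so they include everything compactly supported in the interior
   of A.  Moving A around the circle with H and gluing overlapping arcs, H
   contains every element supported on a proper arc, and these generate T. *)

Require Import Defs.
From HB Require Import structures.
From mathcomp Require Import all_boot all_order all_algebra.
From mathcomp Require Import all_classical all_reals all_analysis.
From mathcomp Require Import ring lra zify.

Set Implicit Arguments.
Unset Strict Implicit.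
Unset Printing Implicit Defensive.

Import Order.TTheory GRing.Theory Num.Theory.
Import numFieldNormedType.Exports.
Local Open Scope classical_set_scope.
Local Open Scope ring_scope.

(** * Dyadic numbers and piecewise linear maps with dyadic data *)

Section Dyadic.
Variable R : realType.
Implicit Types (x y a b c : R) (k : int) (n : nat).

(** Since zeta is fixed before alpha is known, only gamma can adapt. If alpha moves an arc off
    itself, conjugation can turn its restriction to that arc into any prescribed map, because source
    and target are disjoint; elsewhere nothing is controlled. So gamma also crowds all four supports
    of zeta^4 into that arc and part of its image; then alpha carries the unwanted copies of f to
    places where zeta^4 is trivial. The map f is translation by 1 on [[0, 2]], so that it takes the
    bump a on [[0, 2]] to a bump b on [[1, 3]]; in the usual generators of F these are x0 x1^-1 and
    x1. The prescribed form of alpha is found by solving alpha f = a alpha piece by piece. Order two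
    is exceptional because alpha then carries I back to the first copy, and the commutator acts
    there as well. The full turn is trivial on the circle, so the subgroups of lifts in question
    contain it: lifts may be changed by whole turns, and zeta^4 may be divided by one. *)

Definition dyadic x := exists m : int, exists n : nat, x = m%:~R / 2 ^+ n.

Lemma pow2_gt0 k : 0 < (2 : R) ^ k.
Proof. by rewrite exprz_gt0. Qed.

Lemma dyadic_int (m : int) : dyadic m%:~R.
Proof. by exists m, 0%N; rewrite expr0 divr1. Qed.

Lemma dyadicD x y : dyadic x -> dyadic y -> dyadic (x + y).
Proof.
move=> [m [n ->]] [m' [n' ->]]; exists (m * 2 ^+ n' + m' * 2 ^+ n), (n + n')%N.
rewrite rmorphD /= !rmorphM /= !rmorphXn /= exprD.
have h1 : (2 : R) ^+ n != 0 by rewrite expf_neq0.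
have h2 : (2 : R) ^+ n' != 0 by rewrite expf_neq0.
by field; rewrite h1 h2.
Qed.

Lemma dyadicM x y : dyadic x -> dyadic y -> dyadic (x * y).
Proof.
move=> [m [n ->]] [m' [n' ->]]; exists (m * m'), (n + n')%N.
rewrite rmorphM /= exprD.
have h1 : (2 : R) ^+ n != 0 by rewrite expf_neq0.
have h2 : (2 : R) ^+ n' != 0 by rewrite expf_neq0.
by field; rewrite h1 h2.
Qed.

Lemma dyadicN x : dyadic x -> dyadic (- x).
Proof. by move=> [m [n ->]]; exists (- m), n; rewrite rmorphN mulNr. Qed.

Lemma dyadicB x y : dyadic x -> dyadic y -> dyadic (x - y).
Proof. by move=> dx dy; apply: dyadicD => //; exact: dyadicN. Qed.

Lemma dyadic_nat n : dyadic n%:R.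
Proof. exact: (dyadic_int n). Qed.

Lemma dyadic_div2n (m : int) n : dyadic (m%:~R / 2 ^+ n).
Proof. by exists m, n. Qed.

Lemma dyadicVn n : dyadic (2 ^+ n)^-1.
Proof. by exists 1, n; rewrite mul1r. Qed.

Lemma dyadic_pow2 k : dyadic (2 ^ k).
Proof.
case: k => n; first by rewrite -exprnP -natrX; exact: dyadic_nat.
exact: (dyadicVn n.+1).
Qed.

Lemma dyadic_half x : dyadic x -> dyadic (x / 2).
Proof. by move=> dx; apply: dyadicM => //; exact: (dyadicVn 1). Qed.

Lemma dyadic_affine k x c : dyadic x -> dyadic c -> dyadic (2 ^ k * x + c).
Proof. by move=> dx dc; apply: dyadicD => //; apply: dyadicM => //; exact: dyadic_pow2. Qed.

Lemma pow2_ltn x : exists n, x < 2 ^+ n.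
Proof.
exists (Num.truncn `|x|).+1.
apply: (le_lt_trans (ler_norm x)); have := truncnS_gt `|x|.
move/lt_le_trans; apply; rewrite -natrX ler_nat; exact/ltnW/ltn_expl.
Qed.

Lemma dyadic_dense x y : x < y -> exists d, [/\ dyadic d, x < d & d < y].
Proof.
move=> xy; have [n hn] := pow2_ltn (y - x)^-1.
have p0 : (0 : R) < 2 ^+ n by rewrite exprn_gt0.
have yx0 : 0 < y - x by rewrite subr_gt0.
have h : 1 < (y - x) * 2 ^+ n.
  by rewrite -ltr_pdivrMl // mulr1.
exists ((Num.floor (x * 2 ^+ n) + 1)%:~R / 2 ^+ n).
have := floor_le (x * 2 ^+ n); have := floorD1_gt (x * 2 ^+ n).
split; first exact: dyadic_div2n.
  by rewrite ltr_pdivlMr.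
by rewrite ltr_pdivrMr // rmorphD /=; nra.
Qed.

Lemma int_between (m : int) : -1 < (m%:~R : R) < 1 -> m = 0.
Proof.
move=> hm; have : 0 < ((m + 1)%:~R : R).
  by rewrite rmorphD /=; lra.
by rewrite ltr0z; move: hm => /andP[_]; rewrite ltrz1; lia.
Qed.

Lemma int_open_unit (m : int) : ~ 0 < (m%:~R : R) < 1.
Proof.
move=> hm; have m0 : m = 0 by apply: int_between; lra.
by rewrite m0 ltxx in hm.
Qed.

(* Continuity is automatic: consecutive pieces share an endpoint. *)
Inductive PL (f : R -> R) : R -> R -> Prop :=
| PL_affine a b k c : a < b -> dyadic a -> dyadic b -> dyadic c ->
    (forall x, a <= x <= b -> f x = 2 ^ k * x + c) -> PL f a b
| PL_cat a b c : PL f a b -> PL f b c -> PL f a c.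

Lemma PL_lt f a b : PL f a b -> a < b.
Proof. by elim=> // ? ? ? _ h _ h'; exact: lt_trans h h'. Qed.

Lemma PL_dyadic f a b : PL f a b -> dyadic a /\ dyadic b.
Proof. by elim=> // ? ? ? _ [? ?] _ []. Qed.

Lemma eq_PL f g a b : (forall x, a <= x <= b -> f x = g x) -> PL f a b -> PL g a b.
Proof.
move=> + h; elim: h => {a b}.
  move=> a b k c ab da db dc fE fg; apply: (PL_affine (k := k) (c := c)) => // x xab.
  by rewrite -fg ?fE.
move=> a b c hab iab hbc ibc fg.
have := PL_lt hab; have := PL_lt hbc => bc ab.
by apply: (PL_cat (b := b)); [apply: iab|apply: ibc] => x xab; apply: fg; lra.
Qed.

Lemma PL_restrict f a b u v : PL f a b -> dyadic u -> dyadic v ->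
  a <= u -> u < v -> v <= b -> PL f u v.
Proof.
move=> h; elim: h u v => {a b}.
  move=> a b k c ab da db dc fE u v du dv au uv vb.
  apply: (PL_affine (k := k) (c := c)) => // x xuv; apply: fE; lra.
move=> a b c hab iab hbc ibc u v du dv au uv vc.
have [db _] := PL_dyadic hbc.
have [vb|bv] := leP v b; first exact: iab.
have [bu|ub] := leP b u; first exact: ibc.
by apply: (PL_cat (b := b)); [apply: iab|apply: ibc] => //; exact: ltW.
Qed.

Lemma PL_mono f a b : PL f a b ->
  forall x y, a <= x -> x < y -> y <= b -> f x < f y.
Proof.
elim=> {a b}.
  move=> a b k c ab _ _ _ fE x y ax xy yb; have := pow2_gt0 k.
  rewrite !fE; [nra|lra|lra].
move=> a b c hab iab hbc ibc x y ax xy yc.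
have ab := PL_lt hab; have bc := PL_lt hbc.
have [yb|by_] := leP y b; first exact: iab.
have [bx|xb] := leP b x; first exact: ibc.
by apply: (lt_trans (y := f b)); [apply: iab|apply: ibc].
Qed.

Lemma PL_dyadic_image f a b x : PL f a b -> a <= x <= b -> dyadic x -> dyadic (f x).
Proof.
move=> h; elim: h x => {a b}.
  by move=> a b k c ab _ _ dc fE x xab dx; rewrite fE //; exact: dyadic_affine.
move=> a b c hab iab hbc ibc x xac dx.
have [xb|bx] := leP x b; [apply: iab|apply: ibc] => //; lra.
Qed.

(** The case of [PL_comp] where [f] has one piece, by induction on the pieces of [g]; induction on
    the pieces of [f] then gives the rest. *)
Lemma PL_precomp_affine g u v : PL g u v -> forall f k c, dyadic c ->
  (forall x, u <= 2 ^ k * x + c <= v -> f x = 2 ^ k * x + c) ->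
  PL (g \o f) (2 ^ (- k) * (u - c)) (2 ^ (- k) * (v - c)).
Proof.
elim=> {u v}.
  move=> u v k c uv du dv dc gE f k' c' dc' fE.
  have p := pow2_gt0 (- k'); have p' := pow2_gt0 k'.
  have e : (2 : R) ^ k' * 2 ^ (- k') = 1 by rewrite -invr_expz divff // gt_eqF.
  apply: (PL_affine (k := k + k') (c := 2 ^ k * c' + c)).
  - by rewrite ltr_pM2l // ltrD2r.
  - by apply: dyadicM; [exact: dyadic_pow2|exact: dyadicB].
  - by apply: dyadicM; [exact: dyadic_pow2|exact: dyadicB].
  - exact: dyadic_affine.
  - move=> x /andP[xu xv].
    have h : u <= 2 ^ k' * x + c' <= v.
      have := ler_wpM2l (ltW p') xu; have := ler_wpM2l (ltW p') xv.
      by rewrite !mulrA e !mul1r; lra.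
    by rewrite /= fE // gE // expfzDr //; ring.
move=> u v w huv iuv hvw ivw f k c dc fE.
have uv := PL_lt huv; have vw := PL_lt hvw.
apply: (PL_cat (b := 2 ^ (- k) * (v - c))); [apply: iuv|apply: ivw] => // x xuv; apply: fE; lra.
Qed.

Lemma PL_comp f g a b : PL f a b -> PL g (f a) (f b) -> PL (g \o f) a b.
Proof.
move=> h; elim: h => {a b}.
  move=> a b k c ab da db dc fE; rewrite !fE ?lexx ?(ltW ab) // => hg.
  have p := pow2_gt0 k.
  have e x : 2 ^ (- k) * (2 ^ k * x + c - c) = x.
    rewrite addrK mulrA -invr_expz mulVf ?mul1r // gt_eqF //.
  have := @PL_precomp_affine _ _ _ hg f k c dc; rewrite !e; apply=> x xab; apply: fE.
  nra.
move=> a b c hab iab hbc ibc hg.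
have ab := PL_lt hab; have bc := PL_lt hbc.
have [da db] := PL_dyadic hab; have [_ dc] := PL_dyadic hbc.
have fab := PL_mono hab (lexx _) ab (lexx _).
have fbc := PL_mono hbc (lexx _) bc (lexx _).
have dfb : dyadic (f b) by apply: (PL_dyadic_image hab) => //; lra.
have [dfa dfc] := PL_dyadic hg.
apply: (PL_cat (b := b)); [apply: iab|apply: ibc]; apply: (PL_restrict hg) => //; exact: ltW.
Qed.

Lemma PL_inv f g a b : PL f a b -> (forall x, a <= x <= b -> g (f x) = x) ->
  PL g (f a) (f b).
Proof.
move=> h; elim: h => {a b}.
  move=> a b k c ab da db dc fE gf.
  have p := pow2_gt0 k; have e : (2 : R) ^ (- k) = (2 ^ k)^-1 by rewrite invr_expz.
  have hk : (2 : R) ^ k != 0 by rewrite gt_eqF.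
  apply: (PL_affine (k := - k) (c := - (2 ^ (- k) * c))).
  - by rewrite !fE ?lexx ?(ltW ab) //; nra.
  - by rewrite fE ?lexx ?(ltW ab) //; exact: dyadic_affine.
  - by rewrite fE ?lexx ?(ltW ab) //; exact: dyadic_affine.
  - by apply/dyadicN/dyadicM => //; exact: dyadic_pow2.
  - move=> y; rewrite !fE ?lexx ?(ltW ab) // e => hy.
    have [x yE] : exists x, y = 2 ^ k * x + c.
      by exists ((2 ^ k)^-1 * (y - c)); field.
    have xab : a <= x <= b by move: hy; rewrite yE !lerD2r !ler_pM2l.
    by rewrite yE -(fE _ xab) gf // fE //; field.
move=> a b c hab iab hbc ibc gf.
have ab := PL_lt hab; have bc := PL_lt hbc.
by apply: (PL_cat (b := f b)); [apply: iab|apply: ibc] => x xab; apply: gf; lra.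
Qed.

Lemma PL_inv_exists f a b : PL f a b -> exists g : R -> R,
  [/\ PL g (f a) (f b), forall x, a <= x <= b -> g (f x) = x &
      forall y, f a <= y <= f b -> (a <= g y <= b) /\ f (g y) = y].
Proof.
move=> h; suff [g [g1 g2]] : exists g : R -> R, (forall x, a <= x <= b -> g (f x) = x) /\
    (forall y, f a <= y <= f b -> (a <= g y <= b) /\ f (g y) = y).
  by exists g; split=> //; exact: PL_inv.
elim: h => {a b}.
  move=> a b k c ab da db dc fE.
  have p := pow2_gt0 k.
  have hk : (2 : R) ^ k != 0 by rewrite gt_eqF.
  exists (fun y => (2 ^ k)^-1 * (y - c)); split=> [x xab|y]; first by rewrite fE //; field.
  rewrite (fE a) ?(fE b) ?lexx ?(ltW ab) // => hy.
  have [x yE] : exists x, y = 2 ^ k * x + c.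
    by exists ((2 ^ k)^-1 * (y - c)); field.
  have xab : a <= x <= b by move: hy; rewrite yE !lerD2r !ler_pM2l.
  have -> : (2 ^ k)^-1 * (y - c) = x by rewrite yE; field.
  by split=> //; rewrite fE.
move=> a b c hab [g1 [g1f fg1]] hbc [g2 [g2f fg2]].
have ab := PL_lt hab; have bc := PL_lt hbc.
have mab := PL_mono hab; have mbc := PL_mono hbc.
exists (fun y => if y <= f b then g1 y else g2 y); split=> [x xac|y yac].
  have [xb|bx] := leP x b.
    have -> : f x <= f b by move: xb; rewrite le_eqVlt => /orP[/eqP->//|xb]; apply/ltW/mab => //; lra.
    by apply: g1f; lra.
  have -> : (f x <= f b) = false by apply/negbTE; rewrite -ltNge; apply: mbc => //; lra.
  by apply: g2f; lra.
have [yb|by_] := leP y (f b).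
  have [] := fg1 y; first lra.
  by move=> ? ?; split=> //; lra.
have [] := fg2 y; first lra.
by move=> ? ?; split=> //; lra.
Qed.

Lemma PL_germ_right f a b x : PL f a b -> a <= x < b ->
  exists k : int, exists2 e, 0 < e & forall t, 0 <= t <= e -> f (x + t) = f x + 2 ^ k * t.
Proof.
move=> h; elim: h x => {a b}.
  move=> a b k c ab da db dc fE x xab; exists k, (b - x); first lra.
  move=> t ht; rewrite !fE; [ring|lra|lra].
move=> a b c hab iab hbc ibc x xac.
have [bx|xb] := leP b x; [apply: ibc|apply: iab]; lra.
Qed.

Lemma PL_germ_two_sided f a b : PL f a b -> exists s : seq R,
  (forall x, x \in s -> dyadic x) /\
  (forall x, a <= x <= b -> x \notin s -> exists k : int, exists2 e, 0 < e &
     forall t, `|t| <= e -> f (x + t) = f x + 2 ^ k * t).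
Proof.
elim=> {a b}.
  move=> a b k c ab da db dc fE; exists [:: a; b]; split.
    by move=> x; rewrite !inE => /orP[]/eqP->.
  move=> x xab; rewrite !inE negb_or => /andP[xa xb].
  have ax : a < x by rewrite lt_neqAle eq_sym xa; lra.
  have bx : x < b by rewrite lt_neqAle xb; lra.
  exists k, (Num.min (x - a) (b - x)); first by rewrite lt_min; lra.
  move=> t; rewrite le_min => /andP[]; rewrite !ler_norml => h1 h2.
  rewrite !fE; [ring|lra|lra].
move=> a b c hab [s1 [d1 h1]] hbc [s2 [d2 h2]]; exists (s1 ++ s2); split.
  by move=> x; rewrite mem_cat => /orP[/d1|/d2].
move=> x xac; rewrite mem_cat negb_or => /andP[x1 x2].
have [xb|bx] := leP x b; [apply: h1|apply: h2] => //; lra.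
Qed.

End Dyadic.

(** * Periodic extension to the line *)

Section PLExtension.
Variable R : realType.
Implicit Types (f g : R -> R) (x y a b c d : R).

Lemma PL_shift f g a b s s' : dyadic s -> dyadic s' -> PL f a b ->
  (forall x, a <= x <= b -> g (x + s) = f x + s') -> PL g (a + s) (b + s).
Proof.
move=> ds ds'; elim=> {a b}.
  move=> a b k c ab da db dc fE gE.
  apply: (PL_affine (k := k) (c := c + s' - 2 ^ k * s)).
  - by rewrite ltrD2r.
  - exact: dyadicD.
  - exact: dyadicD.
  - apply: dyadicB; first exact: dyadicD.
    by apply: dyadicM => //; exact: dyadic_pow2.
  - move=> x hx; have -> : x = (x - s) + s by ring.
    by rewrite gE ?fE; [ring|lra|lra].
move=> a b c hab iab hbc ibc gE.
have ab := PL_lt hab; have bc := PL_lt hbc.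
by apply: (PL_cat (b := b + s)); [apply: iab|apply: ibc] => x hx; apply: gE; lra.
Qed.

Definition periodic f := forall x, f (x + 32) = f x + 32.

Lemma periodicz f (m : int) x : periodic f -> f (x + 32 * m%:~R) = f x + 32 * m%:~R.
Proof.
move=> pf.
have hn (n : nat) y : f (y + 32 * n%:R) = f y + 32 * n%:R.
  elim: n y => [|n IH] y; first by rewrite mulr0 !addr0.
  have -> : y + 32 * n.+1%:R = y + 32 * n%:R + 32 by ring.
  by rewrite pf IH; ring.
case: m => n; first exact: hn.
rewrite NegzE rmorphN /= mulrN.
by have := hn n.+1 (x - 32 * n.+1%:R); rewrite subrK => ->; ring.
Qed.

Lemma period_reduce a x : exists m : int, a <= x + 32 * m%:~R < a + 32.
Proof.
exists (- Num.floor ((x - a) / 32)).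
have := floor_le ((x - a) / 32); have := floorD1_gt ((x - a) / 32).
by rewrite rmorphN rmorphD /=; lra.
Qed.

Definition plfun f :=
  periodic f /\ forall a b, dyadic a -> dyadic b -> a < b -> PL f a b.

Definition pext x0 f x :=
  let k := (Num.floor ((x - x0) / 32))%:~R in f (x - 32 * k) + 32 * k.

Lemma pext_periodic x0 f : periodic (pext x0 f).
Proof.
move=> x; rewrite /pext.
have -> : (x + 32 - x0) / 32 = (x - x0) / 32 + 1 by field.
rewrite floorDrz ?rpred1 // floor1 rmorphD /=.
by rewrite (_ : x + 32 - _ = x - 32 * (Num.floor ((x - x0) / 32))%:~R); ring.
Qed.

Lemma pextE0 x0 f x : x0 <= x < x0 + 32 -> pext x0 f x = f x.
Proof.
move=> hx; rewrite /pext (_ : Num.floor _ = 0); first by rewrite mulr0 subr0 addr0.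
by apply: floor_def; rewrite rmorphD /=; lra.
Qed.

Lemma pextE x0 f x : f (x0 + 32) = f x0 + 32 -> x0 <= x <= x0 + 32 -> pext x0 f x = f x.
Proof.
move=> f0 hx; have [xl|lx] := ltP x (x0 + 32); first by apply: pextE0; lra.
have -> : x = x0 + 32 by lra.
by rewrite pext_periodic pextE0 // ?f0 //; lra.
Qed.

(** Translates of the given period are concatenated to the right of [x0], the result is moved left
    by whole periods until it covers [[a, b]], and then restricted. *)
Lemma periodic_PL x0 f : periodic f -> PL f x0 (x0 + 32) -> plfun f.
Proof.
move=> pf h; split=> // a b da db ab.
have [dx0 _] := PL_dyadic h; have d32 : dyadic (32 : R) := dyadic_nat _ 32.
have hs (n : nat) : PL f (x0 + 32 * n%:R) (x0 + 32 * n.+1%:R).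
  have -> : x0 + 32 * n.+1%:R = x0 + 32 + 32 * n%:R by ring.
  apply: (PL_shift (s' := 32 * n%:R) _ _ h) => [||x _].
  - by apply: dyadicM => //; exact: dyadic_nat.
  - by apply: dyadicM => //; exact: dyadic_nat.
  - exact: (periodicz n).
have hn (n : nat) : PL f x0 (x0 + 32 * n.+1%:R).
  elim: n => [|n IH]; first by rewrite mulr1.
  exact: (PL_cat IH (hs n.+1)).
have hb x : exists n : nat, x < 32 * n.+1%:R.
  exists (Num.truncn `|x|); have := truncnS_gt `|x|; have := ler_norm x.
  have : (0 : R) <= (Num.truncn `|x|).+1%:R by []. lra.
have [na ha] := hb (x0 - a); have [nb hnb] := hb (b - x0).
have := hn (na + nb.+1)%N => hh.
have {}hh : PL f (x0 - 32 * na.+1%:R) (x0 + 32 * nb.+1%:R).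
  have -> : x0 + 32 * nb.+1%:R = x0 + 32 * (na + nb.+1).+1%:R - 32 * na.+1%:R :> R.
    by ring.
  have dd : dyadic (- (32 * na.+1%:R : R)).
    by apply/dyadicN/dyadicM => //; exact: dyadic_nat.
  apply: (PL_shift (s' := - (32 * na.+1%:R)) _ _ hh) => // x _.
  by have := periodicz (- na.+1%:Z) x pf; rewrite rmorphN /= mulrN.
by apply: (PL_restrict hh) => //; lra.
Qed.

End PLExtension.

(* Lifts to the line of the elements of T, with period 32 instead of 1 so that
   the explicit elements have small nodes. *)
Record pl (R : realType) := Pl {
  pl_fun :> R -> R;
  pl_inv : R -> R;
  pl_funK : cancel pl_fun pl_inv;
  pl_invK : cancel pl_inv pl_fun;
  pl_funP : plfun pl_fun;
  pl_invP : plfun pl_inv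
}.

(** * The group of lifts *)

Section PLGroup.
Variable R : realType.
Implicit Types (f g h : pl R).

Lemma pl_ext f g : pl_fun f =1 pl_fun g -> f = g.
Proof.
case: f g => [f f' fK f'K fc f'c] [g g' gK g'K gc g'c] /= /funext fg.
subst g; have /funext fg' : f' =1 g' by move=> x; rewrite -{1}(g'K x) fK.
by subst g'; congr Pl; exact: Prop_irrelevance.
Qed.

Lemma plfun_id : plfun (idfun : R -> R).
Proof.
split=> // a b da db ab.
apply: (PL_affine (k := 0) (c := 0)) => //; first exact: (dyadic_nat _ 0).
by move=> x _; rewrite expr0z mul1r addr0.
Qed.

Lemma plfun_comp (u v : R -> R) : plfun u -> plfun v -> plfun (v \o u).
Proof.
move=> [pu Pu] [pv Pv]; split=> [x|a b da db ab]; first by rewrite /= pu pv.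
have hu := Pu a b da db ab.
apply: PL_comp => //; apply: Pv.
- by apply: (PL_dyadic_image hu) => //; lra.
- by apply: (PL_dyadic_image hu) => //; lra.
- exact: (PL_mono hu).
Qed.

Definition pl_one : pl R := @Pl R idfun idfun (fun=> erefl) (fun=> erefl) plfun_id plfun_id.

Definition pl_mul f g : pl R :=
  Pl (can_comp (pl_funK g) (pl_funK f)) (can_comp (pl_invK f) (pl_invK g))
     (plfun_comp (pl_funP f) (pl_funP g)) (plfun_comp (pl_invP g) (pl_invP f)).

Definition pl_opp f : pl R := Pl (pl_invK f) (pl_funK f) (pl_invP f) (pl_funP f).

Lemma pl_mulA : associative pl_mul.
Proof. by move=> f g h; exact: pl_ext. Qed.

Lemma pl_mul1g : left_id pl_one pl_mul.
Proof. by move=> f; exact: pl_ext. Qed.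

Lemma pl_mulg1 : right_id pl_one pl_mul.
Proof. by move=> f; exact: pl_ext. Qed.

Lemma pl_mulVg : left_inverse pl_one pl_opp pl_mul.
Proof. by move=> f; apply: pl_ext => x /=; rewrite pl_invK. Qed.

Lemma pl_mulgV : right_inverse pl_one pl_opp pl_mul.
Proof. by move=> f; apply: pl_ext => x /=; rewrite pl_funK. Qed.

HB.instance Definition _ := gen_eqMixin (pl R).
HB.instance Definition _ := gen_choiceMixin (pl R).
HB.instance Definition _ := isGroup.Build (pl R)
  pl_mulA pl_mul1g pl_mulg1 pl_mulVg pl_mulgV.

End PLGroup.

Section PLTheory.
Variable R : realType.
Implicit Types (f g h : pl R) (x y a b c d u v s t : R).

Lemma plM g h x : (g * h)%g x = h (g x). Proof. by []. Qed.
Lemma pl1 x : (1%g : pl R) x = x. Proof. by []. Qed.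
Lemma plVK g x : g^-1%g (g x) = x. Proof. exact: pl_funK. Qed.
Lemma plKV g x : g (g^-1%g x) = x. Proof. exact: pl_invK. Qed.
Lemma plJ g h x : (g ^ h)%g (h x) = h (g x). Proof. by rewrite conjgE !plM plVK. Qed.
Lemma pl_per g x : g (x + 32) = g x + 32. Proof. exact: (pl_funP g).1. Qed.
Lemma pl_perz g (m : int) x : g (x + 32 * m%:~R) = g x + 32 * m%:~R.
Proof. exact/periodicz/(pl_funP g).1. Qed.
Lemma plP g a b : dyadic a -> dyadic b -> a < b -> PL g a b.
Proof. exact: (pl_funP g).2. Qed.

Lemma pl_around x : exists a b, [/\ dyadic a, dyadic b, a < x & x < b].
Proof.
have [a [da a1 a2]] := @dyadic_dense R (x - 1) x ltac:(lra).
have [b [db b1 b2]] := @dyadic_dense R x (x + 1) ltac:(lra).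
by exists a, b.
Qed.

Lemma pl_lt g x y : (g x < g y) = (x < y).
Proof.
have h k u v : u < v -> pl_fun k u < k v.
  move=> uv; have [a [_ [da _ au _]]] := pl_around u.
  have [_ [b [_ db _ vb]]] := pl_around v.
  by apply: (PL_mono (@plP k a b da db _)); lra.
apply/idP/idP => [hg|]; last exact: h.
by have := h g^-1%g _ _ hg; rewrite !plVK.
Qed.

Lemma pl_le g x y : (g x <= g y) = (x <= y).
Proof. by rewrite !leNgt pl_lt. Qed.

Lemma pl_inj g x y : g x = g y -> x = y.
Proof. by move=> e; rewrite -[x](plVK g) e plVK. Qed.

Lemma pl_dyadic g x : dyadic x -> dyadic (g x).
Proof.
move=> dx; have [a [b [da db ax xb]]] := pl_around x.
by apply: (PL_dyadic_image (@plP g a b da db _)); rewrite ?(ltW ax) ?(ltW xb) //; lra.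
Qed.

Lemma pl_lV g x y : (g^-1%g x < y) = (x < g y).
Proof. by rewrite -{2}(plKV g x) pl_lt. Qed.
Lemma pl_Vl g x y : (x < g^-1%g y) = (g x < y).
Proof. by rewrite -{2}(plKV g y) pl_lt. Qed.
Lemma pl_leV g x y : (g^-1%g x <= y) = (x <= g y).
Proof. by rewrite -{2}(plKV g x) pl_le. Qed.
Lemma pl_Vle g x y : (x <= g^-1%g y) = (g x <= y).
Proof. by rewrite -{2}(plKV g y) pl_le. Qed.

Lemma pl_of_PL x0 (f : R -> R) : PL f x0 (x0 + 32) -> f (x0 + 32) = f x0 + 32 ->
  exists g : pl R, forall x, x0 <= x <= x0 + 32 -> g x = f x.
Proof.
move=> h f32; have [k [hk kf fk]] := PL_inv_exists h.
have k32 : k (f x0 + 32) = k (f x0) + 32 by rewrite -f32 !kf //; lra.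
have hlt := PL_mono h.
have pe := @pext_periodic R.
have K1 : cancel (pext x0 f) (pext (f x0) k).
  move=> x; have [m hm] := period_reduce x0 x.
  have -> : x = (x + 32 * m%:~R) + 32 * (- m)%:~R by rewrite rmorphN; ring.
  move: (x + _) hm (- m)%R => y hy m'.
  rewrite (periodicz m' y (pe x0 f)) (periodicz m' _ (pe (f x0) k)); congr (_ + _).
  rewrite pextE0 //pextE0 ?kf //; first lra.
  rewrite -f32; apply/andP; split; last by apply: hlt; lra.
  by have [->//|yx] := eqVneq y x0; apply/ltW/hlt; rewrite ?lt_neqAle 1?eq_sym ?yx; lra.
have K2 : cancel (pext (f x0) k) (pext x0 f).
  move=> x; have [m hm] := period_reduce (f x0) x.
  have -> : x = (x + 32 * m%:~R) + 32 * (- m)%:~R by rewrite rmorphN; ring.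
  move: (x + _) hm (- m)%R => y hy m'.
  rewrite (periodicz m' y (pe (f x0) k)) (periodicz m' _ (pe x0 f)); congr (_ + _).
  rewrite (pextE0 k) //; have [h1 h2] := fk y ltac:(lra).
  by rewrite pextE // h2.
have P1 : plfun (pext x0 f).
  apply: (periodic_PL (x0 := x0)) => //; apply: eq_PL h => x hx.
  by rewrite pextE.
have P2 : plfun (pext (f x0) k).
  apply: (periodic_PL (x0 := f x0)) => //; rewrite -f32; apply: eq_PL hk => x hx.
  by rewrite pextE //; lra.
by exists (Pl K1 K2 P1 P2) => x hx /=; rewrite pextE.
Qed.

End PLTheory.

(** * Maps between dyadic intervals, interpolation and supports *)

Section PLConn.
Variable R : realType.
Implicit Types (f g : R -> R) (x y a b c d u v : R).

Definition PL_conn a b c d := exists f, [/\ PL f a b, f a = c & f b = d].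

Lemma PL_conn_sym a b c d : PL_conn a b c d -> PL_conn c d a b.
Proof.
move=> [f [h <- <-]]; have [g [hg gf _]] := PL_inv_exists h; have ab := PL_lt h.
by exists g; split=> //; apply: gf; lra.
Qed.

Lemma PL_conn_trans a b c d u v : PL_conn a b c d -> PL_conn c d u v -> PL_conn a b u v.
Proof. by move=> [f [h <- <-]] [g [hg <- <-]]; exists (g \o f); split=> //; exact: PL_comp. Qed.

Lemma PL_glue f g a b c : PL f a b -> PL g b c -> f b = g b ->
  PL (fun x => if x <= b then f x else g x) a c.
Proof.
move=> hf hg e; have ab := PL_lt hf; have bc := PL_lt hg.
apply: (PL_cat (b := b)); [apply: eq_PL hf|apply: eq_PL hg] => x hx.
  by case: ifPn => //; lra.
case: ifPn => // xb; have -> : x = b by lra. by [].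
Qed.

Lemma PL_conn_cat a b a' c d c' : PL_conn a b c d -> PL_conn b a' d c' -> PL_conn a a' c c'.
Proof.
move=> [f [hf <- fb]] [g [hg gb <-]]; have ab := PL_lt hf; have bc := PL_lt hg.
exists (fun x => if x <= b then f x else g x); split.
- by apply: PL_glue => //; rewrite fb gb.
- by case: ifPn => //; lra.
- by case: ifPn => //; lra.
Qed.

Lemma PL_conn_affine a b c d k : dyadic a -> dyadic b -> dyadic c -> a < b ->
  d - c = 2 ^ k * (b - a) -> PL_conn a b c d.
Proof.
move=> da db dc ab e; exists (fun x => 2 ^ k * x + (c - 2 ^ k * a)); split.
- apply: (PL_affine (k := k) (c := c - 2 ^ k * a)) => //.
  by apply: dyadicB => //; apply: dyadicM => //; exact: dyadic_pow2.
- ring.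
- by rewrite -[d](subrK c) e; ring.
Qed.

(** All but the last unit interval are mapped onto [[0, 1]] by induction and then halved; the last
    one goes to [[1/2, 1]]. This absorbs a length whose numerator is not a power of two. *)
Lemma PL_conn_nat n : PL_conn 0 n.+1%:R 0 1.
Proof.
have d0 : dyadic (0 : R) := dyadic_nat R 0.
have dn m : dyadic (m%:R : R) := dyadic_nat R m.
elim: n => [|n IH]; first by apply: (PL_conn_affine (k := 0)); rewrite ?expr0z; do ?[exact: dn|lra].
apply: (@PL_conn_cat _ n.+1%:R _ _ (1 / 2)).
  apply: (PL_conn_trans IH); apply: (PL_conn_affine (k := -1)) => //; first exact: (dn 1).
  by rewrite exprN1; lra.
apply: (PL_conn_affine (k := -1)) => //; first exact/dyadic_half/(dn 1).
  by rewrite ltr_nat.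
by rewrite exprN1 -(natr1 n.+1); field.
Qed.

Lemma PL_connT a b c d : dyadic a -> dyadic b -> dyadic c -> dyadic d ->
  a < b -> c < d -> PL_conn a b c d.
Proof.
suff H u v : dyadic u -> dyadic v -> u < v -> PL_conn u v 0 1.
  by move=> da db dc dd ab cd; apply: (PL_conn_trans (H _ _ da db ab)); apply/PL_conn_sym/H.
move=> du dv uv; have [m [n e]] := dyadicB dv du.
have p : (0 : R) < 2 ^+ n by rewrite exprn_gt0.
have m0 : 0 < m.
  by rewrite -(ltr0z R) -(pmulr_lgt0 _ (x := (2 ^+ n)^-1)) ?invr_gt0 // -e subr_gt0.
case: m m0 e => // -[//|m] _ e; apply: (PL_conn_trans _ (PL_conn_nat m)).
apply: (PL_conn_affine (k := n)) => //; first exact: (dyadic_nat R 0).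
by rewrite e subr0 -exprnP mulrC divfK // gt_eqF.
Qed.

(* Consecutive nodes whose slope is a power of two are joined by an affine
   piece, which makes the values of explicit elements computable. *)
Fixpoint interpolates f x y (s : seq (R * R)) : Prop :=
  f x = y /\
  if s is p :: s' then
    (forall k : int, p.2 - y = 2 ^ k * (p.1 - x) ->
      forall t, x <= t <= p.1 -> f t = y + 2 ^ k * (t - x)) /\
    interpolates f p.1 p.2 s'
  else True.

Fixpoint nodes x y (s : seq (R * R)) : Prop :=
  dyadic x /\ dyadic y /\
  if s is p :: s' then x < p.1 /\ y < p.2 /\ nodes p.1 p.2 s' else True.

End PLConn.

Section Interpolation.
Variable R : realType.
Implicit Types (f g h : pl R) (x y a b c d u v s t : R).

Lemma nodes_le x y l : nodes x y l -> x <= (last (x, y) l).1.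
Proof.
elim: l x y => [|[x' y'] l IH] x y //= [_ [_ [xx' [_ /IH h]]]].
exact: (le_trans (ltW xx') h).
Qed.

Lemma eq_interpolates (f g : R -> R) x y l : nodes x y l ->
  (forall t, x <= t <= (last (x, y) l).1 -> f t = g t) ->
  interpolates f x y l -> interpolates g x y l.
Proof.
elim: l x y => [|[x' y'] l IH] x y /=.
  by move=> _ fg [fx _]; rewrite -fg ?lexx.
move=> [_ [_ [xx' [_ nl]]]] fg [fx [faff fl]]; have /= le := nodes_le nl.
split; first by rewrite -fg // lexx; apply: le_trans le; exact: ltW.
split; last by apply: (IH _ _ nl) fl => t /andP[h1 h2]; apply: fg; rewrite h2 andbT; lra.
move=> k e t ht; rewrite -fg; last lra.
exact: faff.
Qed.

Lemma interpolation_piece x y x' y' : dyadic x -> dyadic x' -> dyadic y -> dyadic y' ->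
  x < x' -> y < y' -> exists f : R -> R, [/\ PL f x x', f x = y, f x' = y' &
    forall k : int, y' - y = 2 ^ k * (x' - x) ->
      forall t, x <= t <= x' -> f t = y + 2 ^ k * (t - x)].
Proof.
move=> dx dx' dy dy' xx' yy'.
have [[k e]|nk] := pselect (exists k : int, y' - y = 2 ^ k * (x' - x)).
  exists (fun t => 2 ^ k * t + (y - 2 ^ k * x)); split.
  - apply: (PL_affine (k := k) (c := y - 2 ^ k * x)) => //.
    by apply: dyadicB => //; apply: dyadicM => //; exact: dyadic_pow2.
  - ring.
  - by rewrite -[y'](subrK y) e; ring.
  - move=> k' e' t _; have : 2 ^ k * (x' - x) = 2 ^ k' * (x' - x) by rewrite -e -e'.
    by move=> /mulIf -> //; [ring|rewrite subr_eq0 gt_eqF].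
have [f [hf fx fx']] := PL_connT dx dx' dy dy' xx' yy'.
by exists f; split=> // k e; exfalso; apply: nk; exists k.
Qed.

Lemma interpolation_fun x y p l : nodes x y (p :: l) ->
  exists f : R -> R, PL f x (last p l).1 /\ interpolates f x y (p :: l).
Proof.
elim: l x y p => [|q l IH] x y [x' y'] hn.
  have [dx [dy [xx' [yy' [dx' [dy' _]]]]]] := hn.
  by have [f [hf fx fx' fk]] := interpolation_piece dx dx' dy dy' xx' yy'; exists f.
have {hn} [dx [dy [xx' [yy' hn]]]] := hn.
have [g [hg gi]] := IH _ _ _ hn.
have [dx' [dy' _]] := hn.
have [f [hf fx fx' fk]] := interpolation_piece dx dx' dy dy' xx' yy'.
have gx' : g x' = y' by case: gi.
exists (fun t => if t <= x' then f t else g t); split; first by apply: PL_glue => //; rewrite fx'.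
rewrite [interpolates _ _ _ _]/=; split; first by rewrite (ltW xx').
split; first by move=> k e t ht; rewrite ifT; [exact: fk|move: ht => /=; lra].
suff: interpolates (fun t => if t <= x' then f t else g t) x' y' (q :: l) by [].
apply: (@eq_interpolates g _ x' y' (q :: l) hn _ gi) => t /andP[ht _]; case: ifPn => // h.
have -> : t = x' by apply/eqP; rewrite eq_le h ht.
by rewrite gx' fx'.
Qed.

Lemma interpolation x y p l : nodes x y (p :: l) -> last p l = (x + 32, y + 32) ->
  exists f, interpolates f x y (p :: l).
Proof.
move=> hn hl; have [f [hf fi]] := interpolation_fun hn; rewrite hl /= in hf.
have fx : f x = y by case: fi.
have fl : f (x + 32) = y + 32.
  have: forall x y q m, interpolates f x y (q :: m) -> f (last q m).1 = (last q m).2.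
    move=> x' y' q m; elim: m x' y' q => [|r m IH] x' y' q; first by case=> _ [_ []].
    by case=> _ [_] /IH.
  by move=> /(_ _ _ _ _ fi); rewrite hl.
have [g gE] := pl_of_PL hf ltac:(by rewrite fl fx).
exists g; apply: (eq_interpolates hn) fi => t ht; rewrite gE //.
by move: ht; rewrite /= hl.
Qed.

(* The support lies in [u, v] modulo the period, provided u < v < u + 32. *)
Definition supported f u v := forall x, v <= x <= u + 32 -> f x = x.

Lemma supportedM f g u v : supported f u v -> supported g u v -> supported (f * g)%g u v.
Proof. by move=> hf hg x hx; rewrite plM hf ?hg. Qed.

Lemma supportedV f u v : supported f u v -> supported f^-1%g u v.
Proof. by move=> hf x hx; rewrite -{1}(hf x hx) plVK. Qed.

Lemma supportedJ f g u v : supported f u v -> supported (f ^ g)%g (g u) (g v).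
Proof.
move=> hf x hx; rewrite -[x](plKV g) plJ hf //.
by rewrite pl_Vle pl_leV pl_per.
Qed.

Lemma supportedS f u v u' v' : supported f u v -> u' <= u -> v <= v' -> supported f u' v'.
Proof. by move=> hf hu hv x hx; apply: hf; lra. Qed.

Lemma supported_stable f u v x : supported f u v -> v <= u + 32 -> u <= x <= v -> u <= f x <= v.
Proof.
move=> hf vu hx; have fu : f u = u.
  by apply: (addIr 32); rewrite -pl_per hf //; lra.
have fv : f v = v by apply: hf; lra.
by rewrite -{1}fu -{1}fv !pl_le.
Qed.

Lemma supported_out f u v (m : int) x : supported f u v -> v <= x + 32 * m%:~R <= u + 32 -> f x = x.
Proof. by move=> hf /hf; rewrite pl_perz; exact: addIr. Qed.

Lemma pl_restrict h u v : dyadic u -> dyadic v -> u < v -> v < u + 32 ->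
  h u = u -> h v = v ->
  exists g, supported g u v /\ forall x, u <= x <= v -> g x = h x.
Proof.
move=> du dv uv vu hu hv.
have d32 : dyadic (u + 32) by apply: dyadicD => //; exact: (dyadic_nat R 32).
have := @PL_glue R h idfun u v (u + 32) (plP h du dv uv) ((@plfun_id R).2 _ _ dv d32 vu) hv.
move=> /pl_of_PL[|g gE].
  have -> : (u + 32 <= v) = false by apply/negbTE; rewrite -ltNge.
  by rewrite (ltW uv) hu.
exists g; split=> x hx; rewrite gE; try lra.
  case: ifPn => // xv; have -> : x = v by lra. by [].
by case: ifPn => //; lra.
Qed.

(** An auxiliary [k] fixes [s] and [t] and sends [u], [v] where [h] does. Then [h * k^-1] fixes [u]
    and [v], so it can be cut off outside [[u, v]] before [k] is put back. *)
Lemma pl_extension h u v s t : dyadic u -> dyadic v -> dyadic s -> dyadic t ->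
  s < u -> u < v -> v < t -> s < h u -> h v < t -> t < s + 32 ->
  exists g, supported g s t /\ forall x, u <= x <= v -> g x = h x.
Proof.
move=> du dv ds dt su uv vt shu hvt ts.
have d32 : dyadic (s + 32) by apply: dyadicD => //; exact: (dyadic_nat R 32).
have huv : h u < h v by rewrite pl_lt.
have [||k [ks [_ [ku [_ [kv [_ [kt [kid _]]]]]]]]] := @interpolation s s (u, h u) [:: (v, h v); (t, t); (s + 32, s + 32)].
- by rewrite /=; do !split=> //; exact: pl_dyadic.
- by [].
move: ku kv kt kid => /= ku kv kt kid.
have [|||g [gs gE]] := @pl_restrict (h * k^-1)%g u v du dv uv.
- lra.
- by rewrite plM -ku plVK.
- by rewrite plM -kv plVK.
exists (g * k)%g; split=> x hx.
  rewrite plM gs; last lra.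
  by rewrite (kid 0) ?expr0z; [ring|ring|lra].
by rewrite plM gE // plM plKV.
Qed.

End Interpolation.

(** * Vines: the copy of Thompson's group F on [0, 3] *)

Section Generation.
Variable R : realType.
Implicit Types (f g h p q : pl R) (x y u v w t : R).

Definition subgroup (G : groupType) (H : set G) :=
  [/\ H 1%g, forall x y : G, H x -> H y -> H (x * y)%g & forall x : G, H x -> H x^-1%g].

Lemma subgroupJ (G : groupType) (H : set G) (x y : G) :
  subgroup H -> H x -> H y -> H (x ^ y)%g.
Proof. by move=> [_ HM HV] hx hy; rewrite conjgE; apply: (HM); [exact: HV|exact: HM]. Qed.

(** Up to inversion, the standard generator of F with slopes 2, 1, 1/2, scaled from [[0, 1]] to
    [[s, s + 2]]. *)
Definition bump_at (s : R) (a : pl R) := [/\ supported a s (s + 2),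
  forall x, s <= x <= s + 1 / 2 -> a x = 2 * x - s,
  forall x, s + 1 / 2 <= x <= s + 1 -> a x = x + 1 / 2 &
  forall x, s + 1 <= x <= s + 2 -> a x = x / 2 + s / 2 + 1].

(** Parametrised from 0 to 1, so that affine pieces compose without naming slopes. *)
Definition aff f u v u' v' :=
  forall t, 0 <= t <= 1 -> f (u + t * (v - u)) = u' + t * (v' - u').

Lemma affM f g u v u' v' u2 v2 : aff f u v u' v' -> aff g u' v' u2 v2 -> aff (f * g)%g u v u2 v2.
Proof. by move=> hf hg t ht; rewrite plM hf // hg. Qed.

Lemma affJ f g u v u' v' w w' z z' : aff g u v u' v' -> aff f u v w w' -> aff g w w' z z' ->
  aff (f ^ g)%g u' v' z z'.
Proof. by move=> hg hf hg' t ht; rewrite -hg // plJ hf // hg'. Qed.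

Lemma aff_halfl f u v u' v' : aff f u v u' v' -> aff f u ((u + v) / 2) u' ((u' + v') / 2).
Proof.
move=> h t ht; have := h (t / 2) ltac:(lra).
by rewrite (_ : u + t / 2 * (v - u) = u + t * ((u + v) / 2 - u)) => [->|]; field.
Qed.

Lemma aff_halfr f u v u' v' : aff f u v u' v' -> aff f ((u + v) / 2) v ((u' + v') / 2) v'.
Proof.
move=> h t ht; have := h ((1 + t) / 2) ltac:(lra).
by rewrite (_ : u + (1 + t) / 2 * (v - u) = (u + v) / 2 + t * (v - (u + v) / 2)) => [->|]; field.
Qed.

Lemma aff_mul f (k c : R) u v : u <= v -> (forall x, u <= x <= v -> f x = k * x + c) ->
  aff f u v (k * u + c) (k * v + c).
Proof. by move=> uv h t ht; rewrite h; [ring|nra]. Qed.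

Variables a b : pl R.
Hypotheses (ba : bump_at 0 a) (bb : bump_at 1 b).

(* The generators x_k of Thompson's group F, transported to [0, 3]: x_k maps the
   two halves of the k-th interval of the partition 0 < 1 < 2 < 5/2 < ... < 3
   to its k-th and (k+1)-st intervals, and shifts the later intervals by one. *)
Fixpoint vine_map k : pl R :=
  match k with
  | 0 => (a * b)%g
  | 1 => b
  | k'.+1 => (vine_map k' ^ (a * b))%g
  end.

(** After the first cell [[0, 1]], the remaining [[1, 3]] is halved again and again on the right;
    the general formula would give -1 at 0. *)
Definition vine k : R := if k is 0%N then 0 else 3 - 4 / 2 ^+ k.

Lemma vineS k : vine k.+2 = (vine k.+1 + 3) / 2.
Proof.
rewrite /vine (exprS _ k.+1); have : (2 : R) ^+ k.+1 != 0 by rewrite expf_neq0.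
by move=> h; field.
Qed.

Lemma vine1 : vine 1 = 1. Proof. by rewrite /vine expr1; field. Qed.
Lemma vine2 : vine 2 = 2. Proof. by rewrite vineS vine1; field. Qed.

Lemma vine_bounds k : 1 <= vine k.+1 < 3.
Proof. by elim: k => [|k]; rewrite ?vine1 ?vineS; lra. Qed.

Lemma vine_lt k : vine k < vine k.+1.
Proof.
by case: k => [|k]; [rewrite vine1 /vine; lra|rewrite vineS; have := vine_bounds k; lra].
Qed.

Lemma bump1_id x : 0 <= x <= 1 -> b x = x.
Proof.
by case: bb => bs _ _ _ hx; apply: (supported_out (m := 1) bs); rewrite mulr1; lra.
Qed.

Lemma vine0E x : 0 <= x <= 1 -> (a * b)%g x = 2 * x.
Proof.
case: ba bb => [_ a1 a2 _] [_ b1 _ _] hx; rewrite plM.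
have [h|h] := leP x (1 / 2).
  by rewrite a1 ?bump1_id; lra.
by rewrite a2 ?b1; lra.
Qed.

Lemma vine0E' x : 1 <= x <= 3 -> (a * b)%g x = x / 2 + 3 / 2.
Proof.
case: ba bb => [as_ _ _ a3] [_ _ b2 b3] hx; rewrite plM.
have [h|h] := leP x 2.
  by rewrite a3 ?b2; lra.
by rewrite as_ ?b3; lra.
Qed.

(** On [[1, 3]] the product [a * b] is the contraction towards 3 with ratio 1/2, which sends each
    vine point to the next. Conjugation by it therefore passes from each index to the next, and only
    the indices 0 and 1 are computed. *)
Lemma vine_mapP k : [/\ forall x, 0 <= x <= vine k -> vine_map k x = x,
  aff (vine_map k) (vine k) ((vine k + vine k.+1) / 2) (vine k) (vine k.+1),
  aff (vine_map k) ((vine k + vine k.+1) / 2) (vine k.+1) (vine k.+1) (vine k.+2) &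
  forall x, vine k.+1 <= x <= 3 -> vine_map k x = x / 2 + 3 / 2].
Proof.
case: k => [|k].
  rewrite vine1 vine2 [vine 0]/= [vine_map 0]/=; split.
  - by move=> x hx; rewrite vine0E; lra.
  - by move=> t ht; rewrite vine0E; lra.
  - by move=> t ht; rewrite vine0E; lra.
  - exact: vine0E'.
elim: k => [|k [i1 i2 i3 i4]].
  case: bb => bs b1 b2 b3.
  rewrite (vineS 1) vine2 vine1 [vine_map 1]/=; split.
  - by move=> x hx; rewrite bump1_id.
  - by move=> t ht; rewrite b1; lra.
  - by move=> t ht; rewrite b2; lra.
  - by move=> x hx; rewrite b3; lra.
rewrite -[vine_map k.+2]/(vine_map k.+1 ^ (a * b))%g; set g := (a * b)%g.
have vb := vine_bounds k; have vl := vine_lt k.+1; have vb' := vine_bounds k.+1.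
have ag u v : 1 <= u -> u <= v -> v <= 3 -> aff g u v ((u + 3) / 2) ((v + 3) / 2).
  move=> hu uv hv; have := @aff_mul g (1 / 2) (3 / 2) u v uv.
  have -> : 1 / 2 * u + 3 / 2 = (u + 3) / 2 by field.
  have -> : 1 / 2 * v + 3 / 2 = (v + 3) / 2 by field.
  by apply=> x hx; rewrite vine0E'; lra.
have g0 : g 0 = 0 by rewrite vine0E; lra.
have gv j : g (vine j.+1) = vine j.+2.
  by rewrite vineS vine0E'; have := vine_bounds j; lra.
have vl2 := vine_lt k.+2; have vb2 := vine_bounds k.+2.
split.
- move=> x hx; rewrite -[x](plKV g) plJ i1 //.
  by rewrite pl_Vle g0 pl_leV gv.
- have -> : (vine k.+2 + vine k.+3) / 2 = ((vine k.+1 + vine k.+2) / 2 + 3) / 2.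
    by rewrite !vineS; field.
  have a1 := ag (vine k.+1) ((vine k.+1 + vine k.+2) / 2) ltac:(lra) ltac:(lra) ltac:(lra).
  have a2 := ag (vine k.+1) (vine k.+2) ltac:(lra) ltac:(lra) ltac:(lra).
  have := affJ a1 i2 a2.
  by rewrite -(vineS k) -(vineS k.+1).
- have -> : (vine k.+2 + vine k.+3) / 2 = ((vine k.+1 + vine k.+2) / 2 + 3) / 2.
    by rewrite !vineS; field.
  have a1 := ag ((vine k.+1 + vine k.+2) / 2) (vine k.+2) ltac:(lra) ltac:(lra) ltac:(lra).
  have a2 := ag (vine k.+2) (vine k.+3) ltac:(lra) ltac:(lra) ltac:(lra).
  have := affJ a1 i3 a2.
  by rewrite -(vineS k.+1) -(vineS k.+2).
- move=> x; rewrite (vineS k.+1) => hx.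
  have gx : g (2 * x - 3) = x by rewrite vine0E'; lra.
  rewrite -{1}gx plJ i4; last lra.
  by rewrite vine0E'; lra.
Qed.

Definition vine_end n i : R := if (i < n)%N then vine i else 3.

Variable G : set (pl R).
Hypotheses (sG : subgroup G) (Ga : G a) (Gb : G b).

Lemma vine_map_in k : G (vine_map k) /\ supported (vine_map k) 0 3.
Proof.
have sa : supported a 0 3 by case: ba => h _ _ _; apply: (supportedS h); lra.
have sb : supported b 0 3.
  case: bb => h _ _ _ x hx; have [h3|h3] := leP x 32; first by apply: h; lra.
  lra.
have [G1 GM GV] := sG.
have G0 : G (a * b)%g by exact: GM.
have s0 : supported (a * b)%g 0 3 by exact: supportedM.
case: k => [//|k]; elim: k => [//|k [IH1 IH2]] /=; split; first exact: subgroupJ.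
by rewrite conjgE; apply: supportedM (supportedV s0) _; exact: supportedM.
Qed.

Definition to_vine q (S : seq R) := forall i, (i.+1 < size S)%N ->
  aff q (nth 0 S i) (nth 0 S i.+1) (vine_end (size S).-1 i) (vine_end (size S).-1 i.+1).

(** An element of F is described by two subdivisions with equally many cells, matched affinely. If
    members of [G] carry both to the vine, the element is a quotient of these members. *)
Definition vinable S := exists q, [/\ G q, supported q 0 3 & to_vine q S].

Lemma nth_insert (S1 S2 : seq R) u m i : nth 0 (S1 ++ [:: u, m & S2]) i =
  if (i <= size S1)%N then nth 0 (S1 ++ u :: S2) i
  else if i == (size S1).+1 then m else nth 0 (S1 ++ u :: S2) i.-1.
Proof.
rewrite !nth_cat; case: ltngtP => [h|h|->]; rewrite ?subnn //.
case: eqP => [->|/eqP hi]; first by rewrite subSnn.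
have [j ->] : exists j, i = (size S1 + j).+2.
  exists (i - (size S1).+2)%N; move: (size S1) h hi => k h hi; lia.
have -> : ((size S1 + j).+2 - size S1)%N = j.+2 by rewrite -!addnS addKn.
have -> : ((size S1 + j).+1 < size S1)%N = false.
  by apply/negbTE; rewrite -leqNgt ltnW // ltnS leq_addr.
by rewrite [_.-1]/= -addnS addKn.
Qed.

Lemma vine_end_lt n i : (i < n)%N -> vine_end n i = vine i.
Proof. by rewrite /vine_end => ->. Qed.

Lemma vine_end_ge n i : (n <= i)%N -> vine_end n i = 3.
Proof. by rewrite /vine_end leqNgt => /negbTE ->. Qed.

Lemma vine_endS n i : vine_end n.+1 i.+2 = (vine_end n i.+1 + 3) / 2.
Proof. by rewrite /vine_end ltnS; case: ifP => _; [exact: vineS|field]. Qed.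

Lemma vine_mono i j : (i <= j)%N -> vine i <= vine j.
Proof.
elim: j => [|j IH]; first by rewrite leqn0 => /eqP->.
rewrite leq_eqVlt => /orP[/eqP->//|/IH h]; apply: le_trans h _; exact/ltW/vine_lt.
Qed.

Lemma vine_ge0 j : 0 <= vine j.
Proof. by case: j => [|j]; [exact: lexx|have := vine_bounds j; lra]. Qed.

Lemma vine_end_bounds n i : (0 < i)%N -> 1 <= vine_end n i <= 3.
Proof.
case: i => // i _; rewrite /vine_end; case: ifP => _; last lra.
by have := vine_bounds i; lra.
Qed.

Lemma vine_end_mono n i j : (i <= j)%N -> vine_end n i <= vine_end n j.
Proof.
rewrite /vine_end => ij; case: ifPn => hi; case: ifPn => hj //.
- exact: vine_mono.
- by case: i {ij hi} => [|i]; [rewrite /vine; lra|have := vine_bounds i; lra].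
- by rewrite (leq_ltn_trans ij hj) in hi.
Qed.

(** Halving the last cell of a vine gives the next vine, so [q] still serves. If the [k]-th of
    several cells is halved, [vine_map k] spreads its halves over the cells [k] and [k + 1] and
    pushes the later cells one place on. A single cell is excluded: its midpoint is sent to 3/2,
    while the vine with two cells breaks at 1. *)
Lemma vinable_split S1 S2 u w : (2 < size (S1 ++ [:: u, w & S2]))%N ->
  vinable (S1 ++ [:: u, w & S2]) -> vinable (S1 ++ [:: u, (u + w) / 2, w & S2]).
Proof.
move=> hs [q [Gq sq hq]]; have [G1 GM GV] := sG.
have eS : (size (S1 ++ [:: u, w & S2])).-1 = (size S1 + size S2).+1.
  by rewrite size_cat /= !addnS.
have eS' : (size (S1 ++ [:: u, (u + w) / 2, w & S2])).-1 = (size S1 + size S2).+2.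
  by rewrite size_cat /= !addnS.
have {}hq i : (i <= size S1 + size S2)%N -> aff q (nth 0 (S1 ++ [:: u, w & S2]) i)
    (nth 0 (S1 ++ [:: u, w & S2]) i.+1)
    (vine_end (size S1 + size S2).+1 i) (vine_end (size S1 + size S2).+1 i.+1).
  by move=> hi; rewrite -eS; apply: hq; rewrite size_cat /= !addnS !ltnS.
suff [q' [Gq' sq' hq']] : exists q', [/\ G q', supported q' 0 3 &
    forall i, (i <= (size S1 + size S2).+1)%N -> aff q'
    (nth 0 (S1 ++ [:: u, (u + w) / 2, w & S2]) i)
    (nth 0 (S1 ++ [:: u, (u + w) / 2, w & S2]) i.+1)
    (vine_end (size S1 + size S2).+2 i) (vine_end (size S1 + size S2).+2 i.+1)].
  exists q'; split=> // i; rewrite eS' => hi; apply: hq'.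
  by move: hi; rewrite size_cat /= !addnS !ltnS.
have nu : nth 0 (S1 ++ [:: u, w & S2]) (size S1) = u by rewrite nth_cat ltnn subnn.
have nw : nth 0 (S1 ++ [:: u, w & S2]) (size S1).+1 = w.
  by rewrite nth_cat ltnNge leqnSn subSnn.
have nS := nth_insert S1 (w :: S2) u ((u + w) / 2).
move: (nth 0 (S1 ++ [:: u, w & S2])) (nth 0 (S1 ++ [:: u, (u + w) / 2, w & S2]))
  hq nu nw nS => F F' hq nu nw nS.
have {}hs : (0 < size S1 + size S2)%N by move: hs; rewrite size_cat /= !addnS.
move: (size S1) (size S2) hs hq nu nw nS => {eS eS' S1 S2} k [|n] hs hq nu nw nS.
  rewrite addn0 in hs hq *.
  have := hq k (leqnn k); rewrite nu nw vine_end_lt // vine_end_ge // => hqk.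
  have e : vine k.+1 = (vine k + 3) / 2 by rewrite -(prednK hs) vineS.
  exists q; split=> // i hi; rewrite !nS.
  have [ik|ki|->] := ltngtP i k.
  - have i1 := ltnW ik; have := hq i i1; rewrite !vine_end_lt ?ltnS ?(leqW ik) ?(leqW i1) ?(leqW (leqW i1)) //.
  - have -> : i = k.+1 by apply/eqP; rewrite eqn_leq hi.
    rewrite eqxx -[k.+2 == k.+1]/(k.+1 == k) (gtn_eqF (ltnSn k)) [_.-1]/= nw.
    rewrite vine_end_lt // vine_end_ge // e; exact: aff_halfr.
  - by rewrite eqxx !vine_end_lt // nu e; exact: aff_halfl.
have [x1 x2 x3 x4] := vine_mapP k; have [Gx sx] := vine_map_in k.
exists (q * vine_map k)%g; split; [exact: GM|exact: supportedM|].
have hk : (k <= k + n)%N by exact: leq_addr.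
have := hq k (leq_addr _ _); rewrite nu nw addnS !vine_end_lt ?ltnS ?leqW // => hqk.
rewrite addnS in hq; move=> i hi; rewrite !nS.
have [ik|ki|->] := ltngtP i k.
- have ikn : (i < k + n)%N := leq_trans ik hk.
  have i1 := ltnW ikn; have := hq i (leqW i1).
  rewrite !vine_end_lt ?ltnS ?(leqW ikn) ?(leqW i1) ?(leqW (leqW i1)) //.
  move=> hqi; apply: affM hqi _ => t ht; apply: x1.
  have := vine_mono ik; have := vine_ge0 i; have := vine_lt i; nra.
- have [->|ik] := eqVneq i k.+1.
    rewrite -[k.+2 == k.+1]/(k.+1 == k) (gtn_eqF (ltnSn k)) [_.-1]/= nw.
    rewrite !vine_end_lt ?ltnS ?(leqW hk) //.
    exact: affM (aff_halfr hqk) x3.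
  case: i ki ik hi => [//|i] ki ik hi; have ki' : (k < i)%N.
    by move: ki; rewrite ltnS leq_eqVlt => /orP[/eqP e|//]; rewrite e eqxx in ik.
  rewrite eqSS (gtn_eqF ki) [_.-1]/= [_.-1]/=.
  have := hq i hi => hqi; apply: affM hqi _.
  case: i ki' {ki ik hi} => [//|i] ki'; rewrite (vine_endS (k + n).+2 i) (vine_endS (k + n).+2 i.+1) => t ht.
  have v1 : vine k.+1 <= vine_end (k + n).+2 i.+1.
    rewrite /vine_end; case: ifP => _; first exact: vine_mono.
    by have := vine_bounds k; lra.
  have v2 := vine_end_mono (k + n).+2 (leqnSn i.+1).
  have v3 := vine_end_bounds (k + n).+2 (ltn0Sn i.+1).
  have /andP[_ v4] := vine_end_bounds (k + n).+2 (ltn0Sn i.+1).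
  move: (vine_end _ i.+1) (vine_end _ i.+2) v1 v2 v3 v4 => V1 V2 *.
  by rewrite x4; [field|nra].
- rewrite eqxx !vine_end_lt ?ltnS ?leqW // nu; exact: affM (aff_halfl hqk) x2.
Qed.

End Generation.

(** * Standard dyadic intervals *)

Section StandardGrid.
Variable R : realType.
Implicit Types (x y u v w t : R) (i j d : int) (m n q N M : nat).

Definition gridpt N i : R := i%:~R / 2 ^+ N.

Definition standard_on (f : R -> R) N i := exists j M,
  forall t, 0 <= t <= 1 -> f ((i%:~R + t) / 2 ^+ N) = (j%:~R + t) / 2 ^+ M.

Lemma expn2_neq0 n : (2 : R) ^+ n != 0. Proof. by rewrite expf_neq0. Qed.
Lemma expn2_gt0 n : (0 : R) < 2 ^+ n. Proof. by rewrite exprn_gt0. Qed.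

Lemma dyadic_level x : dyadic x -> exists q, forall N, (q <= N)%N -> exists d, x = gridpt N d.
Proof.
move=> [d [q ->]]; exists q => N qN; exists (d * 2 ^+ (N - q)); rewrite /gridpt.
rewrite rmorphM rmorphXn /= -{2}(subnKC qN) exprD.
have := expn2_neq0 q; have := expn2_neq0 (N - q) => h1 h2; field; by rewrite h1 h2.
Qed.

Lemma gridpt_lt N i j : (gridpt N i < gridpt N j) = (i < j).
Proof. by rewrite /gridpt ltr_pM2r ?invr_gt0 ?expn2_gt0 // ltr_int. Qed.

Lemma gridpt_le N i j : (gridpt N i <= gridpt N j) = (i <= j).
Proof. by rewrite /gridpt ler_pM2r ?invr_gt0 ?expn2_gt0 // ler_int. Qed.

Lemma PL_standard (f : R -> R) a b : PL f a b -> exists N0, forall N, (N0 <= N)%N ->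
  forall i, a <= gridpt N i -> gridpt N (i + 1) <= b -> standard_on f N i.
Proof.
elim=> {a b}.
  move=> a b k c ab _ _ dc fE; have [q hq] := dyadic_level dc.
  (* A slope of [2 ^ k] turns level [N] into level [N - k]. This bound keeps [N - k] at least [q],
     so that [c] is a grid point of the image level. *)
  exists (q + `|k|)%N => N hN i ai ib.
  have [M [qM Mk]] : exists M, (q <= M)%N /\ M%:Z = N%:Z - k.
    by exists `|(N%:Z - k)|%N; lia.
  have [d dE] := hq M qM.
  have k2 : (2 : R) ^ k = 2 ^+ N / 2 ^+ M.
    have -> : k = N%:Z - M%:Z by lia.
    by rewrite expfzDr // -exprnP -exprnN.
  exists (i + d), M => t ht.
  have := expn2_neq0 N; have := expn2_neq0 M => h1 h2.
  rewrite fE; first by rewrite k2 dE /gridpt rmorphD /=; field; rewrite h1 h2.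
  move: ai ib; rewrite /gridpt rmorphD /= !mulrDl.
  have p : (0 : R) < (2 ^+ N)^-1 by rewrite invr_gt0 expn2_gt0.
  nra.
move=> a b c hab [N1 H1] hbc [N2 H2]; have [db _] := PL_dyadic hbc.
have [q hq] := dyadic_level db; exists (maxn q (maxn N1 N2)) => N.
rewrite !geq_max => /and3P[qN N1N N2N] i ai ic; have [d dE] := hq N qN.
have [bi|ib] := leP b (gridpt N i); first exact: H2.
by apply: H1 => //; move: ib; rewrite dE gridpt_lt gridpt_le; lia.
Qed.

(* Standard dyadic intervals are nested or have disjoint interiors, so a dyadic
   point of level q is interior to the image of a grid interval only if that
   image has level less than q. *)
Lemma standard_mid (p : pl R) N (s c d : int) q :
  (forall i : int, s <= i < c -> standard_on p N i) ->
  p (gridpt N s) < gridpt q d -> gridpt q d < p (gridpt N c) ->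
  (exists2 i : int, s < i < c & gridpt q d = p (gridpt N i)) \/
  exists (i j : int) m, [/\ s <= i < c, (m < q)%N, p (gridpt N i) = gridpt m j &
                  p (gridpt N (i + 1)) = gridpt m (j + 1)].
Proof.
move=> std; rewrite -(pl_Vl p (gridpt N s)) -(pl_lV p _ (gridpt N c)); set x := pl_fun p^-1%g (gridpt q d) => sx xc.
have p2 := expn2_gt0 N; have n2 := expn2_neq0 N.
set i := Num.floor (x * 2 ^+ N); set t := x * 2 ^+ N - i%:~R.
have ht : 0 <= t < 1.
  by have := floor_le (x * 2 ^+ N); have := floorD1_gt (x * 2 ^+ N);
     rewrite /t -/i rmorphD /=; lra.
have xE : x = (i%:~R + t) / 2 ^+ N by rewrite /t; field.
have hi : s <= i < c.
  have h1 : s%:~R < x * 2 ^+ N by rewrite -ltr_pdivrMr.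
  have h2 : x * 2 ^+ N < c%:~R by rewrite -ltr_pdivlMr.
  have h3 := floor_le (x * 2 ^+ N).
  apply/andP; split; first by rewrite /i floor_ge_int; exact: ltW.
  by rewrite -(ltr_int R); exact: le_lt_trans h3 h2.
have [j [m hj]] := std i hi.
have px : p x = gridpt q d by rewrite /x plKV.
have [t0|tn0] := eqVneq t 0.
  have xi : x = gridpt N i by rewrite xE t0 addr0.
  left; exists i; last by rewrite -xi px.
  by move: sx xc; rewrite xi !gridpt_lt => -> ->.
right; exists i, j, m; split=> //.
(* If [m] were at least [q], the point of level [q] would lie on the grid of level [m], and [t]
   would be an integer in [[0, 1)] other than 0. *)
- rewrite ltnNge; apply/negP => qm.
  have e : gridpt q d = (j%:~R + t) / 2 ^+ m by rewrite -px xE hj //; lra.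
  have : t = (d * 2 ^+ (m - q) - j)%:~R.
    have := expn2_neq0 q; have := expn2_neq0 (m - q) => h1 h2.
    move: e; rewrite /gridpt -{1}(subnKC qm) exprD rmorphB rmorphM rmorphXn /=.
    move=> e; have -> : d%:~R = d%:~R / 2 ^+ q * 2 ^+ q :> R by field.
    by rewrite e; field; rewrite h1 h2.
  move: (_ - j) => z tE; move: ht tn0; rewrite tE intr_eq0 ler0z ltrz1; lia.
- by have := hj 0 ltac:(lra); rewrite !addr0.
- by have := hj 1 ltac:(lra); rewrite /gridpt !rmorphD.
Qed.

End StandardGrid.

(** * Two overlapping bumps generate F *)

Section GenerationTheorem.
Variable R : realType.
Implicit Types (f g h p q : pl R) (x y u v w t : R).
Variables a b : pl R.
Hypotheses (ba : bump_at 0 a) (bb : bump_at 1 b).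
Variable G : set (pl R).
Hypotheses (sG : subgroup G) (Ga : G a) (Gb : G b).

(* By [standard_mid], a standard interval subdivided by images of grid points is
   subdivided at its midpoint. *)
Lemma vinable_refine p N (s c : nat) (S1 S2 : seq R) m (j : int) : (0 < c)%N ->
  (forall i : int, s%:Z <= i < (s + c)%:Z -> standard_on p N i) ->
  p (gridpt R N s) = gridpt R m j -> p (gridpt R N (s + c)%N) = gridpt R m (j + 1) ->
  (0 < size S1 + size S2)%N ->
  vinable G (S1 ++ [:: p (gridpt R N s), p (gridpt R N (s + c)%N) & S2]) ->
  vinable G (S1 ++ [seq p (gridpt R N i%:Z) | i <- iota s c.+1] ++ S2).
Proof.
have [n] := ubnP c; elim: n s c S1 S2 m j => // n IH s c S1 S2 m j + c0 std ps pc hS.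
rewrite ltnS => cn vS; have [c1|c1] := eqVneq c 1%N.
  by move: vS; rewrite c1 addn1.
have pm := expn2_neq0 R m; have pm' := expn2_gt0 R m.
have mid : (p (gridpt R N s) + p (gridpt R N (s + c)%N)) / 2 = gridpt R m.+1 (2 * j + 1).
  by rewrite ps pc /gridpt !rmorphD rmorphM /= exprS; field.
have sc : (gridpt R N s < gridpt R N (s + c)%N) by rewrite gridpt_lt; lia.
have := vinable_split ba bb sG Ga Gb (S1 := S1) (S2 := S2) ltac:(by rewrite size_cat /= !addnS !ltnS) vS.
rewrite mid => {}vS.
have psc : p (gridpt R N s) < p (gridpt R N (s + c)%N) by rewrite pl_lt.
have := @standard_mid R p N s (s + c)%N (2 * j + 1) m.+1 std.
rewrite -mid; case; [lra|lra| |].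
  rewrite mid; case=> i /andP[si ic] iE.
  have [c1' [c2 [c10 c20 cE ii]]] : exists c1 c2 : nat, [/\ (0 < c1)%N, (0 < c2)%N, c = (c1 + c2)%N & i = (s + c1)%N].
    by exists `|i - s%:Z|%N, `|(s + c)%:Z - i|%N; split; lia.
  subst i c.
  have e1 : p (gridpt R N s) = gridpt R m.+1 (2 * j).
    by rewrite ps /gridpt rmorphM /= exprS; field.
  have e2 : p (gridpt R N (s + c1' + c2)%N) = gridpt R m.+1 (2 * j + 1 + 1).
    by rewrite -addnA pc /gridpt !rmorphD rmorphM /= exprS; field.
  rewrite iE in vS.
  have H : vinable G (S1 ++ [seq p (gridpt R N i%:Z) | i <- iota s c1'.+1] ++
      p (gridpt R N (s + (c1' + c2))%N) :: S2).
    apply: (IH s c1' S1 (_ :: S2) m.+1 (2 * j)) => //.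
    - lia.
    - by move=> i hi; apply: std; lia.
    - by rewrite /= addnS.
  rewrite -addnS iotaD map_cat -catA catA.
  apply: (IH (s + c1')%N c2 (S1 ++ _) S2 m.+1 (2 * j + 1)) => //.
  - lia.
  - by move=> i hi; apply: std; lia.
  - by rewrite size_cat size_map size_iota; lia.
  - move: H; rewrite -addn1 iotaD map_cat /= -!catA /=.
    by rewrite -addnA.
(* The image of one cell, of level at most [m], is at least as long as the interval that contains
   it, hence fills it; but the interval consists of at least two cells. *)
case=> i [j' [m' [/andP[si ic] mm e1 e2]]]; exfalso.
have h1 : p (gridpt R N s) <= gridpt R m' j' by rewrite -e1 pl_le gridpt_le.
have h2 : gridpt R m' (j' + 1) <= p (gridpt R N (s + c)%N) by rewrite -e2 pl_le gridpt_le; lia.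
have p0 : (0 : R) < (2 ^+ m)^-1 by rewrite invr_gt0.
have p1 : (2 ^+ m)^-1 <= (2 ^+ m')^-1 :> R.
  by rewrite lef_pV2 ?posrE ?expn2_gt0 // ler_eXn2l // ltr1n.
have g1 k z : gridpt R k (z + 1) = gridpt R k z + (2 ^+ k)^-1.
  by rewrite /gridpt rmorphD mulrDl mul1r.
rewrite g1 in pc; rewrite g1 in h2.
have e1' : p (gridpt R N i) = p (gridpt R N s) by rewrite e1; lra.
have e2' : p (gridpt R N (i + 1)) = p (gridpt R N (s + c)%N) by rewrite e2 g1; lra.
have inj k l : gridpt R N k = gridpt R N l -> k = l.
  by move=> e; apply/eqP; rewrite eq_le -!(gridpt_le R N) e lexx.
have := inj _ _ (pl_inj e1'); have := inj _ _ (pl_inj e2'); lia.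
Qed.

(** No image of a cell has a level below 0, so the integers 1 and 2 are images of grid points. The
    three unit intervals of the vine [[:: 0; 1; 2; 3]] are then refined one at a time. *)
Lemma vinable_image p N : supported p 0 3 ->
  (forall i : int, 0 <= i < (3 * 2 ^ N)%:Z -> standard_on p N i) ->
  vinable G [seq p (gridpt R N i%:Z) | i <- iota 0 (3 * 2 ^ N).+1].
Proof.
move=> sp std; have [G1 _ _] := sG.
have g0 : gridpt R N 0 = 0 by rewrite /gridpt mul0r.
have g3 : gridpt R N (3 * 2 ^ N)%N = 3.
  by rewrite /gridpt -pmulrn natrM natrX; field; exact: expn2_neq0.
have p3 : p 3 = 3 by apply: sp; lra.
have p0 : p 0 = 0 by apply: (supported_out (m := 1) sp); rewrite mulr1; lra.
have v0 : vinable G [:: 0; 1; 2; 3].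
  exists 1%g; split=> // i; rewrite /vine_end [(size _).-1]/=.
  by case: i => [|[|[|]]] // _ t ht; rewrite pl1 /vine /=; field.
have hint (z : int) : 0 < z < 3 -> exists i : nat, [/\ (0 < i)%N, (i < 3 * 2 ^ N)%N & p (gridpt R N i) = z%:~R].
  move=> hz; have := @standard_mid R p N 0 (3 * 2 ^ N)%N z 0 std.
  rewrite g0 g3 p0 p3 /gridpt expr0 divr1 ltr0z (_ : 3 = 3%:~R :> R) // ltr_int.
  case; [lia|lia| |by case=> ? [? [? []]]].
  by case=> -[i|i] hi e; [exists i; split; [lia|lia|rewrite e]|lia].
have [i1 [i10 i1N e1]] := hint 1 isT; have [i2 [i20 i2N e2]] := hint 2 isT.
have lt12 : (i1 < i2)%N.
  have : p (gridpt R N i1) < p (gridpt R N i2) by rewrite e1 e2; lra.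
  by rewrite pl_lt gridpt_lt; lia.
have [c2 c2E] : exists c, i2 = (i1 + c)%N by exists (i2 - i1)%N; lia.
have [c3 c3E] : exists c, (3 * 2 ^ N)%N = (i1 + c2 + c)%N by exists (3 * 2 ^ N - i2)%N; lia.
have gz (z : int) : gridpt R 0 z = z%:~R by rewrite /gridpt expr0 divr1.
rewrite c3E c2E in std g3 e2 *.
have v1 : vinable G ([::] ++ [seq p (gridpt R N i%:Z) | i <- iota 0 i1.+1] ++ [:: 2; 3]).
  apply: (@vinable_refine p N 0 i1 [::] [:: 2; 3] 0 0) => //.
  - by move=> i hi; apply: std; lia.
  - by rewrite g0 p0 gz.
  - by rewrite add0n e1 gz.
  - by rewrite add0n g0 e1 p0; exact: v0.
have v2 : vinable G ([seq p (gridpt R N i%:Z) | i <- iota 0 i1] ++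
           [seq p (gridpt R N i%:Z) | i <- iota i1 c2.+1] ++ [:: 3]).
  apply: (@vinable_refine p N i1 c2 _ [:: 3] 0 1) => //.
  - lia.
  - by move=> i hi; apply: std; lia.
  - by rewrite e1 gz.
  - by rewrite e2 gz.
  - by rewrite addnS.
  - by move: v1; rewrite -(addn1 i1) iotaD map_cat -!catA /= e1 e2.
rewrite -addnS iotaD map_cat -[X in _ ++ X]cats0.
apply: (@vinable_refine p N (i1 + c2)%N c3 _ [::] 0 2) => //.
- lia.
- by move=> i hi; apply: std; lia.
- by rewrite e2 gz.
- by rewrite g3 p3 gz.
- by rewrite size_map size_iota; lia.
- move: v2; rewrite catA -map_cat -(iotaD 0 i1 c2.+1) addnS -addn1 iotaD map_cat -!catA /=.
  by rewrite g3 p3.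
Qed.

(** On a fine enough grid [p] sends cells to standard intervals. Both the grid, as the image under
    the identity, and its image under [p] are vinable, through [q'] and [q]; cell by cell [p * q]
    agrees with [q']. *)
Theorem bumps_generate p : supported p 0 3 -> G p.
Proof.
move=> sp; have [G1 GM GV] := sG.
have d0 : dyadic (0 : R) := dyadic_nat R 0.
have [N hN] := PL_standard (plP p d0 (dyadic_nat R 3) ltac:(lra)).
have {}hN := hN N (leqnn N).
have g3 : gridpt R N (3 * 2 ^ N)%N = 3.
  by rewrite /gridpt -pmulrn natrM natrX; field; exact: expn2_neq0.
have g0 : gridpt R N 0 = 0 by rewrite /gridpt mul0r.
have std (i : int) : 0 <= i < (3 * 2 ^ N)%:Z -> standard_on p N i.
  by move=> hi; apply: hN; rewrite -?[0]g0 -?[3]g3 gridpt_le; lia.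
have [q [Gq sq hq]] := vinable_image sp std.
have s1 : supported (1%g : pl R) 0 3 by [].
have [q' [Gq' sq' hq']] := vinable_image s1 (fun i _ => ex_intro _ i (ex_intro _ N (fun t _ => erefl))).
suff -> : p = (q' * q^-1)%g by apply: (GM) => //; exact: GV.
have out (f : pl R) x : supported f 0 3 -> 3 <= x <= 32 -> f x = x.
  by move=> sf hx; apply: sf; lra.
have main x : 0 <= x < 3 -> q (p x) = q' x.
  move=> hx; have p2 := expn2_gt0 R N; have n2 := expn2_neq0 R N.
  set k := Num.truncn (x * 2 ^+ N).
  have := @truncn_itv R (x * 2 ^+ N); rewrite mulr_ge0 ?(ltW p2) //; last by case/andP: hx.
  move=> /(_ isT); rewrite -/k => /andP[k1 k2].
  set t := x * 2 ^+ N - k%:R.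
  have ht : 0 <= t <= 1 by move: k2; rewrite /t -(natr1 k); lra.
  have xE : x = (k%:~R + t) / 2 ^+ N by rewrite /t; field.
  have k3 : (k < 3 * 2 ^ N)%N.
    rewrite -(ltr_nat R) natrM natrX; apply: (le_lt_trans k1).
    by rewrite ltr_pM2r //; case/andP: hx.
  have [j [m hj]] := std k ltac:(lia).
  have sz (r : pl R) : size [seq r (gridpt R N i%:Z) | i <- iota 0 (3 * 2 ^ N).+1] = (3 * 2 ^ N).+1.
    by rewrite size_map size_iota.
  have nt (r : pl R) i : (i <= 3 * 2 ^ N)%N ->
      nth 0 [seq r (gridpt R N i%:Z) | i <- iota 0 (3 * 2 ^ N).+1] i = r (gridpt R N i).
    by move=> hi; rewrite (nth_map 0%N) ?size_iota // nth_iota.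
  have := hq k; rewrite sz => /(_ ltac:(lia) t ht).
  have := hq' k; rewrite sz => /(_ ltac:(lia) t ht).
  rewrite (nt 1%g k (ltnW k3)) (nt 1%g k.+1 k3) (nt p k (ltnW k3)) (nt p k.+1 k3) !pl1 => <-.
  have gE (i : nat) : gridpt R N i.+1 = (i%:~R + 1) / 2 ^+ N.
    by rewrite /gridpt -addn1 PoszD rmorphD.
  rewrite gE {1}/gridpt.
  have e0 := hj 0 ltac:(lra); have e1 := hj 1 ltac:(lra); rewrite addr0 in e0.
  rewrite /gridpt e0 e1 xE hj //.
  move=> e; transitivity (q ((j%:~R + 0) / 2 ^+ m + t * ((j%:~R + 1) / 2 ^+ m - (j%:~R + 0) / 2 ^+ m))).
    by congr (pl_fun q _); field; exact: expn2_neq0.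
  by rewrite e; congr (pl_fun q' _); field.
apply: pl_ext => x; have [n hn] := period_reduce 0 x.
apply: (addIr (32 * n%:~R)); rewrite -!pl_perz; move: (x + _) hn => {n}y hy.
rewrite plM; apply: (@pl_inj _ q); rewrite plKV.
have [y3|y3] := ltP y 3; first by apply: main; lra.
by rewrite !out //; lra.
Qed.

End GenerationTheorem.

Section DyadicConstants.
Variable R : realType.

Lemma dyadic0 : dyadic (0 : R). Proof. exact: (dyadic_nat R 0). Qed.
Lemma dyadic1 : dyadic (1 : R). Proof. exact: (dyadic_nat R 1). Qed.

Lemma dyadicV (n k : nat) : n = (2 ^ k)%N -> dyadic (n%:R^-1 : R).
Proof. by move=> ->; rewrite natrX; exact: dyadicVn. Qed.

End DyadicConstants.

Ltac dy := repeat first [assumption | exact: dyadic0 | exact: dyadic1 | exact: dyadic_nat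
  | exact: (@dyadicV _ 2 1 erefl) | exact: (@dyadicV _ 4 2 erefl)
  | exact: (@dyadicV _ 8 3 erefl) | exact: (@dyadicV _ 16 4 erefl)
  | apply: pl_dyadic | apply: dyadicN | apply: dyadicM | apply: dyadicD].

Ltac check_nodes := rewrite /=; do !split; first [lra | dy].

(** * Arcs whose compactly supported elements all lie in H *)

Section Good.
Variable R : realType.
Implicit Types (f g h p q k : pl R) (x y u v s t : R).

(** Allows a conjugator outside [H] to be replaced by a member of [H] with the same restriction. *)
Lemma conj_eq_on f g h u v : u <= v <= u + 32 -> supported f u v ->
  (forall x, u <= x <= v -> g x = h x) -> (f ^ g)%g = (f ^ h)%g.
Proof.
move=> uv sf gh; apply: pl_ext => x.
have [m hm] := period_reduce (g u) x.
apply: (addIr (32 * m%:~R)); rewrite -!pl_perz; move: (x + _) hm => {m}y hy.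
have gu : g u = h u by apply: gh; lra.
have gv : g v = h v by apply: gh; lra.
have [yv|vy] := leP y (g v).
  have [z [yE hz]] : exists z, y = g z /\ u <= z <= v.
    by exists (g^-1%g y); rewrite plKV pl_leV pl_Vle; split=> //; lra.
  rewrite {1}yE plJ yE (gh z hz) plJ; apply: gh.
  by apply: supported_stable => //; lra.
rewrite (supportedJ (g := g) sf) ?(supportedJ (g := h) sf) //; lra.
Qed.

Lemma disjoint_commute f g u v u' v' : supported f u v -> supported g u' v' ->
  u <= v -> v <= u' -> u' <= v' -> v' <= u + 32 -> (f * g)%g = (g * f)%g.
Proof.
move=> sf sg uv vu uv' vu'; apply: pl_ext => x.
have [m hm] := period_reduce u x.
apply: (addIr (32 * m%:~R)); rewrite -!pl_perz; move: (x + _) hm => {m}y hy.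
rewrite !plM.
have gout z : u <= z <= u' -> g z = z.
  by move=> hz; apply: (supported_out (m := 1) sg); rewrite mulr1; lra.
have [yv|vy] := leP y v.
  have := supported_stable (x := y) sf; rewrite (gout y); last lra.
  by move=> hf; apply: gout; have := hf ltac:(lra) ltac:(lra); lra.
rewrite (sf y); last lra.
have [yu|uy] := leP y u'; first by rewrite (gout y) ?sf //; lra.
have [yv'|vy'] := leP y v'; last by rewrite sg ?sf //; lra.
by have := supported_stable (x := y) sg ltac:(lra) ltac:(lra) => hg; rewrite sf //; lra.
Qed.

Lemma pl_shift_exists (c : R) : dyadic c -> exists f, forall x, f x = x + c.
Proof.
move=> dc; have d32 := dyadic_nat R 32; have d0 := dyadic_nat R 0.
have [||f /= [f0 [fc _]]] := @interpolation R 0 c (32, c + 32) [::].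
- by check_nodes.
- by rewrite /= add0r.
exists f => x; have [m hm] := period_reduce 0 x.
apply: (addIr (32 * m%:~R)); rewrite -!pl_perz addrAC; move: (x + _) hm => {m}y hy.
by rewrite (fc 0) ?expr0z; [ring|ring|lra].
Qed.

Lemma bump_shift a f : bump_at 0 a -> (forall x, f x = x + 1) -> bump_at 1 (a ^ f)%g.
Proof.
move=> [a0 a1 a2 a3] fE; split=> [|x hx|x hx|x hx].
- by have := supportedJ (g := f) a0; rewrite !fE add0r => h; apply: (supportedS h); lra.
- by have := plJ a f (x - 1); rewrite !fE subrK => ->; rewrite a1; lra.
- by have := plJ a f (x - 1); rewrite !fE subrK => ->; rewrite a2; lra.
- by have := plJ a f (x - 1); rewrite !fE subrK => ->; rewrite a3; lra.
Qed.

(* With a = x0 x1^-1 and b = x1 in Thompson's group F this is x1 x2^-1. *)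
Lemma bump_commutator a b : bump_at 0 a -> bump_at 1 b ->
  exists f, [/\ f 0 = 1, f 2 = 5 / 2 & [~ a, b]%g = (a ^ f)%g].
Proof.
move=> ba bb; have [a0 a1 a2 a3] := ba; have [b0 b1 b2 b3] := bb.
have [||f /= [f0 [fa [f1 [fb [f2 _]]]]]] := @interpolation R 0 1 (1, 2) [:: (2, 5 / 2); (32, 33)].
- by check_nodes.
- by congr (_, _); lra.
have {}fa t : 0 <= t <= 1 -> f t = 1 + t by move=> ht; rewrite (fa 0) ?expr0z; [ring|ring|lra].
have {}fb t : 1 <= t <= 2 -> f t = 2 + (t - 1) / 2.
  by move=> ht; rewrite (fb (-1)) ?exprN1; [field|lra|lra].
have saf := supportedJ (g := f) a0.
exists f; split=> //.
have c0 y : 0 <= y <= 1 \/ 5 / 2 <= y <= 3 -> (a ^ f)%g y = y.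
  case=> hy; last by apply: saf; rewrite f0 add0r f2; lra.
  by apply: (supported_out (m := 1) saf); rewrite f0 add0r f2 mulr1; lra.
have c1 y : 1 <= y <= 3 / 2 -> (a ^ f)%g y = 2 * y - 1.
  move=> hy; have := plJ a f (y - 1); rewrite (fa (y - 1)) ?(addrC 1) ?subrK; last lra.
  by move=> ->; rewrite a1 ?fa; lra.
have c2 y : 3 / 2 <= y <= 5 / 2 -> (a ^ f)%g y = y / 2 + 5 / 4.
  move=> hy; have [y2|y2] := leP y 2.
    have := plJ a f (y - 1); rewrite (fa (y - 1)) ?(addrC 1) ?subrK; last lra.
    by move=> ->; rewrite a2 ?fb; lra.
  have := plJ a f (2 * y - 3); rewrite (fb (2 * y - 3)); last lra.
  rewrite (_ : 2 + (2 * y - 3 - 1) / 2 = y); last by field.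
  by move=> ->; rewrite a3 ?fb; lra.
suff e : (a * b = b * a * (a ^ f))%g.
  by rewrite commgEl (conjgE a b) e; move: (a ^ f)%g => c; rewrite !mulgA mulgVK mulVg mul1g.
have sa : supported a 0 3 by apply: (supportedS a0); lra.
have sb : supported b 0 3 by move=> x hx; apply: b0; lra.
have sc : supported (a ^ f)%g 0 3 by move=> x hx; apply: saf; rewrite f0 add0r f2; lra.
apply: pl_ext => x; have [m hm] := period_reduce 0 x.
apply: (addIr (32 * m%:~R)); rewrite -!pl_perz; move: (x + _) hm => {m}y hy.
have [y3|y3] := leP 3 y.
  by rewrite (plM a b) (plM (b * a)%g) (plM b a) (sb y) ?(sa y) ?(sb y) ?(sc y) //; lra.
rewrite (plM (b * a)%g) (plM b a).
have [y1|y1] := leP y 1.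
  rewrite (vine0E ba bb) ?(bump1_id bb); [|lra|lra].
  have [h|h] := leP y (1 / 2).
    by rewrite a1 ?c0; lra.
  by rewrite a2 ?c1; lra.
rewrite (vine0E' ba bb); last lra.
have aid z : 2 <= z <= 3 -> a z = z by move=> hz; apply: a0; lra.
have [y2|y2] := leP y (3 / 2).
  by rewrite b1 ?a3 ?c2; lra.
have [y4|y4] := leP y 2.
  by rewrite b2 ?aid ?c2; lra.
by rewrite b3 ?aid ?c0; lra.
Qed.

Variable H : set (pl R).
Hypothesis sH : subgroup H.

(** Supports stay strictly inside the arc because the normal subgroup argument yields only elements
    that are trivial near both ends. *)
Definition good x y := forall u v f, x < u -> u < v -> v < y -> supported f u v -> H f.

Lemma good_sub x y x' y' : good x y -> x <= x' -> y' <= y -> good x' y'.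
Proof. by move=> h xx yy u v f xu uv vy; apply: h => //; lra. Qed.

Lemma good_conj x y h : good x y -> H h -> good (h x) (h y).
Proof.
move=> gxy Hh u v f xu uv vy sf; rewrite -[f](conjgKV h).
apply: subgroupJ => //; have := supportedJ (g := h^-1%g) sf.
by apply: gxy; rewrite ?pl_Vl ?pl_lV ?pl_lt ?plKV.
Qed.

Lemma good_shift x y (m : int) : good x y -> good (x + 32 * m%:~R) (y + 32 * m%:~R).
Proof.
move=> gxy u v f xu uv vy sf; apply: (gxy (u - 32 * m%:~R) (v - 32 * m%:~R)); try lra.
by move=> z hz; apply: (supported_out (m := m) sf); lra.
Qed.

(** A support that starts at or before [x'] is pushed into the second arc by some [k] in [H],
    supported inside the first arc, that moves a point [u0 < u] to a point [w > x']. *)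
Lemma good_union x y x' y' : good x y -> good x' y' ->
  x < x' -> x' < y -> y < y' -> y' <= x + 32 -> good x y'.
Proof.
move=> g1 g2 xx' x'y yy' y'x u v f xu uv vy sf.
have [ux|ux] := ltP x' u; first exact: (g2 u v).
have [s [ds xs su]] := dyadic_dense xu.
have [u0 [du0 su0 u0u]] := dyadic_dense su.
have [w [dw xw wy]] := dyadic_dense x'y.
have [t [dt wt ty]] := dyadic_dense wy.
have [||k /= [k0 [_ [ku [_ [kt [kid _]]]]]]] := @interpolation R s s (u0, w) [:: (t, t); (s + 32, s + 32)].
- by check_nodes.
- by [].
have sk : supported k s t.
  by move=> z hz; rewrite (kid 0) ?expr0z; [ring|ring|lra].
have Hk : H k by apply: (g1 s t) => //; lra.
have kuw : w < k u by rewrite -ku pl_lt.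
rewrite -[f](conjgK k); apply: subgroupJ => //; last by case: sH => _ _; apply.
apply: (g2 (k u) (k v)).
- lra.
- by rewrite pl_lt.
- have [vt|vt] := ltP v t; first by have : k v < k t by [rewrite pl_lt]; rewrite kt; lra.
  by rewrite sk //; lra.
- exact: supportedJ.
Qed.

(* L := { f in H | f supported on [0, 3] } is normalised by all elements
   supported on [0, 3]; being nontrivial it contains commutators, hence a bump,
   hence all bumps, hence everything compactly supported in (0, 3). *)
Lemma good_of_realization (a l : pl R) : bump_at 0 a ->
  H l -> supported l 0 3 -> (forall s, 0 <= s <= 1 -> l s = s / 2) ->
  (forall p, supported p 0 3 -> exists2 q, H q & forall x, 0 <= x <= 3 -> q x = p x) ->
  good 0 3.
Proof.
move=> ba Hl sl lE real; have [H1 HM HV] := sH.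
have d32 := dyadic_nat R 32; have d0 := dyadic_nat R 0; have d3 := dyadic_nat R 3.
have [sh shE] := pl_shift_exists (dyadic_nat R 1).
have bb := bump_shift ba shE; set b := (a ^ sh)%g in bb.
pose L f := H f /\ supported f 0 3.
have LJ f p : L f -> supported p 0 3 -> L (f ^ p)%g.
  (* Here [p] need not lie in [H], but [q] does, and the two agree on the support of [f]. *)
  move=> [Hf sf] sp; have [q Hq qE] := real p sp.
  rewrite -(conj_eq_on _ sf qE); last lra.
  split; first exact: subgroupJ.
  have [q0 q3] : q 0 = 0 /\ q 3 = 3.
    split; rewrite qE; try lra; last by apply: sp; lra.
    by apply: (supported_out (m := 1) sp); rewrite mulr1; lra.
  by have := supportedJ (g := q) sf; rewrite q0 q3.
have LM f g : L f -> L g -> L (f * g)%g.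
  by move=> [? ?] [? ?]; split; [exact: HM|exact: supportedM].
have LV f : L f -> L f^-1%g.
  by move=> [? ?]; split; [exact: HV|exact: supportedV].
(* As [l] moves [[1/4, 1/2]] to [[1/8, 1/4]], the factor [p^-1 ^ l] of [[~ l, p]] commutes with [q]
   and drops out of [[~ [~ l, p], q]], which lies in [L] because [l] does. *)
have LC p q : supported p (1 / 4) (1 / 2) -> supported q (1 / 4) (1 / 2) -> L [~ p, q]%g.
  move=> sp sq.
  have sp3 : supported p 0 3 by apply: (supportedS sp); lra.
  have sq3 : supported q 0 3 by apply: (supportedS sq); lra.
  have sr : supported (p^-1 ^ l)%g (1 / 8) (1 / 4).
    have := supportedJ (g := l) (supportedV sp); rewrite !lE; try lra.
    by move=> h; apply: (supportedS h); lra.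
  have rq := disjoint_commute sr sq ltac:(lra) ltac:(lra) ltac:(lra) ltac:(lra).
  have Ll : L l by [].
  have L1 : L [~ l, p]%g by rewrite commgEl; apply: LM; [exact: LV|exact: LJ].
  have L2 : L [~ [~ l, p], q]%g by rewrite commgEl; apply: LM; [exact: LV|exact: LJ].
  move: L2; rewrite (commgEr l p); set r := (p^-1 ^ l)%g in rq *.
  suff -> : [~ r * p, q]%g = [~ p, q]%g by [].
  by rewrite !commgEl conjMg (_ : (r ^ q)%g = r) ?invgM ?mulgA ?mulgVK // conjgE rq mulKg.
have [nu [nu0 nu2 nuE]] := bump_commutator ba bb.
(* Shrinks [[0, 3]] into [[1/4, 1/2]], so that [LC] applies to the conjugates of [a] and [b]; their
   commutator is a conjugate of [a]. *)
have [||rho /= [rho0 [rhoE [rho3 _]]]] := @interpolation R 0 (1 / 4) (3, 7 / 16) [:: (32, 1 / 4 + 32)].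
- by check_nodes.
- by congr (_, _); lra.
have {}rhoE t : 0 <= t <= 3 -> rho t = 1 / 4 + t / 16.
  move=> ht; have e : (2 : R) ^ (-4) = 1 / 16 by rewrite -invr_expz -exprnP !exprS expr0; field.
  by have := rhoE (-4); rewrite e => -> //; [field|field].
have sa : supported a 0 3 by case: ba => h _ _ _; apply: (supportedS h); lra.
have sb : supported b 0 3 by case: bb => h _ _ _ x hx; apply: h; lra.
have sJ f : supported f 0 3 -> supported (f ^ rho)%g (1 / 4) (1 / 2).
  move=> sf; have := supportedJ (g := rho) sf; rewrite rho0 rho3 => h.
  by apply: (supportedS h); lra.
have Lbump : L (a ^ (nu * rho))%g.
  by rewrite conjgM -nuE conjRg; apply: LC; exact: sJ.
(* Any two conjugates of [a] supported inside [(0, 3)] are conjugate by an element supported on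
   [[0, 3]], and [L] is stable under such conjugations. *)
have La (mu : pl R) : 0 < mu 0 -> mu 2 < 3 -> L (a ^ mu)%g.
  move=> mu0 mu2; case: ba => a0 _ _ _.
  have e0 : (nu * rho)%g 0 = 5 / 16 by rewrite plM nu0 rhoE; lra.
  have e2 : (nu * rho)%g 2 = 13 / 32 by rewrite plM nu2 rhoE; lra.
  have [||||||||||k [sk kE]] := @pl_extension R ((nu * rho)^-1 * mu)%g ((nu * rho)%g 0) ((nu * rho)%g 2) 0 3.
  - exact: pl_dyadic.
  - by apply: pl_dyadic; exact: (dyadic_nat R 2).
  - by [].
  - by [].
  - by rewrite e0; lra.
  - by rewrite pl_lt; lra.
  - by rewrite e2; lra.
  - by rewrite (plM (nu * rho)^-1%g) plVK.
  - by rewrite (plM (nu * rho)^-1%g) plVK.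
  - lra.
  have -> : (a ^ mu = (a ^ (nu * rho)) ^ k)%g.
    rewrite (conj_eq_on _ _ kE); first by rewrite -conjgM mulVKg.
      by rewrite e0 e2; lra.
    by have := supportedJ (g := (nu * rho)%g) a0; rewrite add0r.
  exact: LJ.
move=> u v f u0 uv v3 sf.
have [u' [du' u'0 u'u]] := dyadic_dense u0.
have [v' [dv' vv' v'3]] := dyadic_dense v3.
(* The support of [f] lies in the image of [[0, 3]] under [mu], on which the conjugates of [a] and
   [b] by [mu] generate. *)
have [||mu /= [mu0 [_ [mu3 _]]]] := @interpolation R 0 u' (3, v') [:: (32, u' + 32)].
- by check_nodes.
- by rewrite /= add0r.
suff : L ((f ^ mu^-1) ^ mu)%g by rewrite conjgKV => -[].
have mu03 : mu 1 < mu 3 by rewrite pl_lt; lra.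
have mu01 : mu 0 < mu 1 by rewrite pl_lt; lra.
have mu02 : mu 2 < mu 3 by rewrite pl_lt; lra.
apply: (@bumps_generate R a b ba bb [set g | L (g ^ mu)%g]).
- split=> [|x y /= hx hy|x /= hx].
  + by rewrite /= conj1g; split.
  + by rewrite conjMg; exact: LM.
  + by rewrite conjVg; exact: LV.
- by apply: La; lra.
- rewrite /= -conjgM; apply: La; rewrite plM shE.
    by rewrite add0r; lra.
  by rewrite (_ : 2 + 1 = 3); lra.
- have := supportedJ (g := mu^-1%g) sf => h; apply: (supportedS h).
    by rewrite pl_Vle mu0 ltW.
  by rewrite pl_leV mu3 ltW.
Qed.

End Good.

Section Fill.
Variable R : realType.
Implicit Types (f g h p q k : pl R) (x y u v s t : R).
Variable H : set (pl R).
Hypothesis sH : subgroup H.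

(** Some [h] in [H] agrees with [g] near [c]. Then [g * h^-1] is trivial near [c], so its support
    lies inside [(c, c + 32)]. *)
Lemma good_local_match x y c g : good H x y -> y <= x + 32 -> x < c < y -> x < g c < y ->
  good H c (c + 32) -> H g.
Proof.
move=> gxy yx hc hgc gc; have [_ HM HV] := sH.
have [u [du u1 u2]] : exists u, [/\ dyadic u, Num.max x (g^-1%g x) < u & u < c].
  by apply: dyadic_dense; rewrite gt_max pl_lV; lra.
have [v [dv v1 v2]] : exists v, [/\ dyadic v, c < v & v < Num.min y (g^-1%g y)].
  by apply: dyadic_dense; rewrite lt_min pl_Vl; lra.
move: u1 v2; rewrite gt_max lt_min pl_lV pl_Vl => /andP[xu xgu] /andP[vy gvy].
have [s [ds xs]] : exists s, [/\ dyadic s, x < s & s < Num.min u (g u)].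
  by apply: dyadic_dense; rewrite lt_min xu xgu.
rewrite lt_min => /andP[su sgu].
have [t [dt]] : exists t, [/\ dyadic t, Num.max v (g v) < t & t < y].
  by apply: dyadic_dense; rewrite gt_max vy gvy.
rewrite gt_max => /andP[vt gvt] ty.
have [|h [sh hE]] := pl_extension du dv ds dt su (lt_trans u2 v1) vt sgu gvt; first lra.
have Hh : H h by apply: (gxy s t) => //; lra.
have -> : g = (g * h^-1 * h)%g by rewrite mulgVK.
apply: (HM) => //; apply: (gc v (u + 32)); try lra.
move=> z hz; apply: (addIr (32 * (-1)%:~R)); rewrite -pl_perz plM -hE ?plVK //.
by rewrite rmorphN1; lra.
Qed.

End Fill.

Ltac block := first [by constructor 1|by constructor 2|by constructor 3|by constructor 4].

(** * The explicit configuration of zeta and the conjugate of alpha *)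

Section Configuration.
Variable R : realType.
Implicit Types (f g h p q k : pl R) (x y u s t : R).

(* [step] satisfies al o step = a o al up to translation, see [v_arc2], and it is
   translation by 1 on [0, 2], so that it conjugates a to its shift b. *)
Definition step (s : R) := if s <= 0 then 2 * s + 1 else if s <= 2 then s + 1 else s / 2 + 2.

Definition in_arc (u v y : R) := exists m : int, u <= y + 32 * m%:~R <= v.

Lemma in_arc_shift u v y (m : int) : in_arc u v (y + 32 * m%:~R) <-> in_arc u v y.
Proof.
split=> -[n hn]; first by exists (m + n); rewrite rmorphD mulrDr addrA.
by exists (n - m); rewrite rmorphB /=; lra.
Qed.

Lemma in_arc0 u v y : u <= y <= v -> in_arc u v y.
Proof. by move=> hy; exists 0; rewrite mulr0 addr0. Qed.

Lemma step_bounds s : -1 <= s <= 4 -> -1 <= step s <= 4.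
Proof. by rewrite /step; case: ifP => h1; [|case: ifP => h2]; lra. Qed.

Definition in_arcs y := [\/ in_arc (- (21 / 2)) (- (3 / 2)) y, in_arc (-1) 4 y | in_arc 7 20 y].

(* z is the quarter turn x + 8 composed with [step] on the arc [-9, -4], so that
   z^4 is the full turn tau times four disjoint copies of [step].  The arcs of
   [in_arcs] contain the supports of these copies, and al carries the copy on
   [-9, -4] to the bump a on [0, 2]. *)
Record config (tau z a al : pl R) : Prop := Config {
  config_tauE : forall x, tau x = x + 32;
  config_z1 : forall x, -9 <= x <= -4 -> z x = step (x + 8);
  config_z2 : forall x, -4 <= x <= 23 -> z x = x + 8;
  config_ba : bump_at 0 a;
  config_al1 : forall x, - (21 / 2) <= x <= -10 -> al x = x + 19 / 2;
  config_al2 : forall x, -9 <= x <= -8 -> al x = x + 9;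
  config_al3 : forall x, -8 <= x <= -7 -> al x = x / 2 + 5;
  config_al4 : forall x, -7 <= x <= -6 -> al x = x / 4 + 13 / 4;
  config_al5 : forall x, -6 <= x <= -4 -> al x = x / 8 + 5 / 2;
  config_al6 : forall x, -4 <= x <= -2 -> al x = x / 2 + 4;
  config_al7 : forall x, -2 <= x <= - (3 / 2) -> al x = 2 * x + 7;
  config_alJ3 : forall x, 7 <= x <= 20 -> ~ in_arcs (al x)
}.

Variables (tau z a al : pl R).
Hypothesis C : config tau z a al.
Let tauE := config_tauE C.
Let z1 := config_z1 C.
Let z2 := config_z2 C.
Let ba := config_ba C.
Let al1 := config_al1 C.
Let al2 := config_al2 C.
Let al3 := config_al3 C.
Let al4 := config_al4 C.
Let al5 := config_al5 C.
Let al6 := config_al6 C.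
Let al7 := config_al7 C.
Let alJ3 := config_alJ3 C.

Definition wmap : pl R := (z * z * z * z * tau^-1)%g.
Let w := wmap.

Lemma wE x : w x = z (z (z (z x))) - 32.
Proof. by apply: (addIr 32); rewrite subrK -tauE /w /wmap !plM plKV. Qed.

Lemma z_per x : z (x + 32) = z x + 32. Proof. exact: pl_per. Qed.

(** Of four successive applications of [z], exactly one meets the arc [[-9, -4]] modulo the period
    and applies [step]; the translations by 8 add up to the full turn that [w] removes. *)
Lemma w_step c s : [\/ c = -8, c = 0, c = 8 | c = 16] -> -1 <= s <= 4 -> w (s + c) = step s + c.
Proof.
move=> hc hs; have hb := step_bounds hs.
have zs : z (s - 8) = step s by rewrite z1 ?subrK; lra.
have zs' : z (s + 24) = step s + 32 by rewrite -zs -z_per; congr (z _); lra.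
have zz t : -4 <= t <= 23 -> z t = t + 8 by exact: z2.
rewrite wE; case: hc => ->.
- by rewrite zs (zz (step s)) ?(zz (step s + 8)) ?(zz (step s + 8 + 8)); lra.
- rewrite addr0 (zz s) ?(zz (s + 8)) ?(zz (s + 8 + 8)); [|lra|lra|lra].
  by rewrite (_ : s + 8 + 8 + 8 = s + 24) ?zs'; lra.
- rewrite (zz (s + 8)) ?(zz (s + 8 + 8)); [|lra|lra].
  by rewrite (_ : s + 8 + 8 + 8 = s + 24) ?zs' ?z_per ?(zz (step s)); lra.
- rewrite (zz (s + 16)); last lra.
  by rewrite (_ : s + 16 + 8 = s + 24) ?zs' ?z_per ?(zz (step s)) ?z_per ?(zz (step s + 8)); lra.
Qed.

Lemma w_id c s : [\/ c = -8, c = 0, c = 8 | c = 16] -> 4 <= s <= 7 -> w (s + c) = s + c.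
Proof.
move=> hc hs; have zz t : -4 <= t <= 23 -> z t = t + 8 by exact: z2.
have zz' t : 28 <= t <= 55 -> z t = t + 8.
  by move=> ht; rewrite (_ : t = t - 32 + 32) ?z_per ?zz; lra.
rewrite wE; case: hc => ->.
- by rewrite (zz (s - 8)) ?(zz (s - 8 + 8)) ?(zz (s - 8 + 8 + 8)) ?(zz (s - 8 + 8 + 8 + 8)); lra.
- by rewrite addr0 (zz s) ?(zz (s + 8)) ?(zz (s + 8 + 8)) ?(zz' (s + 8 + 8 + 8)); lra.
- by rewrite (zz (s + 8)) ?(zz (s + 8 + 8)) ?(zz' (s + 8 + 8 + 8)) ?(zz' (s + 8 + 8 + 8 + 8)); lra.
- by rewrite (zz (s + 16)) ?(zz' (s + 16 + 8)) ?(zz' (s + 16 + 8 + 8)) ?(zz' (s + 16 + 8 + 8 + 8)); lra.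
Qed.

Lemma w_fix_ends : [/\ w (- (21 / 2)) = - (21 / 2), w (- (3 / 2)) = - (3 / 2),
  w (-1) = -1, w 4 = 4 & w 7 = 7 /\ w 20 = 20].
Proof.
have h c s := @w_id c s; split.
- by have := h 16 (11 / 2) ltac:(block) ltac:(lra); rewrite (_ : 11 / 2 + 16 = - (21 / 2) + 32) ?pl_per; [lra|lra].
- by have := h (-8) (13 / 2) ltac:(block) ltac:(lra); rewrite (_ : 13 / 2 - 8 = - (3 / 2)) //; lra.
- by have := h (-8) 7 ltac:(block) ltac:(lra); rewrite (_ : 7 - 8 = -1) //; lra.
- by have := h 0 4 ltac:(block) ltac:(lra); rewrite addr0.
- split; first by have := h 0 7 ltac:(block) ltac:(lra); rewrite addr0.
  by have := h 16 4 ltac:(block) ltac:(lra); rewrite (_ : 4 + 16 = 20) //; lra.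
Qed.

Lemma stable_arc f u v y : f u = u -> f v = v -> in_arc u v (f y) <-> in_arc u v y.
Proof.
move=> fu fv; split=> -[m]; rewrite -?pl_perz => hm; exists m; last rewrite -pl_perz.
  by move: hm; rewrite -{1}fu -{1}fv !pl_le.
by rewrite -{1}fu -{1}fv !pl_le.
Qed.

Lemma w_arcs y : [/\ in_arc (- (21 / 2)) (- (3 / 2)) (w y) <-> in_arc (- (21 / 2)) (- (3 / 2)) y,
  in_arc (-1) 4 (w y) <-> in_arc (-1) 4 y & in_arc 7 20 (w y) <-> in_arc 7 20 y].
Proof. by have [w1 w2 w3 w4 [w5 w6]] := w_fix_ends; split; exact: stable_arc. Qed.

Lemma w_out y : ~ in_arcs y -> w y = y.
Proof.
move=> ny; have [m hm] := period_reduce (- (21 / 2)) y.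
apply: (addIr (32 * m%:~R)); rewrite -pl_perz.
have {ny} : ~ in_arcs (y + 32 * m%:~R).
  by case=> /in_arc_shift h; apply: ny; [constructor 1|constructor 2|constructor 3].
move: (y + _) hm => {m}x hx nx.
have n1 : - (3 / 2) < x by rewrite ltNge; apply/negP => h; apply: nx; constructor 1; apply: in_arc0; lra.
have [n2|n2] : x < -1 \/ 4 < x.
  have [h|h] := ltP x (-1); first by left.
  by right; rewrite ltNge; apply/negP => h'; apply: nx; constructor 2; apply: in_arc0; lra.
- by have := @w_id (-8) (x + 8) ltac:(block) ltac:(lra); rewrite addrK.
have [n3|n3] : x < 7 \/ 20 < x.
  have [h|h] := ltP x 7; first by left.
  by right; rewrite ltNge; apply/negP => h'; apply: nx; constructor 3; apply: in_arc0; lra.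
- by have := @w_id 0 x ltac:(block) ltac:(lra); rewrite addr0.
by have := @w_id 16 (x - 16) ltac:(block) ltac:(lra); rewrite subrK.
Qed.

Lemma w_arc1 y : - (21 / 2) <= y <= - (3 / 2) -> ~ (-9 <= y <= -4) -> w y = y.
Proof.
move=> hy ny; have [h|h] := ltP y (-9).
  have := @w_id 16 (y + 16) ltac:(block) ltac:(lra).
  rewrite (_ : y + 16 + 16 = y + 32) ?pl_per; last lra.
  by move/addIr.
have h' : -4 < y by rewrite ltNge; apply/negP => h'; apply: ny; lra.
by have := @w_id (-8) (y + 8) ltac:(block) ltac:(lra); rewrite addrK.
Qed.

Let v := (w ^ al)%g.

Lemma al_ends : [/\ al (- (21 / 2)) = -1, al (- (3 / 2)) = 4, al (-9) = 0, al (-2) = 3 & al (-4) = 2].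
Proof. by split; [rewrite al1|rewrite al7|rewrite al2|rewrite al6|rewrite al6]; lra. Qed.

Lemma a_id s : -1 <= s <= 4 -> s <= 0 \/ 2 <= s -> a s = s.
Proof.
case: ba => a0 _ _ _ hs [h|h]; last by apply: a0; lra.
by apply: (supported_out (m := 1) a0); rewrite mulr1; lra.
Qed.

(** The pieces of [al] are made to conjugate the copy of [step] on [[-9, -4]] to [a]; the cases
    follow the breakpoints of both maps. *)
Lemma v_arc2 s : -1 <= s <= 4 -> v s = a s.
Proof.
move=> hs; have [e1 e2 e3 e4 e5] := al_ends; have [_ a1 a2 a3] := ba.
have [x [sE hx]] : exists x, s = al x /\ - (21 / 2) <= x <= - (3 / 2).
  by exists (al^-1%g s); rewrite plKV; split=> //; rewrite pl_Vle pl_leV e1 e2.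
rewrite sE /v plJ.
have [[x1 x2]|nx] := pselect (-9 <= x /\ x <= -4); last first.
  rewrite w_arc1 //; last by move=> /andP.
  rewrite a_id //; first by rewrite -e1 -e2 !pl_le.
  rewrite -e3 -e5 !pl_le; have [h|h] := leP x (-9); [by left|right].
  by rewrite leNgt; apply/negP => h'; apply: nx; split; exact: ltW.
have := @w_step (-8) (x + 8) ltac:(block) ltac:(lra); rewrite addrK /step => ->.
have [y1|y1] := leP x (-8).
  rewrite ifT; last lra.
  have [y2|y2] := leP x (- (17 / 2)).
    by rewrite (al2 (x := x)) ?a1 ?al2; lra.
  by rewrite (al2 (x := x)) ?a2 ?al3; lra.
rewrite ifF; last by apply/negbTE; rewrite -ltNge; lra.
have [y2|y2] := leP x (-7).
  by rewrite ifT ?(al3 (x := x)) ?a3 ?al4; lra.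
have [y3|y3] := leP x (-6).
  by rewrite ifT ?(al4 (x := x)) ?a3 ?al5; lra.
rewrite ifF; last by apply/negbTE; rewrite -ltNge; lra.
by rewrite (al5 (x := x)) ?a3 ?al5; lra.
Qed.

End Configuration.

(** * The commutator of zeta^4 and its conjugate *)

Section Commutator.
Variable R : realType.
Implicit Types (f g h p q k : pl R) (x y u s t : R).
Variables (tau z a al : pl R).
Hypothesis C : config tau z a al.
Let tauE := config_tauE C.
Let ba := config_ba C.
Let alJ3 := config_alJ3 C.

Let w := wmap tau z.
Let v := (w ^ al)%g.

Lemma in_arc_map f u t y : in_arc u t y <-> in_arc (f u) (f t) (f y).
Proof. by split=> -[m hm]; exists m; move: hm; rewrite -pl_perz !pl_le. Qed.

Lemma in_arc_per u t y : in_arc (u + 32) (t + 32) y <-> in_arc u t y.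
Proof.
split=> -[m hm]; [exists (m - 1)|exists (m + 1)]; move: hm.
  by rewrite rmorphB /=; lra.
by rewrite rmorphD /=; lra.
Qed.

Lemma in_arc_disj u t u' t' y : t < u' -> t' < u + 32 -> in_arc u t y -> in_arc u' t' y -> False.
Proof.
move=> h1 h2 [m hm] [n hn].
by apply: (@int_open_unit R (n - m)); rewrite rmorphB /=; lra.
Qed.

(** An involution of the circle, with its lift chosen so that the square is a single turn. *)
Definition order2 := forall x, al (al x) = x + 32.
Hypothesis al_cases : (forall x, -1 <= x <= 4 -> ~ in_arcs (al x)) \/ order2.

Let J1 : R -> Prop := in_arc (- (21 / 2)) (- (3 / 2)).
Let J2 : R -> Prop := in_arc (-1) 4.
Let J3 : R -> Prop := in_arc 7 20.

Lemma al_J1 y : J1 y <-> J2 (al y).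
Proof. by have [e1 e2 _ _ _] := al_ends C; rewrite /J1 (in_arc_map al) e1 e2. Qed.

Lemma al_J2 y : order2 -> J2 y <-> J1 (al y).
Proof.
move=> o2; have [e1 e2 _ _ _] := al_ends C; rewrite /J2 (in_arc_map al) -e1 -e2 !o2.
exact: in_arc_per.
Qed.

Lemma al_J3 y : J3 y -> ~ in_arcs (al y).
Proof. by move=> [m /alJ3] h; rewrite pl_perz in h => h'; apply: h; case: h' => /in_arc_shift h'; [constructor 1|constructor 2|constructor 3]. Qed.

Lemma al_J2' y : ~ order2 -> J2 y -> ~ in_arcs (al y).
Proof.
case: al_cases => // hB _ [m /hB] h; rewrite pl_perz in h => h'; apply: h.
by case: h' => /in_arc_shift h'; [constructor 1|constructor 2|constructor 3].
Qed.

(** A point moved by [v] is the image under [al] of a point of the arcs. Now [al] sends [J1] onto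
    [J2] and [J3] off all arcs; it sends [J2] off all arcs, or onto [J1] in the order two case. *)
Lemma v_fix y : in_arcs y -> ~ J2 y -> (order2 -> ~ J1 y) -> v y = y.
Proof.
move=> hy n2 n1; rewrite -[y](plKV al) in hy n2 n1 *; move: (al^-1%g y) hy n2 n1 => x hy n2 n1.
rewrite /v plJ; congr (al _).
have [[h|h|h]|nx] := pselect (in_arcs x); last exact: (w_out C).
all: exfalso.
- by apply: n2; apply/al_J1.
- have [ o2|no2] := pselect order2; first by apply: (n1 o2); apply/al_J2.
  exact: (al_J2' no2 h).
- exact: (al_J3 h).
Qed.

Lemma v_J2 y : J2 (v y) <-> J2 y.
Proof.
apply: stable_arc; (rewrite (v_arc2 C); last lra); apply: (a_id C); lra.
Qed.

Lemma v_J1 y : order2 -> J1 (v y) <-> J1 y.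
Proof.
move=> o2; rewrite -[y](plKV al); move: (al^-1%g y) => x.
have [_ h _] := w_arcs C x.
by rewrite /v plJ -!al_J2.
Qed.

(* w and w ^ al commute away from the arc [-1, 4], except that they may also
   interact on its image under al when al has order two. *)
Definition vcomm : pl R := [~ v, w]%g.
Let e := vcomm.

Lemma vcommE y : e (v y) = (v ^ w)%g y.
Proof. by rewrite /e /vcomm commgEl plM plVK. Qed.

(** Away from the exceptional arcs, [v] is trivial on the arcs and [w] is trivial off them; both
    maps preserve this division, so they commute there. *)
Lemma vcomm_out y : ~ J2 y -> (order2 -> ~ J1 y) -> e y = y.
Proof.
move=> n2 n1; rewrite -[y](plKV v); set y' := v^-1%g y; rewrite vcommE.
have [hy|hy] := pselect (in_arcs y).
  have vy : v y = y by exact: v_fix.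
  have -> : y' = y by rewrite /y' -{1}vy plVK.
  have [h1 h2 h3] := w_arcs C (w^-1%g y); rewrite !plKV in h1 h2 h3.
  rewrite vy -{1}(plKV w y) plJ v_fix ?plKV //.
  - by case: hy => h; [constructor 1; apply/h1|constructor 2; apply/h2|constructor 3; apply/h3].
  - by move/h2.
  - by move=> o2 /h1; exact: n1.
have vy' : v y' = y by rewrite plKV.
have ny' : ~ in_arcs y'.
  move=> hy'; apply: (hy); rewrite -vy'.
  have [h2|h2] := pselect (J2 y'); first by case: n2; rewrite -vy'; apply/v_J2.
  suff -> : v y' = y' by [].
  apply: v_fix => // o2 h1; apply: (n1 o2); rewrite -vy'; exact/v_J1.
have wy' := w_out C ny'; rewrite -{1}wy' plJ vy'; exact: (w_out C).
Qed.

Variable sh : pl R.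
Hypothesis shE : forall x, sh x = x + 1.
Let b := (a ^ sh)%g.

Lemma b_id s : -1 <= s <= 4 -> s <= 1 \/ 3 <= s -> b s = s.
Proof.
have [b0 _ _ _] := bump_shift ba shE.
move=> hs [h|h]; last by apply: b0; lra.
by apply: (supported_out (m := 1) b0); rewrite mulr1; lra.
Qed.

(** Being translation by 1 on [[0, 2]], [w] carries [a] to its shift [b]; it sends the rest of
    [[-1, 4]], where [a] is trivial, to points fixed by [b]. *)
Lemma vw_arc2 s : -1 <= s <= 4 -> (v ^ w)%g s = b s.
Proof.
move=> hs; have [_ _ w1 w4 _] := w_fix_ends C.
have [t [sE ht]] : exists t, s = w t /\ -1 <= t <= 4.
  by exists (w^-1%g s); rewrite plKV pl_Vle pl_leV w1 w4.
have w0 t' : -1 <= t' <= 4 -> w t' = step t'.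
  by move=> h; have := w_step C (c := 0) (s := t') ltac:(block) h; rewrite !addr0.
rewrite sE plJ (v_arc2 C) // (w0 t) //.
have ha : bump_at 0 a := ba; case: (ha) => a0 _ _ _.
have [t0|t0] := ltP t 0.
  rewrite (a_id C) //; last by left; lra.
  by rewrite w0 // b_id // /step; case: ifP => ?; try lra; left; lra.
have [t2|t2] := leP t 2; last first.
  rewrite (a_id C) //; last by right; lra.
  have -> : step t = t / 2 + 2 by rewrite /step !ifF //; apply/negbTE; rewrite -ltNge; lra.
  by rewrite w0 // /step !ifF ?b_id //; try (apply/negbTE; rewrite -ltNge); try lra; right; lra.
have st r : 0 <= r <= 2 -> step r = r + 1.
  by move=> hr; rewrite /step; case: ifP => h1; [lra|rewrite ifT; lra].
have at_ := supported_stable (x := t) a0 ltac:(lra) ltac:(lra).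
by rewrite st ?w0 ?st -?shE ?plJ; lra.
Qed.

Lemma vcomm_arc2 t : -1 <= t <= 4 -> e (a t) = b t.
Proof. by move=> ht; rewrite -(v_arc2 C) // vcommE vw_arc2. Qed.

Lemma vcomm_id2 s : -1 <= s <= 4 -> s <= 0 \/ 3 <= s -> e s = s.
Proof.
move=> hs h; rewrite -{1}(a_id C (s := s)) //; last by case: h; [left|right]; lra.
by rewrite vcomm_arc2 // b_id //; case: h; [left|right]; lra.
Qed.

(** On [[-1, 4]] the commutator is [a^-1 * b], and [b] is trivial on [[0, 1]]. *)
Lemma vcomm_half s : 0 <= s <= 1 -> e s = s / 2.
Proof.
move=> hs; have [_ a1 _ _] := ba; have := @vcomm_arc2 (s / 2) ltac:(lra).
rewrite a1; last lra.
rewrite b_id; [|lra|left; lra].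
by rewrite (_ : 2 * (s / 2) - 0 = s) //; field.
Qed.

(** The further value from which [(e ^ z) 3] is found in the order two case. *)
Lemma vcomm_val : e (27 / 16) = 7 / 4.
Proof.
have [_ _ _ a3] := ba; have [_ b1 _ _] := bump_shift ba shE.
have := @vcomm_arc2 (11 / 8) ltac:(lra); rewrite a3; last lra.
rewrite b1; last lra.
have -> : 11 / 8 / 2 + 0 / 2 + 1 = 27 / 16 :> R by lra.
by have -> : 2 * (11 / 8) - 1 = 7 / 4 :> R by lra.
Qed.

Lemma notJ2 y : 4 < y < 31 -> ~ J2 y.
Proof. by move=> hy h; apply: (in_arc_disj _ _ h (in_arc0 (u := y) (v := y) _)); lra. Qed.

Lemma vcomm_supported : ~ order2 -> supported e 0 3.
Proof.
move=> no2 y hy; have [h|h] := leP y 4; first by apply: vcomm_id2; [lra|right; lra].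
have [h'|h'] := ltP y 31; first by apply: vcomm_out => //; apply: notJ2; lra.
apply: (addIr (32 * (-1)%:~R)); rewrite -pl_perz rmorphN1.
by apply: vcomm_id2; [lra|left; lra].
Qed.

(** The square of [al] is the central element [tau], so conjugation by [al] exchanges [w] and [v]
    and inverts their commutator. *)
Lemma vcommJ : order2 -> (e ^ al = e^-1)%g.
Proof.
move=> o2; rewrite /e /vcomm conjRg invgR; congr [~ _, _]%g.
rewrite /v -conjgM; have -> : (al * al = tau)%g by apply: pl_ext => x; rewrite plM o2 tauE.
by apply: pl_ext => x; rewrite -{1}(plKV tau x) plJ tauE -pl_per -tauE plKV.
Qed.

Lemma vcomm_al y : order2 -> e (al (e y)) = al y.
Proof. by move=> o2; rewrite -(plJ e al) vcommJ // plKV. Qed.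

(** Besides [[0, 3]], [e] can move only points that [al] carries into [[0, 3]]: those of [[-9, -2]],
    which is [[23, 30]] modulo the period. On the first arc this follows from [e] being conjugate to
    its inverse by [al]. *)
Lemma vcomm_order2 y : order2 -> 3 <= y <= 23 \/ 30 <= y <= 32 -> e y = y.
Proof.
move=> o2 hy; have [h|h] := leP y 4; first by apply: vcomm_id2; [lra|right; lra].
have [e1 e2 e3 e4 _] := al_ends C.
have [h'|h'] := leP 31 y.
  apply: (addIr (32 * (-1)%:~R)); rewrite -pl_perz rmorphN1.
  by apply: vcomm_id2; [lra|left; lra].
(* The arc [J1] moved by one period. *)
have [hJ|nJ] := pselect (43 / 2 <= y <= 61 / 2); last first.
  apply: vcomm_out; first by apply: notJ2; lra.
  move=> _ h1; have [g|g] : y < 43 / 2 \/ 61 / 2 < y.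
  - by have [g|g] := ltP y (43 / 2); [left|right; rewrite ltNge; apply/negP => g'; apply: nJ; rewrite g g'].
  - by apply: (in_arc_disj _ _ h1 (in_arc0 (u := y) (v := y) _)); lra.
  - move/in_arc_per: h1 => h1; by apply: (in_arc_disj _ _ h1 (in_arc0 (u := y) (v := y) _)); lra.
apply: (addIr (32 * (-1)%:~R)); rewrite -pl_perz rmorphN1 mulrN1.
apply: (@pl_inj _ al); apply: (@pl_inj _ e); rewrite vcomm_al //; apply/esym.
have b1 : -1 <= al (y - 32) <= 4 by rewrite -e1 -e2 !pl_le; lra.
by apply: vcomm_id2 => //; rewrite -e3 -e4 !pl_le; case: hy => hy; [left|right]; lra.
Qed.

End Commutator.

(** * The configuration generates all lifts *)

Section ConfigurationGenerates.
Variable R : realType.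
Implicit Types (f g h p q k l : pl R) (x y u s t : R).
Variables (tau z a al sh : pl R).
Hypothesis C : config tau z a al.
Hypothesis al_cases : (forall x, -1 <= x <= 4 -> ~ in_arcs (al x)) \/ order2 al.
Hypothesis shE : forall x, sh x = x + 1.
Let w := wmap tau z.
Let v := (w ^ al)%g.
Let e := vcomm tau z al.

Lemma z_values : [/\ z (- (17 / 2)) = 0, z (-8) = 1, z (-6) = 3 & z (- (25 / 4)) = 11 / 4].
Proof.
have z1 := config_z1 C.
by split; rewrite z1; try lra; rewrite /step; repeat case: ifP => ?; lra.
Qed.

(** The images under [z] of the two supports of [e], [[-9, -2]] and [[0, 3]], are [[-1, 6]] and
    [[8, 11]], so [e ^ z] is trivial on [[-9, -2]]. Its values at 0 and 3 come from [e] on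
    [[-9, -2]], which [al] relates to the inverse of [e] on [[0, 3]]. *)
Lemma conj_vcomm_values : order2 al -> [/\ (e ^ z)%g 0 = 1, (e ^ z)%g 3 = 11 / 4 &
  forall x, -9 <= x <= -2 -> (e ^ z)%g x = x].
Proof.
move=> o2; have [z1 z2 z3 z4] := z_values.
have al2 := config_al2 C; have al4 := config_al4 C; have al5 := config_al5 C.
have half s : 0 <= s <= 1 -> e s = s / 2 by exact: (vcomm_half C shE).
have val : e (27 / 16) = 7 / 4 by exact: (vcomm_val C shE).
have eal x y : e (al y) = al x -> e x = y.
  by move=> h; apply: (@pl_inj _ al); apply: (@pl_inj _ e); rewrite (vcomm_al C).
split.
- have := plJ e z (- (17 / 2)); rewrite z1 (eal _ (-8)) ?z2 //.
  by rewrite al2 ?half ?al2; lra.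
- have := plJ e z (-6); rewrite z3 (eal _ (- (25 / 4))) ?z4 //.
  rewrite al4 ?al5; [|lra|lra].
  have -> : - (25 / 4) / 4 + 13 / 4 = 27 / 16 :> R by lra.
  by rewrite val; lra.
- move=> x hx; apply: (addIr 32); rewrite -pl_per.
  have zt : z (x + 24) = x + 32 by rewrite (config_z2 C); lra.
  by rewrite -zt plJ (vcomm_order2 C al_cases shE) //; left; lra.
Qed.

Variable H : set (pl R).
Hypothesis sH : subgroup H.
Hypotheses (Htau : H tau) (Hz : H z) (Hal : H al).

Lemma H_w : H w.
Proof. by have [_ HM HV] := sH; exact: (HM _ _ (HM _ _ (HM _ _ (HM _ _ Hz Hz) Hz) Hz) (HV _ Htau)). Qed.

Lemma H_v : H v. Proof. exact: (subgroupJ sH H_w Hal). Qed.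

Lemma H_vcomm : H e.
Proof.
have [_ HM HV] := sH; rewrite /e /vcomm commgEl; apply: (HM); first exact: (HV _ H_v).
exact: (subgroupJ sH H_v H_w).
Qed.

(* If al has order two, e also moves points of [-9, -2]; the conjugate of e^-1 by
   e ^ z agrees with e^-1 there, and moves no point of [0, 1). *)
Lemma halving_exists : exists l, [/\ H l, supported l 0 3 & forall s, 0 <= s <= 1 -> l s = s / 2].
Proof.
have [_ HM HV] := sH.
have half s : 0 <= s <= 1 -> e s = s / 2 by exact: (vcomm_half C shE).
have [ o2|no2] := pselect (order2 al); last first.
  by exists e; split=> //; [exact: H_vcomm|exact: (vcomm_supported C al_cases shE no2)].
have [E0 E3 E9] := conj_vcomm_values o2; set E := (e ^ z)%g in E0 E3 E9.
have HE : H E by exact: (subgroupJ sH H_vcomm Hz).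
have eid y : 3 <= y <= 23 \/ 30 <= y <= 32 -> e y = y by exact: (vcomm_order2 C al_cases shE o2).
have E9' x : 23 <= x <= 30 -> E x = x.
  move=> hx; apply: (addIr (32 * (-1)%:~R)); rewrite -pl_perz rmorphN1; apply: E9; lra.
have rE x : e x = x -> (e^-1 ^ E)%g (E x) = E x.
  by move=> ex; rewrite plJ -{1}ex plVK.
exists (e * (e^-1 ^ E))%g; split=> [|y hy|s hs].
- by apply: (HM); [exact: H_vcomm|apply: subgroupJ => //; exact: (HV _ H_vcomm)].
- rewrite plM.
  have [h1|h1] := ltP y 23.
    rewrite (eid y); last by left; lra.
    rewrite -(plKV E y) rE //; apply: eid; left; rewrite pl_Vle pl_leV E3 E9'; lra.
  have [h2|h2] := ltP 30 y.
    rewrite (eid y); last by right; lra.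
    rewrite -(plKV E y) rE //; apply: eid; right; rewrite pl_Vle pl_leV E9'; last lra.
    by have := pl_per E 0; rewrite add0r => ->; rewrite E0; lra.
  have ey : 23 <= e y <= 30.
    have e23 : e 23 = 23 by apply: eid; left; lra.
    have e30 : e 30 = 30 by apply: eid; right; lra.
    by rewrite -e23 -e30 !pl_le; lra.
  by rewrite -{1}(E9' _ ey) plJ plVK E9' //; lra.
- rewrite plM half // -[X in pl_fun _ X](plKV E) rE ?plKV //.
  apply: (addIr 32); rewrite -pl_per; apply: eid; right.
  have : -2 <= E^-1%g (s / 2) <= 0 by rewrite pl_Vle pl_leV E0 E9; lra.
  lra.
Qed.

Let b := (a ^ sh)%g.

(** By [bumps_generate] only two elements need witnesses: [v] acts as [a] and [v ^ w] as [b].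
    Nothing is said about the witnesses outside [[0, 3]]. *)
Lemma realization p : supported p 0 3 -> exists2 q, H q & forall x, 0 <= x <= 3 -> q x = p x.
Proof.
have [H1 HM HV] := sH; have ba := config_ba C; have bb := bump_shift ba shE.
suff h q : supported q 0 3 -> supported q 0 3 /\ exists2 r, H r & forall x, 0 <= x <= 3 -> r x = q x.
  by move/h => [].
apply: (@bumps_generate R a b ba bb [set q | supported q 0 3 /\ exists2 r, H r & forall x, 0 <= x <= 3 -> r x = q x]).
- split=> [|x y [sx [x' Hx hx]] [sy [y' Hy hy]]|x [sx [x' Hx hx]]] /=.
  + by split=> //; exists 1%g.
  + split; first exact: supportedM.
    exists (x' * y')%g; first exact: HM.
    move=> t ht; rewrite !plM hx // hy //; apply: supported_stable => //; lra.
  + split; first exact: supportedV.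
    exists x'^-1%g; first exact: HV.
    move=> t ht; apply: (@pl_inj _ x'); rewrite plKV hx ?plKV //.
    by apply: (supported_stable (supportedV sx)); lra.
- case: (ba) => a0 _ _ _; split; first by apply: (supportedS a0); lra.
  exists v; first exact: H_v.
  by move=> x hx; apply: (v_arc2 C); lra.
- case: (bb) => b0 _ _ _; split; first by move=> x hx; apply: b0; lra.
  exists (v ^ w)%g; first exact: (subgroupJ sH H_v H_w).
  by move=> x hx; apply: (vw_arc2 C shE); lra.
Qed.

Lemma good_core : good H 0 3.
Proof.
have [l [Hl sl lE]] := halving_exists.
exact: (good_of_realization sH (config_ba C) Hl sl lE realization).
Qed.

Lemma w0E s : -1 <= s <= 4 -> w s = step s.
Proof. by move=> h; have := w_step C (c := 0) (s := s) ltac:(block) h; rewrite !addr0. Qed.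

(** Conjugation by [w] and by [w^-2] turns [(0, 3)] into [(1, 7/2)] and [(-3/4, 1)]. The union pulls
    back under [al] to [(-41/4, -7/4)], which is longer than the step 8 of the quarter turn, so the
    next arcs overlap. *)
Lemma good_wide : good H (- (3 / 4)) (7 / 2).
Proof.
have [_ HM HV] := sH.
have g1 := good_conj sH good_core H_w.
have g2 := good_conj sH (good_conj sH good_core (HV _ H_w)) (HV _ H_w).
have inv s t : -1 <= s <= 4 -> step s = t -> w^-1%g t = s.
  by move=> hs <-; rewrite -w0E // plVK.
have st1 : w^-1%g 0 = - (1 / 2) by apply: inv; [lra|rewrite /step ifT; lra].
have st2 : w^-1%g (- (1 / 2)) = - (3 / 4) by apply: inv; [lra|rewrite /step ifT; lra].
have st3 : w^-1%g 3 = 2 by apply: inv; [lra|rewrite /step ifF ?ifT; try lra; apply/negbTE; rewrite -ltNge; lra].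
have st4 : w^-1%g 2 = 1 by apply: inv; [lra|rewrite /step ifF ?ifT; try lra; apply/negbTE; rewrite -ltNge; lra].
have st5 : w 0 = 1 by rewrite w0E /step ?ifT; lra.
have st6 : w 3 = 7 / 2 by rewrite w0E /step ?ifF; try lra; apply/negbTE; rewrite -ltNge; lra.
rewrite st1 st2 st3 st4 in g2; rewrite st5 st6 in g1.
have g3 : good H (- (3 / 4)) 3 by apply: (good_union sH g2 good_core); lra.
by apply: (good_union sH g3 g1); lra.
Qed.

(** The point that [al] sends to -3/4, the left end in [good_wide]. *)
Let c0 : R := - (41 / 4).

Lemma z_c0 : [/\ z c0 = - (9 / 4), z (- (9 / 4)) = 23 / 4, z (23 / 4) = 55 / 4 & z (55 / 4) = 87 / 4].
Proof.
have z2 := config_z2 C; split; try by rewrite z2; lra.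
by apply: (addIr 32); rewrite -pl_per z2 /c0; lra.
Qed.

Lemma good_blocks : [/\ good H c0 (- (7 / 4)), good H (- (9 / 4)) (25 / 4),
  good H (23 / 4) (57 / 4) & good H (55 / 4) (89 / 4)].
Proof.
have [_ HM HV] := sH; have [zc1 zc2 zc3 zc4] := z_c0; have z2 := config_z2 C.
have g0 : good H c0 (- (7 / 4)).
  have h1 : al c0 = - (3 / 4) by rewrite (config_al1 C) /c0; lra.
  have h2 : al (- (7 / 4)) = 7 / 2 by rewrite (config_al7 C); lra.
  have := good_wide; rewrite -h1 -h2 => g.
  by have := good_conj sH g (HV _ Hal); rewrite !plVK.
have g1 : good H (- (9 / 4)) (25 / 4).
  have := good_conj sH g0 Hz; rewrite zc1 z2; last lra.
  by have -> : - (7 / 4) + 8 = 25 / 4 :> R by lra.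
have g2 : good H (23 / 4) (57 / 4).
  have := good_conj sH g1 Hz; rewrite zc2 z2; last lra.
  by have -> : 25 / 4 + 8 = 57 / 4 :> R by lra.
split=> //.
have := good_conj sH g2 Hz; rewrite zc3 z2; last lra.
by have -> : 57 / 4 + 8 = 89 / 4 :> R by lra.
Qed.

(** The four blocks cover the circle without [c0], and [z] moves the puncture. Matching an element
    at [c0] requires an arc punctured neither at [c0] nor at its image; two punctures besides [c0]
    leave a choice. *)
Lemma good_punctured : [/\ good H c0 (c0 + 32), good H (- (9 / 4)) (- (9 / 4) + 32) &
  good H (23 / 4) (23 / 4 + 32)].
Proof.
have [g0 g1 g2 g3] := good_blocks; have [zc1 zc2 zc3 zc4] := z_c0.
have g01 : good H c0 (25 / 4) by apply: (good_union sH g0 g1); rewrite /c0; lra.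
have g02 : good H c0 (57 / 4) by apply: (good_union sH g01 g2); rewrite /c0; lra.
have g3' : good H (55 / 4) (c0 + 32) by apply: (good_sub g3); rewrite /c0; lra.
have gc : good H c0 (c0 + 32) by apply: (good_union sH g02 g3'); rewrite /c0; lra.
have gc1 : good H (- (9 / 4)) (- (9 / 4) + 32).
  by have := good_conj sH gc Hz; rewrite pl_per zc1.
split=> //.
by have := good_conj sH gc1 Hz; rewrite pl_per zc2.
Qed.

(** After whole turns, [g c0] lies in the period starting at -9/4 - 32. Inside it,
    [good_local_match] applies to the arc punctured at -9/4; if [g c0] is that puncture, the arc
    punctured at 23/4 serves instead. *)
Theorem config_generates g : H g.
Proof.
have [H1 HM HV] := sH; have [g0 g1 g2] := good_punctured.
have shift x y : good H x y -> good H (x - 32) (y - 32).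
  by move=> h; have := good_shift (m := -1) h; rewrite rmorphN1 mulrN1.
have Htaun (n : nat) : exists2 k, H k & forall x, k x = x + 32 * n%:R.
  elim: n => [|n [k Hk kE]]; first by exists 1%g => // x; rewrite mulr0 addr0.
  exists (k * tau)%g; first exact: HM.
  by move=> x; rewrite plM kE (config_tauE C); ring.
have Htauz (m : int) : exists2 k, H k & forall x, k x = x + 32 * m%:~R.
  case: m => n; first exact: Htaun.
  have [k Hk kE] := Htaun n.+1; exists k^-1%g; first exact: HV.
  by move=> x; apply: (@pl_inj _ k); rewrite plKV kE NegzE rmorphN /=; ring.
have [m hm] := period_reduce (- (9 / 4) - 32) (g c0).
have [k Hk kE] := Htauz m.
have -> : g = (g * k * k^-1)%g by rewrite mulgK.
apply: (HM); last exact: HV.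
have gk : (g * k)%g c0 = g c0 + 32 * m%:~R by rewrite plM kE.
have [hl|hr] := ltP (- (9 / 4) - 32) ((g * k)%g c0).
  by apply: (good_local_match sH (shift _ _ g1) (c := c0)); rewrite // ?gk /c0; lra.
have gk' : (g * k)%g c0 = - (9 / 4) - 32 by lra.
suff Hg : H (g * k * tau)%g.
  have -> : (g * k = g * k * tau * tau^-1)%g by rewrite mulgK.
  by apply: (HM) => //; exact: HV.
have gk2 : (g * k * tau)%g c0 = - (9 / 4) by rewrite plM gk' (config_tauE C); lra.
by apply: (good_local_match sH (shift _ _ g2) (c := c0)); rewrite // ?gk2 /c0; lra.
Qed.

End ConfigurationGenerates.

(** * Conjugating alpha into normal position *)

Section Choice.
Variable R : realType.
Implicit Types (f g h p q A B : pl R) (x y u s t c : R).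

Lemma separate_above f x c : x + c < f x ->
  exists L U, [/\ L < x, x < U & forall k k', L < k -> k' < U -> k' + c < f k].
Proof.
move=> h; exists (f^-1%g ((x + c + f x) / 2)), ((x + c + f x) / 2 - c); split.
- by rewrite pl_lV; lra.
- lra.
- by move=> k k'; rewrite pl_lV; lra.
Qed.

Lemma separate_below f x c : f x < x + c ->
  exists L U, [/\ L < x, x < U & forall k k', L < k -> k' < U -> f k' < k + c].
Proof.
move=> h; exists ((x + c + f x) / 2 - c), (f^-1%g ((x + c + f x) / 2)); split.
- lra.
- by rewrite pl_Vl; lra.
- by move=> k k'; rewrite pl_Vl; lra.
Qed.

Lemma strict_period_reduce x y : (forall m : int, y <> x + 32 * m%:~R) ->
  exists m : int, x + 32 * m%:~R < y < x + 32 * m%:~R + 32.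
Proof.
move=> hy; have [m hm] := period_reduce x y; exists (- m).
have h := hy (- m); rewrite rmorphN /= in h *.
have : x <> y + 32 * m%:~R by move=> e; apply: h; lra.
move/eqP; rewrite neq_lt; lra.
Qed.

(** The displacements are strict inequalities at [x], so they persist on a small arc. Its two end
    parts, [[k0, k1]] and [[k2, k3]], are to hold different supports of the spread element. *)
Lemma displaced_arc B x : x < B x < x + 32 ->
  (forall y, B (B y) = y + 32) \/ (forall m : int, B (B x) <> x + 32 * m%:~R) ->
  exists k0 k1 k2 k3, [/\ [/\ dyadic k0, dyadic k1, dyadic k2 & dyadic k3],
    [/\ k0 < k1, k1 < k2 & k2 < k3],
    [/\ k3 < B k0, B k3 < k0 + 32 & forall t, k0 <= t <= k3 -> ~ in_arc k0 k3 (B t)] &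
    (forall y, B (B y) = y + 32) \/ (forall t, k0 <= t <= k3 -> ~ in_arc k0 k3 (B (B t)))].
Proof.
move=> /andP[xB Bx] cases.
have [L1 [U1 [L1x xU1 s1]]] := @separate_above B x 0 ltac:(lra).
have [L2 [U2 [L2x xU2 s2]]] := @separate_below B x 32 Bx.
have [L3 [U3 [L3x xU3 s3]]] : exists L U, [/\ L < x, x < U &
    (forall y, B (B y) = y + 32) \/ forall k0 k3, L < k0 -> k0 < k3 -> k3 < U -> forall t, k0 <= t <= k3 -> ~ in_arc k0 k3 (B (B t))].
  case: cases => [ o2|hB]; first by exists (x - 1), (x + 1); split; [lra|lra|left].
  have [m /andP[m1 m2]] := strict_period_reduce hB.
  have [L [U [Lx xU sa]]] := @separate_above (B * B)%g x (32 * m%:~R) m1.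
  have [L' [U' [L'x xU' sb]]] := @separate_below (B * B)%g x (32 * m%:~R + 32) ltac:(rewrite plM; lra).
  exists (Num.max L L'), (Num.min U U'); rewrite gt_max lt_min Lx xU L'x xU'.
  split=> //; right=> k0 k3; rewrite gt_max lt_min => /andP[h1 h2] h03 /andP[h3 h4] t ht.
  have a1 := sa _ _ h1 h3; have a2 := sb _ _ h2 h4; rewrite !plM in a1 a2.
  have b1 : B (B k0) <= B (B t) by rewrite !pl_le; lra.
  have b2 : B (B t) <= B (B k3) by rewrite !pl_le; lra.
  move=> h; have := @in_arc_shift R k0 k3 (B (B t)) (- m) => -[_ /(_ h)].
  move: h => _ h; apply: (in_arc_disj _ _ h (in_arc0 (u := B (B t) + 32 * (- m)%:~R) (v := B (B t) + 32 * (- m)%:~R) _));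
    rewrite ?lexx // rmorphN /=; lra.
have [k0 [d0 l0 u0]] := @dyadic_dense R (Num.max L1 (Num.max L2 L3)) x ltac:(by rewrite !gt_max L1x L2x L3x).
have [k3 [d3 l3 u3]] := @dyadic_dense R x (Num.min U1 (Num.min U2 U3)) ltac:(by rewrite !lt_min xU1 xU2 xU3).
move: l0 u3; rewrite !gt_max !lt_min => /and3P[l1 l2 l3'] /and3P[u1 u2 u3].
have a1 : k3 < B k0 by have := s1 _ _ l1 u1; rewrite addr0.
have a2 := s2 _ _ l2 u2.
have dm : dyadic ((k0 + k3) / 2) by dy.
exists k0, ((k0 + (k0 + k3) / 2) / 2), ((k0 + k3) / 2), k3; split.
- by split=> //; dy.
- by split; lra.
- split=> // t ht h.
  have b1 : B k0 <= B t by rewrite pl_le; lra.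
  have b2 : B t <= B k3 by rewrite pl_le; lra.
  by apply: (in_arc_disj _ _ h (in_arc0 (u := B t) (v := B t) _)); lra.
- case: s3 => [ o2|h]; [by left|right; apply: h => //; lra].
Qed.

(** Monotonicity fixes the number of turns: [B (B x)] lies strictly between [x] and [x + 64], and
    over the period above [x] the value is squeezed between those at the ends. *)
Lemma rotation_square B x : x < B x < x + 32 ->
  (forall y, exists m : int, B (B y) = y + 32 * m%:~R) -> forall y, B (B y) = y + 32.
Proof.
move=> /andP[xB Bx] hB.
have Bx1 : B (B x) = x + 32.
  have [m hm] := hB x.
  have h1 : B x < B (B x) by rewrite pl_lt.
  have h2 : B (B x) < B x + 32 by rewrite -pl_per pl_lt.
  have : 0 < (m%:~R : R) < 2 by lra.
  rewrite ltr0z (_ : 2 = 2%:~R) // ltr_int => hm'.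
  have m1 : m = 1 by lia.
  by rewrite hm m1 mulr1.
have key y : x < y < x + 32 -> B (B y) = y + 32.
  move=> hy; have [m hm] := hB y.
  have h1 : B (B x) < B (B y) by rewrite !pl_lt; lra.
  have h2 : B (B y) < B (B x) + 32 by rewrite -!pl_per !pl_lt; lra.
  have : 0 < (m%:~R : R) < 2 by lra.
  rewrite ltr0z (_ : 2 = 2%:~R) // ltr_int => hm'.
  have m1 : m = 1 by lia.
  by rewrite hm m1 mulr1.
move=> y; have [m hm] := period_reduce x y.
apply: (addIr (32 * m%:~R)); rewrite -!pl_perz addrAC.
have [->//|ne] := eqVneq (y + 32 * m%:~R) x.
have h : x < y + 32 * m%:~R by rewrite lt_neqAle eq_sym ne; case/andP: hm.
by apply: key; lra.
Qed.

(** An interpolating [g] puts the arcs in place. A further conjugation by [h], supported on the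
    target [[-1, 4]], leaves the source [[-21/2, -3/2]] alone, so there it amounts to composition
    with [h] and can turn the map into [k]. *)
Lemma normal_position B (k : pl R) (k0 k1 k2 k3 : R) : dyadic k0 -> dyadic k1 -> dyadic k2 -> dyadic k3 ->
  k0 < k1 -> k1 < k2 -> k2 < k3 -> k3 < B k0 -> B k3 < k0 + 32 ->
  k (- (21 / 2)) = -1 -> k (- (3 / 2)) = 4 ->
  exists g, [/\ forall x, - (21 / 2) <= x <= - (3 / 2) -> (B ^ g)%g x = k x,
    g k2 = - (21 / 2) /\ g k3 = - (3 / 2), g (B k2) = -1 /\ g (B k3) = 4 &
    g (k0 + 32) = 7 /\ g (k1 + 32) = 20].
Proof.
move=> d0 d1 d2 d3 k01 k12 k23 k3B Bk0 kl kr.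
have b02 : B k0 < B k2 by rewrite pl_lt; lra.
have b23 : B k2 < B k3 by rewrite pl_lt; lra.
have [||g [g1 [_ [g2 [_ [g3 [_ [g4 [_ [g5 [_ [g6 _]]]]]]]]]]]] :=
  @interpolation R k2 (- (21 / 2)) (k3, - (3 / 2)) [:: (B k2, -1); (B k3, 4); (k0 + 32, 7); (k1 + 32, 20); (k2 + 32, 43 / 2)].
- by check_nodes.
- by congr (_, _); lra.
rewrite /= in g2 g3 g4 g5 g6; clear d0 d1 d2 d3 k01 k12 k23 k3B Bk0 b02 b23.
set al := (B ^ g)%g.
have al1 : al (- (21 / 2)) = -1 by rewrite -g1 plJ g3.
have al2 : al (- (3 / 2)) = 4 by rewrite -g2 plJ g4.
have [||||||h [sh hE]] := @pl_restrict R (al^-1 * k)%g (-1) 4.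
- by dy.
- by dy.
- lra.
- lra.
- by rewrite plM -al1 plVK kl al1.
- by rewrite plM -al2 plVK kr al2.
have hout x : - 28 <= x <= -1 -> h x = x.
  by move=> hx; apply: (supported_out (m := 1) sh); rewrite mulr1; lra.
have hout' x : 4 <= x <= 31 -> h x = x by move=> hx; apply: sh; lra.
exists (g * h)%g; split=> [x hx|||].
- rewrite conjgM -/al -{1}(hout x) ?plJ ?hE ?plM ?plVK //; last lra.
  by rewrite -al1 -al2 !pl_le.
- by rewrite !plM g1 g2 !hout; lra.
- by rewrite !plM g3 g4 hout ?hout'; lra.
- by rewrite !plM g5 g6 !hout'; lra.
Qed.

End Choice.

(** * The generation theorem for lifts *)

Section Spread.
Variable R : realType.
Implicit Types (f g h p q A B : pl R) (x y u s t c : R).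

Lemma in_arc_sub u t u' t' y : in_arc u t y -> u' <= u -> t <= t' -> in_arc u' t' y.
Proof. by move=> [m hm] h1 h2; exists m; lra. Qed.

Lemma bump_exists : exists a : pl R, bump_at 0 a.
Proof.
have [||a /= [a0 [e1 [_ [e2 [_ [e3 [a2 [e4 _]]]]]]]]] :=
  @interpolation R 0 0 (1 / 2, 1) [:: (1, 3 / 2); (2, 2); (32, 32)].
- by check_nodes.
- by congr (_, _); lra.
exists a; split=> x hx.
- by rewrite (e4 0) ?expr0z; [ring|ring|lra].
- by rewrite (e1 1) ?expr1z; [ring|lra|lra].
- by rewrite (e2 0) ?expr0z; [field|field|lra].
- by rewrite (e3 (-1)) ?exprN1; [field|field|lra].
Qed.

Lemma spread_exists : exists z : pl R,
  (forall x, -9 <= x <= -4 -> z x = step (x + 8)) /\ (forall x, -4 <= x <= 23 -> z x = x + 8).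
Proof.
have [||z /= [_ [e1 [_ [e2 [_ [e3 [_ [e4 _]]]]]]]]] :=
  @interpolation R (-9) (-1) (-8, 1) [:: (-6, 3); (-4, 4); (23, 31)].
- by check_nodes.
- by congr (_, _); lra.
exists z; split=> x hx; last by rewrite (e4 0) ?expr0z; [ring|ring|lra].
rewrite /step; case: ifP => h1; last case: ifP => h2.
- by rewrite (e1 1) ?expr1z; [ring|lra|lra].
- by rewrite (e2 0) ?expr0z; [field|field|lra].
- by rewrite (e3 (-1)) ?exprN1; [field|field|lra].
Qed.

(** Once [k] is [x + 9] on [[-9, -8]], the relation with [step] and [a] behind [v_arc2] determines
    it up to -4; the outer pieces extend it to an arc that maps onto [[-1, 4]]. *)
Definition template (k : pl R) := [/\
  [/\ forall x, - (21 / 2) <= x <= -10 -> k x = x + 19 / 2,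
      forall x, -9 <= x <= -8 -> k x = x + 9,
      forall x, -8 <= x <= -7 -> k x = x / 2 + 5 &
      forall x, -7 <= x <= -6 -> k x = x / 4 + 13 / 4],
  [/\ forall x, -6 <= x <= -4 -> k x = x / 8 + 5 / 2,
      forall x, -4 <= x <= -2 -> k x = x / 2 + 4 &
      forall x, -2 <= x <= - (3 / 2) -> k x = 2 * x + 7],
  k (- (21 / 2)) = -1 & k (- (3 / 2)) = 4].

Lemma template_exists : exists k : pl R, template k.
Proof.
have [||k /= [k1 [e1 [_ [_ [_ [e3 [_ [e4 [_ [e5 [_ [e6 [_ [e7 [_ [e8 [k2 _]]]]]]]]]]]]]]]]]] :=
  @interpolation R (- (21 / 2)) (-1) (-10, - (1 / 2))
    [:: (-9, 0); (-8, 1); (-7, 3 / 2); (-6, 7 / 4); (-4, 2); (-2, 3); (- (3 / 2), 4); (43 / 2, 31)].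
- by check_nodes.
- by congr (_, _); lra.
have p2 : (2 : R) ^ (-2) = 1 / 4 by rewrite -invr_expz -exprnP !exprS expr0; field.
have p3 : (2 : R) ^ (-3) = 1 / 8 by rewrite -invr_expz -exprnP !exprS expr0; field.
exists k; split=> //; split=> x hx.
- by rewrite (e1 0) ?expr0z; first [exact: hx | field].
- by rewrite (e3 0) ?expr0z; first [exact: hx | field].
- by rewrite (e4 (-1)) ?exprN1; first [exact: hx | field].
- by have := e5 (-2); rewrite p2 => ->; first [exact: hx | field].
- by have := e6 (-3); rewrite p3 => ->; first [exact: hx | field].
- by rewrite (e7 (-1)) ?exprN1; first [exact: hx | field].
- by rewrite (e8 1) ?expr1z; first [exact: hx | field].
Qed.

Lemma config_of_template (tau z a al k : pl R) :
  (forall x, tau x = x + 32) ->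
  (forall x, -9 <= x <= -4 -> z x = step (x + 8)) -> (forall x, -4 <= x <= 23 -> z x = x + 8) ->
  bump_at 0 a -> template k ->
  (forall x, - (21 / 2) <= x <= - (3 / 2) -> al x = k x) ->
  (forall x, 7 <= x <= 20 -> ~ in_arcs (al x)) -> config tau z a al.
Proof.
move=> tauE z1 z2 ba [[k1 k2 k3 k4] [k5 k6 k7] _ _] E alJ3; split=> // x hx; (rewrite E; last lra);
  [exact: k1|exact: k2|exact: k3|exact: k4|exact: k5|exact: k6|exact: k7].
Qed.

(** Pulled back by [g], the supporting arcs lie in [[k0, k3]] or are [[B k2, B k3]], so everything
    follows from the displacement of [[k0, k3]] and the injectivity of [B]. *)
Lemma displaced_arcs B g (k0 k1 k2 k3 : R) : k0 < k1 -> k1 < k2 -> k2 < k3 -> k3 < B k0 -> B k3 < k0 + 32 ->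
  (forall t, k0 <= t <= k3 -> ~ in_arc k0 k3 (B t)) ->
  (forall y, B (B y) = y + 32) \/ (forall t, k0 <= t <= k3 -> ~ in_arc k0 k3 (B (B t))) ->
  g k2 = - (21 / 2) /\ g k3 = - (3 / 2) -> g (B k2) = -1 /\ g (B k3) = 4 ->
  g (k0 + 32) = 7 /\ g (k1 + 32) = 20 ->
  (forall y, 7 <= y <= 20 -> ~ in_arcs ((B ^ g)%g y)) /\
  ((forall y, -1 <= y <= 4 -> ~ in_arcs ((B ^ g)%g y)) \/ order2 (B ^ g)%g).
Proof.
move=> k01 k12 k23 k3B Bk0 D1 D2 [g1 g2] [g3 g4] [g5 g6].
have arcs u : in_arcs (g u) -> in_arc k0 k3 u \/ in_arc (B k2) (B k3) u.
  case.
  - rewrite -g1 -g2 => /(in_arc_map g k2 k3 u).2 hu; left.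
    by apply: (in_arc_sub hu) => //; exact: ltW (lt_trans k01 k12).
  - by rewrite -g3 -g4 => /(in_arc_map g (B k2) (B k3) u).2 hu; right.
  - rewrite -g5 -g6 => /(in_arc_map g (k0 + 32) (k1 + 32) u).2 /(in_arc_per k0 k1 u).1 hu.
    by left; apply: (in_arc_sub hu) => //; exact: ltW (lt_trans k12 k23).
have alE u : (B ^ g)%g (g u) = g (B u) by rewrite plJ.
split=> [y hy|].
  have [t [-> ht]] : exists t, y = g (t + 32) /\ k0 <= t <= k1.
    exists (g^-1%g y - 32); rewrite subrK plKV; split=> //.
    by rewrite lerBrDr lerBlDr pl_Vle pl_leV g5 g6.
  rewrite alE => /arcs; rewrite pl_per => hh.
  have e1 u t' : in_arc u t' (B t + 32) -> in_arc u t' (B t).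
    by move=> [n hn]; exists (n + 1); rewrite rmorphD /=; lra.
  clear g1 g2 g3 g4 g5 g6.
  have bt : B k0 <= B t by rewrite pl_le; lra.
  have bt' : B t < B k2 by rewrite pl_lt; lra.
  have b23 : B k2 < B k3 by rewrite pl_lt.
  case: hh => /e1; first by apply: D1; lra.
  by move=> hh; apply: (in_arc_disj _ _ (in_arc0 (u := B t) (v := B t) _) hh); lra.
case: D2 => [ o2|D2]; [right|left].
  move=> y; have [u ->] : exists u, y = g u by exists (g^-1%g y); rewrite plKV.
  by rewrite !alE o2 pl_per.
move=> y hy; have [t [-> ht]] : exists t, y = g (B t) /\ k2 <= t <= k3.
  exists (B^-1%g (g^-1%g y)); rewrite !plKV; split=> //.
  by rewrite !pl_Vle !pl_leV g3 g4.
clear g1 g2 g3 g4 g5 g6.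
rewrite alE => /arcs[]; first by apply: D2; lra.
move/(in_arc_map B k2 k3 (B t)).2 => hh; apply: (D1 t); first lra.
by apply: (in_arc_sub hh); lra.
Qed.

Theorem pl_spread : exists z : pl R, forall A, (exists x, forall m : int, A x <> x + 32 * m%:~R) ->
  exists g : pl R, forall H : set (pl R), subgroup H ->
    (forall t : pl R, (forall x, t x = x + 32) -> H t) -> H A -> H (z ^ g)%g -> forall k : pl R, H k.
Proof.
have [a ba] := bump_exists; have [z [z1 z2]] := spread_exists.
have [k tk] := template_exists; have [_ _ kl kr] := tk.
have [tau tauE] := pl_shift_exists (dyadic_nat R 32).
have [sh shE] := pl_shift_exists (dyadic_nat R 1).
exists z => A [x0 hx0].
(* If some point is moved by the square of [A], such a point is taken; [A] itself then moves it as
   well. *)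
have [x [hA cases]] : exists x, (forall m : int, A x <> x + 32 * m%:~R) /\
    ((forall y, exists m : int, A (A y) = y + 32 * m%:~R) \/
     (forall m : int, A (A x) <> x + 32 * m%:~R)).
  have [ o2|no2] := pselect (forall y, exists m : int, A (A y) = y + 32 * m%:~R).
    by exists x0; split=> //; left.
  have [x hx] : exists x, forall m : int, A (A x) <> x + 32 * m%:~R.
    apply: contrapT => h; apply: no2 => y; apply: contrapT => h'; apply: h; exists y => m e.
    by apply: h'; exists m.
  exists x; split; last by right.
  by move=> m e; apply: (hx (m + m)); rewrite e pl_perz e rmorphD mulrDr addrA.
have [m hm] := strict_period_reduce hA.
have [c cE] := @pl_shift_exists R (- (32 * m%:~R)) ltac:(by apply/dyadicN/dyadicM; [exact: (dyadic_nat R 32)|exact: dyadic_int]).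
pose B := (A * c)%g.
have BE y : B y = A y - 32 * m%:~R by rewrite plM cE.
have hB : x < B x < x + 32 by rewrite BE; lra.
have BBE y : B (B y) = A (A y) - 64 * m%:~R.
  rewrite !BE; have := pl_perz A (- m) (A y); rewrite rmorphN /= mulrN => ->; ring.
have casesB : (forall y, B (B y) = y + 32) \/ (forall n : int, B (B x) <> x + 32 * n%:~R).
  case: cases => [ o2|hAA]; [left|right].
    apply: (rotation_square hB) => y; have [n hn] := o2 y.
    by exists (n - m - m); rewrite BBE hn !rmorphB /=; ring.
  move=> n; rewrite BBE => e; apply: (hAA (n + m + m)).
  by rewrite -[LHS](subrK (64 * m%:~R)) e !rmorphD /=; ring.
have [y0 [y1 [y2 [y3 [[d0 d1 d2 d3] [y01 y12 y23] [y3B By0 D1] D2]]]]] := displaced_arc hB casesB.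
have [gam [hE ga1 ga2 ga3]] := normal_position d0 d1 d2 d3 y01 y12 y23 y3B By0 kl kr.
have [alJ3 al_cases] := displaced_arcs y01 y12 y23 y3B By0 D1 D2 ga1 ga2 ga3.
have C := config_of_template tauE z1 z2 ba tk hE alJ3.
exists gam^-1%g => H sH Htau HA Hz f; have [H1 HM HV] := sH.
(* The conjugate of [H] by [gam]: it contains [z] itself and the normalised [B ^ gam]. *)
pose G := [set q | H (q ^ gam^-1)%g].
have sG : subgroup G.
  split=> [|p q Gp Gq|p Gp]; rewrite /G /=; first by rewrite conj1g.
    by rewrite conjMg; exact: HM.
  by rewrite conjVg; exact: HV.
have tauJ (q : pl R) : (tau ^ q)%g = tau.
  apply: pl_ext => y; have [u ->] : exists u, y = q u by exists (q^-1%g y); rewrite plKV.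
  by rewrite plJ !tauE pl_per.
have Gtau : G tau by rewrite /G /= tauJ; exact: Htau.
have Gal : G (B ^ gam)%g.
  rewrite /G /= conjgK; apply: (HM) => //.
  have {}Htau (n : nat) : forall t : pl R, (forall y, t y = y + 32 * n%:R) -> H t.
    elim: n => [|n IH] t tE.
      have -> : t = 1%g by apply: pl_ext => y; rewrite tE mulr0 addr0.
      exact: H1.
    have -> : t = (t * tau^-1 * tau)%g by rewrite mulgVK.
    apply: (HM); last exact: Htau.
    apply: IH => y; rewrite plM tE; apply: (@pl_inj _ tau); rewrite plKV tauE -(natr1 n); ring.
  case: m cE {hm BE BBE B hB casesB D1 D2 y3B By0 alJ3 al_cases C Gtau hE ga2} => n cE.
    rewrite -[c]invgK; apply: (HV); apply: (Htau n) => y.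
    by apply: (@pl_inj _ c); rewrite plKV cE -pmulrn; ring.
  by apply: (Htau n.+1) => y; rewrite cE NegzE rmorphN /=; ring.
have -> : f = ((f ^ gam) ^ gam^-1)%g by rewrite conjgK.
exact: (config_generates C al_cases shE sG Gtau Hz Gal).
Qed.

End Spread.

(** * From lifts to the circle *)

Section CircleLift.
Variable R : realType.
Implicit Types (g h : pl R) (x y t a : R).
Local Open Scope quotient_scope.

(* The point of R / Z with line coordinate x, in units where the period is 32. *)
Definition cp x : circle R := circle_pi (x / 32).

Lemma circle_pi_eq x y : circle_pi x = circle_pi y <-> exists m : int, x = y + m%:~R.
Proof.
have E : (x - y \in integers R) = (\pi_(Quotient.quot (integers R)) x == \pi_(Quotient.quot (integers R)) y).
  exact: Quotient.idealrBE.
split=> [e|[m xE]].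
  have : \pi_(Quotient.quot (integers R)) x == \pi_(Quotient.quot (integers R)) y by apply/eqP.
  rewrite -E => h; have [m e'] : exists m : int, x - y = m%:~R by exact/intrP.
  by exists m; rewrite -e' addrC subrK.
suff /eqP : \pi_(Quotient.quot (integers R)) x == \pi_(Quotient.quot (integers R)) y by [].
rewrite -E xE addrC addKr; exact: intr_int.
Qed.

Lemma circle_piD x y : circle_pi (x + y) = circle_pi x + circle_pi y.
Proof. exact: (@Quotient.pi_add _ (integers R) x y). Qed.

Lemma circle_pi_surj (p : circle R) : exists x, p = circle_pi x.
Proof. by exists (repr p); rewrite /circle_pi reprK. Qed.

Lemma cp_eq x y : cp x = cp y <-> exists m : int, x = y + 32 * m%:~R.
Proof.
rewrite /cp circle_pi_eq; split=> -[m e]; exists m; lra.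
Qed.

Lemma cpD x t : cp (x + t) = cp x + circle_pi (t / 32).
Proof. by rewrite /cp mulrDl circle_piD. Qed.

Lemma cp_surj (p : circle R) : exists x, p = cp x.
Proof.
have [x ->] := circle_pi_surj p; exists (32 * x); rewrite /cp; congr circle_pi; lra.
Qed.

Lemma cp_continuous : continuous cp.
Proof.
move=> x; apply: (@continuous_comp _ _ _ (fun x : R => x / 32) (@circle_pi R)).
  exact: mulrr_continuous.
exact: pi_continuous.
Qed.

(** An arbitrary, discontinuous choice of lift; periodic maps do not see it. *)
Definition cp_lift (p : circle R) : R := 32 * repr p.

Lemma cp_liftK p : cp (cp_lift p) = p.
Proof.
rewrite /cp /cp_lift (_ : 32 * repr p / 32 = repr p); last by lra.
by rewrite /circle_pi reprK.
Qed.

Lemma cp_liftE x : exists m : int, cp_lift (cp x) = x + 32 * m%:~R.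
Proof. by apply/cp_eq; rewrite cp_liftK. Qed.

Lemma pl_continuous g : continuous g.
Proof.
move=> x; apply/cvgrPdist_lt => eps eps0.
have hL : g^-1%g (g x - eps) < x by rewrite pl_lV; lra.
have hU : x < g^-1%g (g x + eps) by rewrite pl_Vl; lra.
have [L LE] : exists L, L = g^-1%g (g x - eps) by exists (g^-1%g (g x - eps)).
have [U UE] : exists U, U = g^-1%g (g x + eps) by exists (g^-1%g (g x + eps)).
rewrite -LE -UE in hL hU.
apply/nbhs_ballP; exists (Num.min (x - L) (U - x)).
  by rewrite /= lt_min !subr_gt0 hL hU.
move=> y /=; rewrite lt_min !ltr_norml => /andP[/andP[h1 h2] /andP[h3 h4]].
have Ly : L < y by lra.
have yU : y < U by lra.
by move: Ly yU; rewrite LE UE pl_lV pl_Vl; lra.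
Qed.

Definition circle_fun g (p : circle R) : circle R := cp (g (cp_lift p)).

Lemma circle_funE g x : circle_fun g (cp x) = cp (g x).
Proof.
rewrite /circle_fun; have [m ->] := cp_liftE x.
by apply/cp_eq; exists m; rewrite pl_perz.
Qed.

Lemma circle_fun_continuous g : continuous (circle_fun g).
Proof.
have h : continuous (fun x : R => cp (g (32 * x))).
  move=> x; apply: (@continuous_comp _ _ _ (fun x : R => 32 * x) (cp \o g)).
    exact: mulrl_continuous.
  by apply: continuous_comp; [exact: pl_continuous|exact: cp_continuous].
apply: (repr_comp_continuous h) => x y /eqP e; apply/eqP.
have [m ->] : exists m : int, x = y + m%:~R by exact/circle_pi_eq.
by apply/cp_eq; exists m; rewrite mulrDr pl_perz.
Qed.

Definition circle_homeo g : homeo (circle R).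
Proof.
apply: (@Homeo _ (circle_fun g) (circle_fun g^-1%g)).
- by move=> p; have [x ->] := cp_surj p; rewrite !circle_funE plVK.
- by move=> p; have [x ->] := cp_surj p; rewrite !circle_funE plKV.
- exact: circle_fun_continuous.
- exact: circle_fun_continuous.
Defined.

Lemma circle_homeoE g x : circle_homeo g (cp x) = cp (g x).
Proof. exact: circle_funE. Qed.

Lemma circle_homeo_eq (f : homeo (circle R)) g :
  (forall x, f (cp x) = cp (g x)) -> f = circle_homeo g.
Proof.
by move=> h; apply: homeo_ext => p; have [x ->] := cp_surj p; rewrite h circle_homeoE.
Qed.

Lemma circle_homeoM g h : circle_homeo (g * h)%g = (circle_homeo g * circle_homeo h)%g.
Proof.
apply/esym/circle_homeo_eq => x.
by rewrite -[LHS]/(circle_homeo h (circle_homeo g (cp x))) !circle_homeoE.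
Qed.

Lemma circle_homeo1 g : (forall x, exists m : int, g x = x + 32 * m%:~R) -> circle_homeo g = 1%g.
Proof. by move=> h; apply/esym/circle_homeo_eq => x; apply/cp_eq; have [m ->] := h x; exists (- m); rewrite rmorphN /=; lra. Qed.

Lemma circle_homeoV g : circle_homeo g^-1%g = (circle_homeo g)^-1%g.
Proof.
apply/esym; rewrite -[LHS]mulg1 -(@circle_homeo1 1%g); last by exists 0; rewrite mulr0 addr0.
by rewrite -(mulgV g) circle_homeoM mulKg.
Qed.

Lemma circle_homeoJ g h : circle_homeo (g ^ h)%g = (circle_homeo g ^ circle_homeo h)%g.
Proof. by rewrite !conjgE !circle_homeoM circle_homeoV. Qed.

Lemma dyadic_pointsE x : dyadic_points (cp x) <-> dyadic x.
Proof.
have d32 : dyadic (32 : R) := dyadic_nat R 32.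
split=> [[m _ [n _ e]]|dx].
  have [k xE] : exists k : int, m%:~R / 2 ^+ n = x / 32 + k%:~R :> R by exact/circle_pi_eq.
  have -> : x = 32 * (m%:~R / 2 ^+ n) - 32 * k%:~R by lra.
  apply: dyadicB; apply: dyadicM => //; [exact: dyadic_div2n|exact: dyadic_int].
have [m [n e]] : dyadic (x / 32).
  by apply: dyadicM => //; exact: (@dyadicV R 32 5).
by exists m => //; exists n => //; rewrite /cp e.
Qed.

Lemma has_gradientE (f : circle R -> circle R) x a : has_gradient f (cp x) a <->
  exists2 e, 0 < e & forall t, `|t| <= e -> f (cp (x + t)) = f (cp x) + circle_pi (a * t / 32).
Proof.
rewrite /has_gradient; split=> [/nbhs_ballP[e /= e0 he]|[e e0 he]].
  exists (16 * e); first by lra.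
  move=> t ht; rewrite cpD he ?mulrA //.
  suff : `|0 - t / 32| < e by [].
  by rewrite sub0r normrN normrM [`|32^-1|]ger0_norm; lra.
apply/nbhs_ballP; exists (e / 32); first by rewrite /=; lra.
move=> t ht; have {}ht : `|0 - t| < e / 32 by exact: ht.
rewrite sub0r normrN in ht.
have := he (32 * t); rewrite cpD.
have -> : 32 * t / 32 = t by lra.
have -> : a * (32 * t) / 32 = a * t by lra.
by apply; rewrite normrM [`|32|]ger0_norm; lra.
Qed.

Lemma circle_homeo_thompson g : thompsonT R (circle_homeo g).
Proof.
have d0 : dyadic (0 : R) := dyadic_nat R 0; have d32 : dyadic (32 : R) := dyadic_nat R 32.
have d64 : dyadic (64 : R) := dyadic_nat R 64.
have dyim h p : dyadic_points p -> dyadic_points (circle_fun h p).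
  have [x ->] := cp_surj p; rewrite circle_funE !dyadic_pointsE; exact: pl_dyadic.
have [s [ds hs]] := PL_germ_two_sided (plP g d0 d64 ltac:(lra)).
have brk : breakpoints (circle_homeo g) `<=` cp @` [set` s].
  move=> p hp; have [x0 pE] := cp_surj p; have [m hm] := period_reduce 16 x0.
  have {}pE : p = cp (x0 + 32 * m%:~R).
    by rewrite pE; apply/cp_eq; exists (- m); rewrite rmorphN /=; lra.
  move: (x0 + _) hm pE => x hx pE; exists x => //=.
  apply: contrapT => /negP xs; apply: hp; have [k [e e0 he]] := hs x ltac:(lra) xs.
  exists (2 ^ k); rewrite pE; apply/has_gradientE; exists e => // t ht.
  by rewrite !circle_homeoE he // cpD.
split.
- apply/seteqP; split=> [_ [p hp <-]|p hp]; first exact: dyim.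
  by exists (homeo_inv (circle_homeo g) p); [exact: dyim|exact: homeo_invK].
- apply: (sub_finite_set brk); exact/finite_image/finite_seq.
- move=> p a; have [x0 pE] := cp_surj p; have [m hm] := period_reduce 16 x0.
  have {pE}-> : p = cp (x0 + 32 * m%:~R).
    by rewrite pE; apply/cp_eq; exists (- m); rewrite rmorphN /=; lra.
  move: (x0 + _) hm => x hx /has_gradientE[e e0 he].
  have [k [e' e'0 he']] := PL_germ_right (plP g d0 d64 ltac:(lra)) (x := x) ltac:(lra).
  exists k; apply: contrapT => ak.
  pose d := a - 2 ^ k; have d0' : d != 0 by rewrite subr_eq0; apply/eqP.
  (* So small that [a * t] and [2 ^ k * t], which agree modulo 32, differ by at most 1 and hence are
     equal. *)
  pose t := Num.min (Num.min e e') (1 / `|d|).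
  have dn : 0 < `|d| by rewrite normr_gt0.
  have t0 : 0 < t by rewrite /t !lt_min e0 e'0 divr_gt0.
  have [te te' td] : [/\ t <= e, t <= e' & `|d| * t <= 1].
    split; rewrite /t ?ge_min ?lexx ?orbT //.
    have : Num.min (Num.min e e') (1 / `|d|) <= 1 / `|d| by rewrite ge_min lexx orbT.
    by rewrite ler_pdivlMr // mulrC.
  have := he t ltac:(by rewrite ger0_norm // ltW).
  rewrite !circle_homeoE he' ?te' ?ltW // cpD => /addrI /circle_pi_eq [n hn].
  have e1 : - (d * t) = 32 * n%:~R by rewrite /d; lra.
  have : `|d * t| <= 1 by rewrite normrM (ger0_norm (ltW t0)).
  rewrite -normrN e1 ler_norml => hn'.
  have n0 : n = 0 by apply: (@int_between R); lra.
  have /eqP : d * t = 0 by move: e1; rewrite n0; lra.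
  by rewrite mulf_eq0 (negbTE d0') gt_eqF.
- move=> p /brk[x /= xs <-]; apply/dyadic_pointsE; exact: ds.
Qed.

End CircleLift.

(** * Every element of T has a lift *)

Section Lifting.
Variable R : realType.
Implicit Types (g h : pl R) (x y t u w b c : R).

Lemma real_induction (P : R -> Prop) u w :
  (forall b, u <= b < w -> (forall y, u <= y < b -> P y) ->
     exists2 e, 0 < e & forall y, b <= y < b + e -> P y) ->
  forall y, u <= y < w -> P y.
Proof.
move=> step y0 hy0; apply: contrapT => nP.
pose S := [set b | u <= b <= y0 /\ forall y, u <= y < b -> P y].
have Su : S u by split=> [|y]; lra.
have hS : has_sup S by split; [exists u|exists y0 => b [hb _]; lra].
have s1 : u <= sup S by apply: sup_upper_bound.
have s2 : sup S <= y0 by apply: ge_sup => [|b [hb _]]; [exists u|lra].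
have PS y : u <= y < sup S -> P y.
  move=> hy; have [b [_ hb] yb] := sup_adherent (eps := sup S - y) ltac:(lra) hS.
  by apply: hb; lra.
have [e e0 he] := step (sup S) ltac:(lra) PS.
have : S (Num.min y0 (sup S + e / 2)).
  split; first by rewrite le_min ge_min lexx /=; lra.
  move=> y; rewrite lt_min => hy; have [h|h] := ltP y (sup S); first by apply: PS; lra.
  by apply: he; lra.
move/(sup_upper_bound hS); rewrite ge_min => /orP[h|h]; last lra.
by apply: nP; apply: he; lra.
Qed.

Lemma cp_ball_open y0 d : 0 < d -> open [set p : circle R | exists2 y, `|y - y0| < d & p = cp y].
Proof.
move=> d0; rewrite /open /= /quotient_open.
rewrite openE => x [y hy e]; apply/nbhs_ballP.
have [m hm] : exists m : int, x = y / 32 + m%:~R by exact/circle_pi_eq.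
exists ((d - `|y - y0|) / 32) => /=; first by lra.
move=> x' hx'; have {}hx' : `|x - x'| < (d - `|y - y0|) / 32 by exact: hx'.
exists (32 * (x' - m%:~R)).
  have -> : 32 * (x' - m%:~R) - y0 = (y - y0) - 32 * (x - x') by rewrite hm; lra.
  apply: (le_lt_trans (ler_normB _ _)); rewrite normrM [`|32|]ger0_norm; lra.
by rewrite /= /cp; apply/circle_pi_eq; exists m; lra.
Qed.

(** The circle is Hausdorff: a representative of [h u] that is not [k u] modulo 32 is separated from
    it by a quarter of the gap. This extends an affine formula to endpoints that may be
    breakpoints. *)
Lemma cp_closed (h : R -> circle R) (k : R -> R) u :
  {for u, continuous h} -> {for u, continuous k} ->
  (forall e, 0 < e -> exists2 x, `|u - x| < e & h x = cp (k x)) -> h u = cp (k u).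
Proof.
move=> hc kc hk; have [y0 hy0] := cp_surj (h u); rewrite hy0; apply/cp_eq.
apply: contrapT => no.
have [m /andP[m1 m2]] : exists m : int, k u + 32 * m%:~R < y0 < k u + 32 * m%:~R + 32.
  by apply: strict_period_reduce => m e; apply: no; exists m.
pose d := Num.min (y0 - (k u + 32 * m%:~R)) (k u + 32 * m%:~R + 32 - y0) / 4.
have d0 : 0 < d by rewrite /d divr_gt0 // lt_min; apply/andP; split; lra.
have [d1 d2] : 4 * d <= y0 - (k u + 32 * m%:~R) /\ 4 * d <= k u + 32 * m%:~R + 32 - y0.
  by rewrite /d mulrC divfK // !ge_min !lexx orbT.
have n1 : nbhs u (h @^-1` [set p | exists2 y, `|y - y0| < d & p = cp y]).
  apply: hc; apply: open_nbhs_nbhs; split; first exact: cp_ball_open.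
  by exists y0 => //; rewrite subrr normr0.
have n2 : nbhs u (k @^-1` ball (k u) d) by apply: kc; exact: nbhsx_ballx.
have /nbhs_ballP[e /= e0 he] : nbhs u ((h @^-1` [set p | exists2 y, `|y - y0| < d & p = cp y]) `&` (k @^-1` ball (k u) d)).
  by apply: filterI.
have [x xu hx] := hk e e0.
have [[y hy hxy] kx] := he x xu.
have {}kx : `|k u - k x| < d by exact: kx.
have [n hn] : exists n : int, k x = y + 32 * n%:~R by apply/cp_eq; rewrite -hx.
move: hy kx; rewrite !ltr_norml => hy kx.
by apply: (@int_open_unit R (- n - m)); rewrite rmorphB rmorphN /=; lra.
Qed.

Variable f : homeo (circle R).
Hypothesis Tf : thompsonT R f.

(** The difference is affine with values in the multiples of 32 on an interval, hence constant. *)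
Lemma affine_unique k c k' c' u w : u < w ->
  (forall x, u <= x < w -> cp (2 ^ k * x + c) = cp (2 ^ k' * x + c')) ->
  forall x, cp (2 ^ k * x + c) = cp (2 ^ k' * x + c').
Proof.
move=> uw h; pose a : R := 2 ^ k - 2 ^ k'; pose d := c - c'.
have hz x : u <= x < w -> exists m : int, a * x + d = 32 * m%:~R.
  by move=> /h/cp_eq[m e]; exists m; rewrite /a /d; lra.
have a0 : a = 0.
  apply: contrapT => /eqP an0.
  pose t := Num.min ((w - u) / 2) (1 / `|a|).
  have na : 0 < `|a| by rewrite normr_gt0.
  have t0 : 0 < t by rewrite lt_min divr_gt0 // ?subr_gt0 // divr_gt0.
  have t1 : t <= (w - u) / 2 by rewrite /t ge_min lexx.
  have t2 : `|a| * t <= 1.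
    have : t <= 1 / `|a| by rewrite /t ge_min lexx orbT.
    by rewrite ler_pdivlMr // mulrC.
  have [m1 e1] := hz u ltac:(lra); have [m2 e2] := hz (u + t) ltac:(lra).
  have e3 : a * t = 32 * (m2 - m1)%:~R by rewrite rmorphB /=; lra.
  have : `|a * t| <= 1 by rewrite normrM (ger0_norm (ltW t0)).
  rewrite ler_norml e3 => h1.
  have m12 : m2 - m1 = 0 by apply: (@int_between R); lra.
  have /eqP : a * t = 0 by rewrite e3 m12 mulr0.
  by rewrite mulf_eq0 (negbTE an0) gt_eqF.
have [m e] := hz u ltac:(lra).
move=> x; apply/cp_eq; exists m; have := e; rewrite a0 mul0r add0r => <-.
have -> : (2 : R) ^ k = 2 ^ k' by move: a0; rewrite /a; lra.
by rewrite /d; ring.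
Qed.

Lemma breakpoint_level : exists N, forall x, breakpoints f (cp x) -> exists d : int, x = gridpt R N d.
Proof.
have [_ /finite_seqP[s hs] _ sub] := Tf.
have : forall p, p \in s -> dyadic_points p.
  by move=> p ps; apply: sub; rewrite hs.
have [N hN] : exists N, forall p, p \in s -> dyadic_points p -> exists d : int, p = cp (gridpt R N d).
  elim: {hs} s => [|p s [N hN]]; first by exists 0%N.
  have [x pE] := cp_surj p.
  have [dp|np] := pselect (dyadic_points p); last first.
    by exists N => q; rewrite inE => /orP[/eqP->//|qs]; exact: hN.
  have [q0 hq] := dyadic_level ((dyadic_pointsE x).1 ltac:(by rewrite -pE)).
  exists (maxn q0 N) => q; rewrite inE => /orP[/eqP-> _|qs dq].
    by have [d xE] := hq (maxn q0 N) (leq_maxl _ _); exists d; rewrite pE xE.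
  have [d ->] := hN q qs dq.
  have dd : dyadic (gridpt R N d) by exact: dyadic_div2n.
  exists (d * 2 ^+ (maxn q0 N - N)); congr cp.
  have Nm : (N <= maxn q0 N)%N := leq_maxr _ _.
  rewrite /gridpt rmorphM rmorphXn /= -{2}(subnKC Nm) exprD.
  have := expn2_neq0 R N; have := expn2_neq0 R (maxn q0 N - N) => h1 h2; field; by rewrite h1 h2.
move=> ds; exists N => x hx.
have xs : cp x \in s by move: hx; rewrite hs.
have [d /cp_eq[m ->]] := hN _ xs (ds _ xs).
exists (d + 32 * m * 2 ^+ N).
have := expn2_neq0 R N => h1.
by rewrite /gridpt rmorphD !rmorphM rmorphXn /=; field.
Qed.

Lemma local_affine x : ~ breakpoints f (cp x) ->
  exists k c, exists2 e, 0 < e & forall y, `|y - x| <= e -> f (cp y) = cp (2 ^ k * y + c).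
Proof.
move=> nb; have [a ha] : exists a, has_gradient f (cp x) a by exact: contrapT.
have [_ _ grad _] := Tf; have [k aE] := grad _ _ ha.
have [e e0 he] := (has_gradientE _ _ _).1 ha.
have [y0 y0E] := cp_surj (f (cp x)).
exists k, (y0 - 2 ^ k * x), e => // y hy.
have := he (y - x) hy; rewrite addrC subrK => ->.
by rewrite y0E -cpD aE; congr cp; ring.
Qed.

(** Real induction carries a local formula to the right of any point; uniqueness identifies these
    formulas with the one found at the midpoint, and continuity adds the two ends. *)
Lemma interval_affine u w : u < w -> (forall x, u < x < w -> ~ breakpoints f (cp x)) ->
  exists k c, forall x, u <= x <= w -> f (cp x) = cp (2 ^ k * x + c).
Proof.
move=> uw nb.
have right x0 : u < x0 < w -> exists k c, forall x, x0 <= x < w -> f (cp x) = cp (2 ^ k * x + c).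
  move=> hx0; have [k [c [e e0 he]]] := local_affine (nb _ hx0); exists k, c.
  apply: real_induction => b hb Pb.
  have [bx|bx] := eqVneq b x0.
    exists e => // y hy; apply: he; rewrite ger0_norm; lra.
  have xb : x0 < b by rewrite lt_neqAle eq_sym bx; lra.
  have [k' [c' [e' e'0 he']]] := local_affine (nb b ltac:(lra)).
  exists e' => // y hy.
  rewrite he'; last by rewrite ger0_norm; lra.
  apply/esym; apply: (@affine_unique k c k' c' (Num.max x0 (b - e')) b).
    by rewrite gt_max xb; lra.
  move=> z; rewrite ge_max => /andP[/andP[z1 z2] z3].
  by rewrite -Pb ?z1 // he' // ler_norml; lra.
pose mid := (u + w) / 2; have hmid : u < mid < w by rewrite /mid; lra.
have [k [c hk]] := right mid hmid; exists k, c.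
have inner x : u < x < w -> f (cp x) = cp (2 ^ k * x + c).
  move=> hx; have [h|h] := leP mid x; first by apply: hk; lra.
  have [k' [c' hk']] := right x hx; rewrite hk'; last lra.
  apply: (@affine_unique k' c' k c mid w); first lra.
  by move=> y hy; rewrite -hk' ?hk //; lra.
have fc y : {for y, continuous (fun x : R => f (cp x))}.
  by apply: continuous_comp; [exact: cp_continuous|exact: homeo_fun_continuous].
have ac y : {for y, continuous (fun x : R => 2 ^ k * x + c)}.
  apply: continuousD; last exact: cst_continuous.
  exact: mulrl_continuous.
move=> x hx.
have [xu|xu] := eqVneq x u.
  apply: (@cp_closed (fun x => f (cp x)) (fun x => 2 ^ k * x + c) x) => // e e0.
  exists (u + Num.min (e / 2) ((w - u) / 2)).
    by rewrite xu opprD addrA subrr sub0r normrN ger0_norm ?le_min ?gt_min; lra.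
  have h1 : 0 < Num.min (e / 2) ((w - u) / 2) by rewrite lt_min; lra.
  have h2 : Num.min (e / 2) ((w - u) / 2) <= (w - u) / 2 by rewrite ge_min lexx orbT.
  by apply: inner; lra.
have [xw|xw] := eqVneq x w.
  apply: (@cp_closed (fun x => f (cp x)) (fun x => 2 ^ k * x + c) x) => // e e0.
  have h1 : 0 < Num.min (e / 2) ((w - u) / 2) by rewrite lt_min; lra.
  have h2 : Num.min (e / 2) ((w - u) / 2) <= (w - u) / 2 by rewrite ge_min lexx orbT.
  exists (w - Num.min (e / 2) ((w - u) / 2)).
    by rewrite xw opprB addrC subrK ger0_norm ?gt_min; lra.
  by apply: inner; lra.
apply: inner; rewrite !lt_neqAle eq_sym xu xw; lra.
Qed.

(** Over a grid containing all breakpoints [f] has affine lifts, whose constants are adjusted by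
    multiples of 32 so that they join up. Constants are dyadic because [f] preserves dyadic
    points. *)
Lemma lift_exists : exists g, f = circle_homeo g.
Proof.
have [N hN] := breakpoint_level; have n0 := expn2_neq0 R N; have p0 := expn2_gt0 R N.
have gd i : dyadic (gridpt R N i) by exact: dyadic_div2n.
have [im _ _ _] := Tf.
have piece (n : nat) : exists k c, dyadic c /\
    forall x, gridpt R N n <= x <= gridpt R N (n + 1) -> f (cp x) = cp (2 ^ k * x + c).
  have lt : gridpt R N n < gridpt R N (n + 1) by rewrite gridpt_lt; lia.
  have [||k [c hk]] := @interval_affine (gridpt R N n) (gridpt R N (n + 1)); first by [].
    by move=> x hx /hN[d xE]; move: hx; rewrite xE !gridpt_lt; lia.
  exists k, c; split=> //.
  have : dyadic_points (f (cp (gridpt R N n))).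
    rewrite -im; exists (cp (gridpt R N n)) => //; exact/dyadic_pointsE.
  rewrite hk; last by rewrite lexx ltW.
  move/dyadic_pointsE => dd.
  have -> : c = (2 ^ k * gridpt R N n + c) - 2 ^ k * gridpt R N n by ring.
  by apply: dyadicB => //; apply: dyadicM => //; exact: dyadic_pow2.
have glue (n : nat) : exists F : R -> R, PL F 0 (gridpt R N (n + 1)) /\
    forall x, 0 <= x <= gridpt R N (n + 1) -> f (cp x) = cp (F x).
  have g0 : gridpt R N 0 = 0 by rewrite /gridpt mul0r.
  elim: n => [|n [F [hF hf]]].
    have [k [c [dc hk]]] := piece 0%N; exists (fun x => 2 ^ k * x + c); split.
      apply: (PL_affine (k := k) (c := c)) => //; last exact: (dyadic_nat R 0).
      by rewrite -g0 gridpt_lt.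
    by move=> x hx; apply: hk; rewrite g0.
  have [k [c [dc hk]]] := piece n.+1.
  have e1 : (n + 1 : int) = n.+1 by lia.
  rewrite e1 in hF hf.
  have lt : gridpt R N n.+1 < gridpt R N (n.+1 + 1) by rewrite gridpt_lt; lia.
  have lt0 := PL_lt hF.
  have [m hm] : exists m : int, F (gridpt R N n.+1) = 2 ^ k * gridpt R N n.+1 + c + 32 * m%:~R.
    by apply/cp_eq; rewrite -hf ?hk //; lra.
  exists (fun x => if x <= gridpt R N n.+1 then F x else 2 ^ k * x + (c + 32 * m%:~R)); split.
    apply: PL_glue => //; last by rewrite hm; ring.
    apply: (PL_affine (k := k) (c := c + 32 * m%:~R)) => //.
    by apply: dyadicD => //; apply: dyadicM; [exact: (dyadic_nat R 32)|exact: dyadic_int].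
  move=> x hx; case: ifPn => h; first by apply: hf; lra.
  rewrite hk; last lra.
  by apply/cp_eq; exists (- m); rewrite rmorphN /=; ring.
have [n nE] : exists n : nat, gridpt R N (n + 1) = 32.
  exists (32 * 2 ^ N).-1.
  have -> : ((32 * 2 ^ N).-1 + 1 : int) = (32 * 2 ^ N)%N.
    by have : (0 < 32 * 2 ^ N)%N; [rewrite muln_gt0 expn_gt0|lia].
  by rewrite /gridpt -pmulrn natrM natrX; field.
have [F [hF hf]] := glue n; rewrite nE in hF hf.
have [g [gPL gF Fg]] := PL_inv_exists hF.
have F32 : F 32 = F 0 + 32.
  have [m hm] : exists m : int, F 32 = F 0 + 32 * m%:~R.
    have e32 : f (cp 32) = cp (F 32) by apply: hf; lra.
    have e0 : f (cp 0) = cp (F 0) by apply: hf; lra.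
    apply/cp_eq; rewrite -e32 -e0; congr (homeo_fun f _); apply/cp_eq; exists 1.
    by rewrite mulr1 add0r.
  have lt : F 0 < F 32 by apply: (PL_mono hF); lra.
  have m0 : 0 < m by rewrite -(ltr0z R); lra.
  have [m1e|m1] := eqVneq m 1; first by rewrite hm m1e mulr1.
  (* If [f] wound more than once, [F] would take the value [F 0 + 32] strictly between 0 and 32,
     against the injectivity of [f]. *)
  exfalso; have m2 : 2 <= m by lia.
  have m2' : 2 <= (m%:~R : R) by rewrite (_ : 2 = 2%:~R) // ler_int.
  have [hx Fx] := Fg (F 0 + 32) ltac:(lra).
  set x := g _ in hx Fx.
  have : cp x = cp 0.
    apply: (can_inj (homeo_funK f)); rewrite !hf ?Fx //; last lra.
    by apply/cp_eq; exists 1; rewrite mulr1.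
  move/cp_eq => [j]; rewrite add0r => xj.
  have x0 : x != 0 by apply/eqP => x0; move: Fx; rewrite x0; lra.
  have x32 : x != 32 by apply/eqP => x32; move: Fx; rewrite x32 hm; lra.
  have x0' : 0 < x by rewrite lt_neqAle eq_sym x0; lra.
  have x32' : x < 32 by rewrite lt_neqAle x32; lra.
  by apply: (@int_open_unit R j); lra.
have [k kE] := @pl_of_PL R 0 F ltac:(by rewrite add0r) ltac:(by rewrite add0r).
exists k; apply: circle_homeo_eq => x; have [m hm] := period_reduce 0 x.
have -> : cp x = cp (x + 32 * m%:~R) by apply/cp_eq; exists (- m); rewrite rmorphN /=; lra.
have -> : cp (k x) = cp (k (x + 32 * m%:~R)).
  by apply/cp_eq; exists (- m); rewrite pl_perz rmorphN /=; lra.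
rewrite kE ?hf //; lra.
Qed.

End Lifting.

(** * Transfer to the circle *)

Lemma group_closedE (G : groupType) (H : set G) : group_closed [in H] <-> subgroup H.
Proof.
split=> [hH|[H1 HM HV]].
  have HV := group_closedV hH; have HM := group_closedM hH; have [H1 _] := hH.
  split=> [|x y hx hy|x hx]; first by move: H1; rewrite inE.
    by have := HM x y (mem_set hx) (mem_set hy); rewrite inE.
  by have := HV x (mem_set hx); rewrite inE.
split=> [|x y]; rewrite !inE //= => hx hy; first by apply: HM => //; exact: HV.
Qed.

(** A subgroup of T is pulled back to the group of lifts; the preimage contains the full turn, which
    is trivial on the circle, so [pl_spread] applies to it. *)
Theorem theorem1 (R : realType) :
  exists zeta : homeo (circle R), thompsonT R zeta /\
    forall alpha : homeo (circle R),
      thompsonT R alpha -> alpha <> 1%g ->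
      exists gamma : homeo (circle R), thompsonT R gamma /\
        generated [set alpha; (zeta ^ gamma)%g]%classic = thompsonT R.
Proof.
have [z hz] := pl_spread R; exists (circle_homeo z); split; first exact: circle_homeo_thompson.
move=> alpha /lift_exists[A ->] nA.
have [|g hg] := hz A.
  apply: contrapT => h; apply: nA; apply: circle_homeo1 => x; apply: contrapT => h'.
  by apply: h; exists x => m e; apply: h'; exists m.
exists (circle_homeo g); split; first exact: circle_homeo_thompson.
apply/seteqP; split.
  apply: smallest_sub.
    apply/group_closedE; split.
    - by rewrite -(@circle_homeo1 R 1%g) ?pl1; [exact: circle_homeo_thompson|exists 0; rewrite mulr0 addr0].
    - by move=> _ _ /lift_exists[p ->] /lift_exists[q ->]; rewrite -circle_homeoM; exact: circle_homeo_thompson.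
    - by move=> _ /lift_exists[p ->]; rewrite -circle_homeoV; exact: circle_homeo_thompson.
  by move=> _ [->|->]; rewrite -?circle_homeoJ; exact: circle_homeo_thompson.
move=> _ /lift_exists[k ->] H [/group_closedE[H1 HM HV] subH].
have := hg [set q | H (circle_homeo q)]; apply.
- split=> /=; first by rewrite circle_homeo1 // => x; exists 0; rewrite mulr0 addr0.
    by move=> p q hp hq; rewrite circle_homeoM; exact: HM.
  by move=> p hp; rewrite circle_homeoV; exact: HV.
- by move=> t tE /=; rewrite circle_homeo1 // => x; exists 1; rewrite mulr1.
- by apply: subH; left.
- by rewrite /= circle_homeoJ; apply: subH; right.
Qed.
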